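(* Let $L\in\mathbb{Q}[z]\langle\partial_z\rangle$ be a linear differential operator and let sufficiently many initial conditions be given, i.e. a truncated power series $f_0$ specifying a unique solution $f\in\mathbb{Q}[[z]]$ of $L(f)=0$. Consider the procedure $\mathsf{GBTest}(L,f_0)$ described in the context, whose output is $\mathsf{T}$ or $\mathsf{A}$. Then: (1) Every output $\mathsf{T}$ is unconditionally correct: if $\mathsf{GBTest}(L,f_0)$ returns $\mathsf{T}$, then $f$ is transcendental. (2) If $f$ is globally bounded, then, assuming the Christol–André hypothesis (CA) stated in the context, every output $\mathsf{A}$ is also correct: if $\mathsf{GBTest}(L,f_0)$ returns $\mathsf{A}$, then $f$ is algebraic.
   Context: A power series $f\in\mathbb{Q}[[z]]$ is algebraic if $P(z,f(z))=0$ for some $P\in\mathbb{Q}[x,y]\setminus\{0\}$; otherwise it is transcendental. It is D-finite if it is annihilated by a nonzero linear differential operator with coefficients in $\mathbb{Q}[z]$. A power series $f=\sum_{n\ge0}a_nz^n\in\mathbb{Q}[[z]]$ is globally bounded if it has a nonzero and finite radius of convergence and there exists a positive integer $C$ such that $a_nC^n\in\mathbb{Z}$ for all $n\ge1$. $\mathbb{Q}[z]\langle\partial_z\rangle$ and $\mathbb{Q}(z)\langle\partial_z\rangle$ are the rings of linear differential operators in $\partial_z=\frac{d}{dz}$ with coefficients in $\mathbb{Q}[z]$ and $\mathbb{Q}(z)$. $L^{\min}_f$ denotes the monic operator of minimal order in $\mathbb{Q}(z)\langle\partial_z\rangle$ that annihilates $f$; it can be computed from $(L,f_0)$ by a known algorithm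 (Bostan–Rivoal–Salvy). Hypothesis (CA) (Part (3) of a conjecture of Christol and André): for every globally bounded and D-finite power series $g\in\mathbb{Q}[[z]]$, if $L^{\min}_g$ admits a logarithm-free fundamental system (a full basis of formal local solutions not involving $\log z$) at $z=0$, then $g$ is algebraic. The finite singularities of an operator $a_r\partial_z^r+\cdots+a_0$ ($a_r\ne0$) are the points of $\overline{\mathbb{Q}}$ where some $a_i/a_r$ has a pole; infinity is a singularity when $0$ is a singularity of the equation obtained by the change of variables $z\mapsto 1/z$. The indicial polynomial at a point $s$ is the usual one (its roots are the local exponents at $s$); it has degree equal to the order of the operator exactly when $s$ is an ordinary or regular singular point. A formal solution at $z=0$ is a local solution in generalized series in $z$, possibly involving powers of $\log z$. Procedure $\mathsf{GBTest}(L,f_0)$: 1. Compute $M:=L^{\min}_f$. 2. For each singularity $s$ of $M$: (a) let $P$ be the indicial polynomial of $M$ at $z=s$; if $\deg P<\operatorname{ord}(M)$, return $\mathsf{T}$; (b) let $Z$ be the set of distinct rational zeros of $P$; if $\operatorname{card} Z<\deg P$, return $\mathsf{T}$; (c) let $D=\{|z_i-z_j| : z_i,z_j\in Z\}\cap\mathbb{N}_{>0}$; if $s=0$ and $D\neq\emptyset$, compute a basis $B$ of formal solutions of $M$ at $z=s$ truncated at order $\max(D)$, and if $B$ contains logarithms, return $\mathsf{T}$. 3. Return $\mathsf{A}$. *)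

(* Defs.v *)
From HB Require Import structures.
From mathcomp Require Import all_boot all_order all_algebra all_field.
From mathcomp Require Import Rstruct.
From Coquelicot Require Rbar PSeries.

Set Implicit Arguments.
Unset Strict Implicit.
Unset Printing Implicit Defensive.

Import Order.TTheory GRing.Theory Num.Theory.
Local Open Scope ring_scope.
Local Open Scope quotient_scope.

(* [algC] plays the role of the algebraic closure of Q.                       *)

(** * Power series over Q *)

Definition series := nat -> rat.

Definition series_of_poly (p : {poly rat}) : series := fun n => p`_n.

Definition series_mul (f g : series) : series :=
  fun n => \sum_(i < n.+1) f i * g (n - i)%N.

Definition series_exp (f : series) (k : nat) : series :=
  iter k (series_mul f) (series_of_poly 1).

Definition series_deriv (f : series) : series := fun n => f n.+1 *+ n.+1.

(* [P : {poly {poly rat}}] is a polynomial in y with coefficients in Q[x].    *)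
Definition algebraic (f : series) : Prop :=
  exists P : {poly {poly rat}}, P != 0 /\
    forall n, \sum_(i < size P)
      series_mul (series_of_poly P`_i) (series_exp f i) n = 0.

Definition transcendental (f : series) : Prop := ~ algebraic f.

Definition globally_bounded (f : series) : Prop :=
  (exists2 r : Rdefinitions.R, 0 < r
     & PSeries.CV_radius (fun n => ratr (f n) : Rdefinitions.R)
       = Rbar.Finite r) /\
  exists C : nat, (0 < C)%N /\
    forall n, (1 <= n)%N -> f n * C%:R ^+ n \is a Num.int.

(** * Differential operators *)

(* The operator sum_i a_i d^i is represented by the list of its coefficients, *)
(* i.e. by the polynomial sum_i a_i 'X^i.  Only the additive structure and    *)
(* the left scaling of {poly _} agree with those of the operators: its        *)
(* product is not their composition.                                          *)
Definition pdiffop (F : fieldType) := {poly {poly F}}.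
Definition rdiffop (F : fieldType) := {poly {fraction {poly F}}}.

Definition ord (F : fieldType) (M : rdiffop F) : nat := (size M).-1.

Definition op_apply (L : pdiffop rat) (f : series) : series :=
  fun n => \sum_(i < size L)
    series_mul (series_of_poly L`_i) (iter i series_deriv f) n.

Definition annihilates (L : pdiffop rat) (f : series) : Prop :=
  forall n, op_apply L f n = 0.

Definition D_finite (f : series) : Prop :=
  exists L : pdiffop rat, L != 0 /\ annihilates L f.

(* [L] is obtained from [M] by multiplying on the left by a common            *)
(* denominator of its coefficients.                                           *)
Definition clears_denominators (M : rdiffop rat) (L : pdiffop rat) : Prop :=
  exists2 d : {poly rat}, d != 0
    & map_poly (@tofrac {poly rat}) L = tofrac d *: M.

Definition rannihilates (M : rdiffop rat) (f : series) : Prop :=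
  exists2 L, clears_denominators M L & annihilates L f.

Definition is_Lmin (f : series) (M : rdiffop rat) : Prop :=
  [/\ M \is monic, rannihilates M f
    & forall M' : rdiffop rat, M' != 0 -> rannihilates M' f ->
        (ord M <= ord M')%N].

(** * Formal solutions at the origin *)

(* [y : gseries] stands for the formal sum over the exponents e of            *)
(* z^e * (y e)(log z); [y e] is a polynomial in log z.                        *)
Definition gseries := algC -> {poly algC}.

(* Membership in z^rho algC[[z]][log z] for some rho.                         *)
Definition generalized_series (y : gseries) : Prop :=
  (exists rho : algC, forall e, y e != 0 -> e - rho \is a Num.nat) /\
  (exists K : nat, forall e, (size (y e) <= K)%N).

(* d/dz (z^e p(log z)) = z^(e-1) (e p + p')(log z).                           *)
Definition gderiv (y : gseries) : gseries :=
  fun e => (e + 1) *: y (e + 1) + (y (e + 1))^`().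

Definition gscale (p : {poly rat}) (y : gseries) : gseries :=
  fun e => \sum_(j < size p) ratr p`_j *: y (e - j%:R).

Definition gapply (L : pdiffop rat) (y : gseries) : gseries :=
  fun e => \sum_(i < size L) gscale L`_i (iter i gderiv y) e.

Definition formal_solution (M : rdiffop rat) (y : gseries) : Prop :=
  generalized_series y /\
  exists2 L, clears_denominators M L & forall e, gapply L y e = 0.

Definition log_free (y : gseries) : Prop := forall e, (size (y e) <= 1)%N.

Definition linearly_independent (r : nat) (B : 'I_r -> gseries) : Prop :=
  forall c : 'I_r -> algC,
    (forall e, \sum_i c i *: B i e = 0) -> forall i, c i = 0.

Definition fundamental_system (M : rdiffop rat) (B : 'I_(ord M) -> gseries) :
    Prop :=
  (forall i, formal_solution M (B i)) /\ linearly_independent B.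

Arguments fundamental_system : clear implicits.

Definition has_log_free_fundamental_system (M : rdiffop rat) : Prop :=
  exists2 B : 'I_(ord M) -> gseries,
    fundamental_system M B & forall i, log_free (B i).

Definition Christol_Andre : Prop :=
  forall (g : series) (M : rdiffop rat),
    globally_bounded g -> D_finite g -> is_Lmin g M ->
    has_log_free_fundamental_system M -> algebraic g.

(* y = z^e (p_0(log z) + p_1(log z) z + p_2(log z) z^2 + ...), p_0 != 0.      *)
Definition leading_exponent (e : algC) (y : gseries) : Prop :=
  y e != 0 /\ forall x, y x != 0 -> x - e \is a Num.nat.

(* With y as above, t = z^e (p_0(log z) + ... + p_m(log z) z^m): the order of *)
(* truncation is counted from the leading exponent, and is included.          *)
Definition truncated_at (m : nat) (y t : gseries) : Prop :=
  exists2 e, leading_exponent e y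
    & forall x, t x = if (x - e \is a Num.nat) && (x - e <= m%:R) then y x
                      else 0.

Definition truncated_fundamental_system (M : rdiffop rat) (m : nat)
    (T : 'I_(ord M) -> gseries) : Prop :=
  exists2 B : 'I_(ord M) -> gseries,
    fundamental_system M B & forall i, truncated_at m (B i) (T i).

Arguments truncated_fundamental_system : clear implicits.

(** * Local data at the points of the projective line *)

(* [Some s] is the finite point s, [None] is the point at infinity.           *)
Definition point := option algC.

(* The rational function x(u).                                                *)
Definition rat_subst (u : {fraction {poly algC}}) (x : {fraction {poly rat}}) :
    {fraction {poly algC}} :=
  let ev (p : {poly rat}) :=
    (map_poly (fun c : rat => tofrac (ratr c : algC)%:P) p).[u] in
  ev \n_(repr x) / ev \d_(repr x).

(* Coefficients of the composition power (- w^2 d/dw)^i; under z = 1/w one    *)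
(* has d/dz = - w^2 d/dw.                                                     *)
Definition inv_deriv_exp (i : nat) : pdiffop algC :=
  iter i (fun T => (- 'X^2) *: (map_poly (@deriv algC) T + T * 'X)) 1.

(* The operator in the local variable w at s: z = s + w or z = 1/w.           *)
Definition localize (s : point) (M : rdiffop rat) : rdiffop algC :=
  match s with
  | Some c => map_poly (rat_subst (tofrac ('X + c%:P))) M
  | None => \sum_(i < size M) rat_subst (tofrac 'X)^-1 M`_i *:
              map_poly (@tofrac {poly algC}) (inv_deriv_exp i)
  end.

(* Valuation at 0, and coefficient of z^(val0 x) in the Laurent expansion of  *)
(* x at 0; both are meaningful only for x != 0.                               *)
Definition val0 (x : {fraction {poly algC}}) : int :=
  (mup 0 \n_(repr x))%:Z - (mup 0 \d_(repr x))%:Z.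

Definition lc0 (x : {fraction {poly algC}}) : algC :=
  (\n_(repr x))`_(mup 0 \n_(repr x)) / (\d_(repr x))`_(mup 0 \d_(repr x)).

Definition pole0 (x : {fraction {poly algC}}) : bool :=
  (x != 0) && (val0 x < 0).

Definition singular0 (N : rdiffop algC) : bool :=
  [exists i : 'I_(size N), pole0 (N`_i / lead_coef N)].

(* N(z^rho) = z^(rho + mu) (P(rho) + O(z)), where mu is the minimum of        *)
(* val0 a_i - i over the nonzero coefficients a_i of N; only the i reaching   *)
(* this minimum contribute to P.                                              *)
Definition indicial0 (N : rdiffop algC) : {poly algC} :=
  \sum_(i < size N | (N`_i != 0) &&
          [forall j : 'I_(size N), (N`_j != 0) ==>
             (val0 N`_i - (i : nat)%:Z <= val0 N`_j - (j : nat)%:Z)])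
    lc0 N`_i *: \prod_(k < i) ('X - (k%:R)%:P).

Definition singularity (M : rdiffop rat) (s : point) : bool :=
  singular0 (localize s M).

Definition indicial (M : rdiffop rat) (s : point) : {poly algC} :=
  indicial0 (localize s M).

Definition deg (p : {poly algC}) : nat := (size p).-1.

(** * The procedure GBTest *)

Inductive verdict := OutT | OutA.

Definition enumerates (T : eqType) (P : T -> Prop) (s : seq T) : Prop :=
  uniq s /\ forall x, x \in s <-> P x.

Definition rational_zeros (P : {poly algC}) (Z : seq rat) : Prop :=
  enumerates (fun q : rat => root P (ratr q)) Z.

Definition exponent_gaps (Z : seq rat) : seq nat :=
  [seq Num.truncn d | d <- [seq `|a - b| | a <- Z, b <- Z]
                    & (d \is a Num.nat) && (0 < d)].

Definition max_gap (Z : seq rat) : nat := \max_(d <- exponent_gaps Z) d.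

(* Possible outcomes of the body of the loop at the singularity s: [None] if  *)
(* it runs to its end, [Some OutT] if the procedure returns T.  The relation  *)
(* allows for every choice of the basis computed in step (c).  That step is   *)
(* only reached when s is a regular singular point, where the bases of formal *)
(* solutions have exactly [ord M] elements.                                   *)
Inductive loop_body (M : rdiffop rat) (s : point) : option verdict -> Prop :=
| Body_irregular :
    (deg (indicial M s) < ord M)%N ->
    loop_body M s (Some OutT)
| Body_exponents Z :
    (ord M <= deg (indicial M s))%N ->
    rational_zeros (indicial M s) Z ->
    (size Z < deg (indicial M s))%N ->
    loop_body M s (Some OutT)
| Body_logs Z B :
    (ord M <= deg (indicial M s))%N ->
    rational_zeros (indicial M s) Z ->
    (deg (indicial M s) <= size Z)%N ->
    s = Some 0 -> exponent_gaps Z <> [::] ->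
    truncated_fundamental_system M (max_gap Z) B ->
    ~ (forall i, log_free (B i)) ->
    loop_body M s (Some OutT)
| Body_no_logs Z B :
    (ord M <= deg (indicial M s))%N ->
    rational_zeros (indicial M s) Z ->
    (deg (indicial M s) <= size Z)%N ->
    s = Some 0 -> exponent_gaps Z <> [::] ->
    truncated_fundamental_system M (max_gap Z) B ->
    (forall i, log_free (B i)) ->
    loop_body M s None
| Body_skip Z :
    (ord M <= deg (indicial M s))%N ->
    rational_zeros (indicial M s) Z ->
    (deg (indicial M s) <= size Z)%N ->
    ~ (s = Some 0 /\ exponent_gaps Z <> [::]) ->
    loop_body M s None.

Inductive loop (M : rdiffop rat) : seq point -> verdict -> Prop :=
| Loop_end : loop M [::] OutA
| Loop_return s ss v :
    loop_body M s (Some v) -> loop M (s :: ss) v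
| Loop_next s ss v :
    loop_body M s None -> loop M ss v -> loop M (s :: ss) v.

(* A truncated power series is the list of its coefficients: [f0] is known    *)
(* modulo z^(size f0).                                                        *)
Definition starts_with (f0 : seq rat) (f : series) : Prop :=
  forall n, (n < size f0)%N -> f n = f0`_n.

Definition specifies (L : pdiffop rat) (f0 : seq rat) (f : series) : Prop :=
  [/\ annihilates L f, starts_with f0 f
    & forall g, annihilates L g -> starts_with f0 g -> g =1 f].

(* [GBTest L f0 v]: some run of the procedure on (L, f0) outputs v; the order *)
(* in which the singularities are visited is arbitrary.                       *)
Definition GBTest (L : pdiffop rat) (f0 : seq rat) (v : verdict) : Prop :=
  exists (f : series) (M : rdiffop rat) (ss : seq point),
    [/\ specifies L f0 f, is_Lmin f M, enumerates (singularity M) ss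
      & loop M ss v].

(* Main.v *)
From HB Require Import structures.
Require Import Defs.
From mathcomp Require Import all_boot all_order all_algebra all_field.
From mathcomp Require Import boolp ring zify.

Set Implicit Arguments.
Unset Strict Implicit.
Unset Printing Implicit Defensive.

Import Order.TTheory GRing.Theory Num.Theory.
Local Open Scope ring_scope.
Local Open Scope quotient_scope.

(** Let M be the minimal operator of f, and r its order.

    Suppose that f is algebraic, with minimal polynomial P over Q(z).  At every
    point of the projective line P splits over a field of Laurent series in a
    root t of a local parameter w: this is Puiseux's theorem [puiseux],
    deduced from Hensel's lemma.  A root g of P satisfies the same differential
    relations over Q(z) as f, so that M annihilates all the roots; and since
    f, f', ..., f^(r-1) are independent over Q(z), the matrix of the first r
    derivatives of the roots is a matrix of full rank times an invertible
    Vandermonde matrix, hence has rank r [conjugate_solutions].  The roots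
    thus span, over the constants, a space of dimension at least r of solutions
    of M in Laurent series in t, without any appeal to Galois theory.

    The leading exponent, in w, of a nonzero element of this space is a
    rational root of the indicial polynomial.  Hence such an element is determined by
    its coefficients at the rational roots, and there are at least r of these
    [local_exponents].  The indicial polynomial has degree at most r, so it has
    degree r and r distinct rational roots [algebraic_exponents]: the first two
    tests never return T.  As for the third one, let y be any formal solution at
    the origin.  Some element g of the space has the constant terms of y at all
    the exponents.  If y - g were nonzero, its leading exponent would be a
    simple root of the indicial polynomial, where leading coefficients are
    free of logarithms, and the constant term of y - g there is zero; so y = g
    and y is free of logarithms [algebraic_log_free].

    Conversely, an outcome A provides a fundamental system without logarithms
    at the origin, to which the conjecture of Christol and Andre applies.  The
    coefficient y_e of z^e in a solution, a polynomial in log z, satisfies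
    P(e + D) y_e = (a combination of earlier coefficients), where P is now the
    indicial polynomial and D the derivation with respect to log z.  This equation
    can be solved within the constants unless P(e) = 0, and it creates no
    logarithm unless P(e) = 0.  So the basis inspected by the procedure is free of
    logarithms as soon as its truncation is [truncation_log_free], and a
    basis is obtained by Frobenius' method when no two exponents differ by
    a positive integer [no_gap_log_free], or when the origin is an ordinary
    point [ordinary_log_free]. *)

(** * Fields of fractions *)

Lemma frac_repr (R : idomainType) (x : {fraction R}) :
  x = tofrac \n_(repr x) / tofrac \d_(repr x).
Proof.
have d0 := denom_ratioP (repr x).
apply: (canRL (mulfK _)); first by rewrite tofrac_eq0.
rewrite -{1}[x]reprK; move: (repr x) d0 => r d0; unlock tofrac.
rewrite !piE; apply/eqmodP; rewrite /= /FracField.equivf /FracField.mulf.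
by rewrite !numden_Ratio ?mulf_neq0 ?oner_eq0 // !mulr1 mulrC.
Qed.

Lemma fracP (R : idomainType) (x : {fraction R}) :
  exists a b, b != 0 /\ x = tofrac a / tofrac b.
Proof.
by exists \n_(repr x), \d_(repr x); split; [exact: denom_ratioP|exact: frac_repr].
Qed.

Lemma eq_frac (R : idomainType) (a b c d : R) : b != 0 -> d != 0 ->
  (tofrac a / tofrac b == tofrac c / tofrac d) = (a * d == c * b).
Proof.
by move=> b0 d0; rewrite eqr_div ?tofrac_eq0 // -!rmorphM /= tofrac_eq.
Qed.

Lemma tofrac_inj (R : idomainType) : injective (@tofrac R).
Proof. by move=> a b /eqP; rewrite tofrac_eq => /eqP. Qed.

Lemma size_map_tofrac (R : idomainType) (p : {poly R}) :
  size (map_poly (@tofrac R) p) = size p.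
Proof. exact: size_map_inj_poly (@tofrac_inj R) (tofrac0 R) p. Qed.

Section FracExt.
Variables (R : idomainType) (K : fieldType) (phi : {rmorphism R -> K}).

(** The morphism depends on the proof of injectivity so that the structure of
    ring morphism can be inferred from the term. *)
Definition frac_ext (_ : injective phi) (x : {fraction R}) : K :=
  phi \n_(repr x) / phi \d_(repr x).

Hypothesis phi_inj : injective phi.

Let phi_eq0 a : (phi a == 0) = (a == 0).
Proof. by rewrite -(rmorph0 phi) (inj_eq phi_inj). Qed.

Lemma frac_ext_div a b : b != 0 ->
  frac_ext phi_inj (tofrac a / tofrac b) = phi a / phi b.
Proof.
move=> b0; set x := _ / _; have d0 := denom_ratioP (repr x).
have /eqP := frac_repr x; rewrite {1}/x eq_frac // => /eqP h.
by apply/eqP; rewrite eqr_div ?phi_eq0 // -!rmorphM h.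
Qed.

Lemma frac_ext_tofrac a : frac_ext phi_inj (tofrac a) = phi a.
Proof.
by rewrite -[tofrac a]divr1 -tofrac1 frac_ext_div ?oner_eq0 // rmorph1 divr1.
Qed.

Fact frac_ext_zmod_morphism : zmod_morphism (frac_ext phi_inj).
Proof.
move=> x y; have [a [b [b0 ->]]] := fracP x; have [c [d [d0 ->]]] := fracP y.
rewrite -mulNr -rmorphN addf_div ?tofrac_eq0 // -!rmorphM -rmorphD /=.
rewrite !frac_ext_div ?mulf_neq0 // rmorphD !rmorphM rmorphN -addf_div ?phi_eq0 //.
by rewrite mulNr.
Qed.

Fact frac_ext_monoid_morphism : monoid_morphism (frac_ext phi_inj).
Proof.
split; first by rewrite -tofrac1 frac_ext_tofrac rmorph1.
move=> x y; have [a [b [b0 ->]]] := fracP x; have [c [d [d0 ->]]] := fracP y.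
by rewrite mulf_div -!rmorphM /= !frac_ext_div ?mulf_neq0 // !rmorphM mulf_div.
Qed.

HB.instance Definition _ := GRing.isZmodMorphism.Build _ _
  (frac_ext phi_inj) frac_ext_zmod_morphism.
HB.instance Definition _ := GRing.isMonoidMorphism.Build _ _
  (frac_ext phi_inj) frac_ext_monoid_morphism.

End FracExt.

(** * Derivations *)

Definition derivation (R : nzRingType) (d : R -> R) : Prop :=
  (forall x y, d (x + y) = d x + d y) /\
  (forall x y, d (x * y) = d x * y + x * d y).

Section Derivation.
Variables (R : comNzRingType) (d : R -> R).
Hypothesis der : derivation d.

Lemma derivationD x y : d (x + y) = d x + d y. Proof. exact: (proj1 der). Qed.
Lemma derivationM x y : d (x * y) = d x * y + x * d y. Proof. exact: (proj2 der). Qed.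

Lemma derivation0 : d 0 = 0.
Proof. by apply: (addrI (d 0)); rewrite -derivationD !addr0. Qed.

Lemma derivation1 : d 1 = 0.
Proof.
by apply: (addrI (d 1)); rewrite addr0 -[in RHS](mul1r 1) derivationM mulr1 mul1r.
Qed.

Lemma derivation_sum I (r : seq I) (P : pred I) (F : I -> R) :
  d (\sum_(i <- r | P i) F i) = \sum_(i <- r | P i) d (F i).
Proof. exact: (big_morph d derivationD derivation0). Qed.

Lemma derivationX x n : d (x ^+ n) = x ^+ n.-1 * d x *+ n.
Proof.
elim: n => [|[|n] IH]; first by rewrite expr0 derivation1 mulr0n.
  by rewrite expr1 expr0 mul1r.
rewrite exprS derivationM IH /= mulrnAr mulrA -exprS mulrC.
by rewrite [RHS]mulrS.
Qed.

Lemma scale_derivation c : derivation (fun x => c * d x).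
Proof.
split=> x y; first by rewrite derivationD mulrDr.
by rewrite derivationM mulrDr !mulrA (mulrC c x).
Qed.

End Derivation.

Lemma derivationV (K : fieldType) (d : K -> K) (der : derivation d) (x : K) :
  x != 0 -> d x^-1 = - d x / x ^+ 2.
Proof.
move=> x0; have : d (x * x^-1) = 0 by rewrite divff ?derivation1.
rewrite derivationM // => /eqP; rewrite addrC addr_eq0 => /eqP h.
apply: (mulfI x0); rewrite h; field; exact: x0.
Qed.

Lemma derivation_poly_deriv (R : comNzRingType) : derivation (@deriv R).
Proof. by split=> p q; rewrite (derivD, derivM). Qed.

(** The chain rule: a derivation that kills the constants is determined on
    polynomials by its value at the variable. *)
Lemma deriv_rmorph_poly (F : comNzRingType) (K : comNzRingType) (d : K -> K)
    (der : derivation d) (phi : {rmorphism {poly F} -> K}) :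
  (forall c, d (phi c%:P) = 0) ->
  forall p, d (phi p) = d (phi 'X) * phi p^`().
Proof.
move=> dC p; elim/poly_ind: p => [|p c IH]; first by rewrite linear0 rmorph0 derivation0 // mulr0.
rewrite rmorphD rmorphM derivationD // derivationM // dC addr0 IH derivD derivM derivX derivC.
by rewrite addr0 mulr1 rmorphD rmorphM; ring.
Qed.

Fact quotient_rule_cross (K : comNzRingType) (A B N M b m x : K) :
  N * b + x * m * B = A * m + x * b * M -> (N - x * M) * b = (A - x * B) * m.
Proof.
by move/eqP; rewrite -subr_eq0 => /eqP h; apply/eqP; rewrite -subr_eq0 -h; apply/eqP; ring.
Qed.

Fact quotient_rule_add (K : fieldType) (a b c e A B C E : K) :
  b != 0 -> e != 0 ->
  (A * e + a * E + (C * b + c * B) - (a / b + c / e) * (B * e + b * E)) / (b * e)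
    = (A - a / b * B) / b + (C - c / e * E) / e.
Proof. by move=> b0 e0; field; rewrite b0 e0. Qed.

Fact quotient_rule_mul (K : fieldType) (a b c e A B C E : K) :
  b != 0 -> e != 0 ->
  (A * c + a * C - a / b * (c / e) * (B * e + b * E)) / (b * e)
    = (A - a / b * B) / b * (c / e) + a / b * ((C - c / e * E) / e).
Proof. by move=> b0 e0; field; rewrite b0 e0. Qed.

Section FracDeriv.
Variables (R : idomainType) (d : R -> R).

Definition frac_deriv (x : {fraction R}) : {fraction R} :=
  (tofrac (d \n_(repr x)) - x * tofrac (d \d_(repr x))) / tofrac \d_(repr x).

Hypothesis der : derivation d.

Lemma frac_deriv_div x a b : b != 0 -> x = tofrac a / tofrac b ->
  frac_deriv x = (tofrac (d a) - x * tofrac (d b)) / tofrac b.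
Proof.
move=> b0 xE; rewrite /frac_deriv.
have m0 := denom_ratioP (repr x); have xE' := frac_repr x.
set n := \n_(repr x) in xE' *; set m := \d_(repr x) in m0 xE' *.
move: n m m0 xE' => n m m0 xE'.
have ba : tofrac a = x * tofrac b by rewrite xE divfK ?tofrac_eq0.
have mn : tofrac n = x * tofrac m by rewrite xE' divfK ?tofrac_eq0.
have /eqP : tofrac n / tofrac m = tofrac a / tofrac b by rewrite -xE -xE'.
rewrite eq_frac // => /eqP /(congr1 d).
rewrite !(derivationM der).
move=> /(congr1 (@tofrac R)).
rewrite !tofracD.
rewrite !tofracM.
rewrite ba mn => h.
apply/eqP; rewrite eqr_div ?tofrac_eq0 //; apply/eqP.
exact: quotient_rule_cross h.
Qed.

Lemma frac_deriv_tofrac a : frac_deriv (tofrac a) = tofrac (d a).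
Proof.
rewrite (@frac_deriv_div _ a 1) ?oner_eq0 ?tofrac1 ?divr1 //.
by rewrite derivation1 // rmorph0 mulr0 subr0.
Qed.

Lemma derivation_frac_deriv : derivation frac_deriv.
Proof.
split=> x y; have [a [b [b0 xE]]] := fracP x; have [c [e [e0 yE]]] := fracP y.
- have hs : x + y = tofrac (a * e + c * b) / tofrac (b * e).
    by rewrite xE yE addf_div ?tofrac_eq0 // rmorphD !rmorphM.
  rewrite (frac_deriv_div b0 xE) (frac_deriv_div e0 yE).
  rewrite (frac_deriv_div _ hs) ?mulf_neq0 // (derivationD der).
  rewrite !(derivationM der) !tofracD !tofracM xE yE.
  by apply: quotient_rule_add; rewrite tofrac_eq0.
- have hs : x * y = tofrac (a * c) / tofrac (b * e).
    by rewrite xE yE mulf_div !rmorphM.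
  rewrite (frac_deriv_div b0 xE) (frac_deriv_div e0 yE).
  rewrite (frac_deriv_div _ hs) ?mulf_neq0 //.
  rewrite !(derivationM der) !tofracD !tofracM xE yE.
  by apply: quotient_rule_mul; rewrite tofrac_eq0.
Qed.

End FracDeriv.

(** By the quotient rule, two derivations that agree on a domain agree on its
    field of fractions. *)
Lemma frac_rmorph_deriv (R : idomainType) (K : fieldType)
    (psi : {rmorphism {fraction R} -> K}) (d : R -> R) (dK : K -> K) :
  derivation d -> derivation dK ->
  (forall a, dK (psi (tofrac a)) = psi (tofrac (d a))) ->
  forall x, dK (psi x) = psi (frac_deriv d x).
Proof.
move=> der derK h x; have [a [b [b0 xE]]] := fracP x.
have p0 : psi (tofrac b) != 0 by rewrite fmorph_eq0 tofrac_eq0.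
have E : psi x * psi (tofrac b) = psi (tofrac a).
  by rewrite -rmorphM xE divfK ?tofrac_eq0.
have := congr1 dK E; rewrite (derivationM derK) !h => /eqP.
rewrite -subr_eq0 -addrA addr_eq0 => /eqP E'.
apply: (mulIf p0); rewrite E' (frac_deriv_div der b0 xE).
by rewrite -[RHS]rmorphM divfK ?tofrac_eq0 // rmorphB rmorphM opprB.
Qed.

(** * Formal power series *)

(** Course-of-values recursion. *)
Lemma recursive_sequence (T : Type) (x0 : T) (G : nat -> (nat -> T) -> T) :
  (forall n u v, (forall i, (i < n)%N -> u i = v i) -> G n u = G n v) ->
  exists u, forall n, u n = G n u.
Proof.
move=> Gext; pose pre := fix pre n : seq T :=
  if n is m.+1 then rcons (pre m) (G m (nth x0 (pre m))) else [::].
pose u n := G n (nth x0 (pre n)).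
have uE n : mkseq u n = pre n by elim: n => // n IH; rewrite mkseqS IH.
by exists u => n; apply: Gext => i lt_in; rewrite -uE nth_mkseq.
Qed.

Record fps (F : fieldType) := Fps { fcoef : nat -> F }.

HB.instance Definition _ (F : fieldType) := gen_eqMixin (fps F).
HB.instance Definition _ (F : fieldType) := gen_choiceMixin (fps F).

Section FpsRing.
Variable F : fieldType.
Implicit Types (a b c : fps F) (p q : {poly F}).

Lemma fpsP a b : fcoef a =1 fcoef b -> a = b.
Proof. by case: a b => a [b] /= /funext ->. Qed.

Definition fps_of_poly p : fps F := Fps (fun n => p`_n).
Definition fps_add a b := Fps (fun n => fcoef a n + fcoef b n).
Definition fps_opp a := Fps (fun n => - fcoef a n).
Definition fps_mul a b := Fps (fun n => \sum_(i < n.+1) fcoef a i * fcoef b (n - i)).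

Fact fps_addA : associative fps_add.
Proof. by move=> a b c; apply: fpsP => n; exact: addrA. Qed.
Fact fps_addC : commutative fps_add.
Proof. by move=> a b; apply: fpsP => n; exact: addrC. Qed.
Fact fps_add0 : left_id (fps_of_poly 0) fps_add.
Proof. by move=> a; apply: fpsP => n /=; rewrite coef0 add0r. Qed.
Fact fps_addN : left_inverse (fps_of_poly 0) fps_opp fps_add.
Proof. by move=> a; apply: fpsP => n /=; rewrite coef0 addNr. Qed.

HB.instance Definition _ :=
  GRing.isZmodule.Build (fps F) fps_addA fps_addC fps_add0 fps_addN.

Definition fps_trunc n a : {poly F} := \poly_(i < n) fcoef a i.

Lemma coef_trunc n a i : (i < n)%N -> (fps_trunc n a)`_i = fcoef a i.
Proof. by move=> h; rewrite coef_poly h. Qed.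

(** The coefficients of a product only depend on initial segments, so that the
    ring laws are inherited from polynomials. *)
Lemma fps_mul_poly a b p q n :
  (forall i, (i <= n)%N -> p`_i = fcoef a i) ->
  (forall i, (i <= n)%N -> q`_i = fcoef b i) ->
  fcoef (fps_mul a b) n = (p * q)`_n.
Proof.
move=> hp hq; rewrite coefM /=; apply: eq_bigr => i _.
by rewrite hp ?hq ?leq_subr // -ltnS.
Qed.

Lemma fps_mul_trunc a b m n : (n < m)%N ->
  fcoef (fps_mul a b) n = (fps_trunc m a * fps_trunc m b)`_n.
Proof.
by move=> h; apply: fps_mul_poly => i hi; rewrite coef_trunc // (leq_ltn_trans hi).
Qed.

Fact fps_mulA : associative fps_mul.
Proof.
move=> a b c; apply: fpsP => n.
rewrite (@fps_mul_poly _ _ (fps_trunc n.+1 a) (fps_trunc n.+1 b * fps_trunc n.+1 c)).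
- rewrite mulrA; apply/esym/fps_mul_poly => i hi; last by rewrite coef_trunc.
  by rewrite -(@fps_mul_trunc a b).
- by move=> i hi; rewrite coef_trunc.
- by move=> i hi; rewrite -(@fps_mul_trunc b c).
Qed.

Fact fps_mulC : commutative fps_mul.
Proof. by move=> a b; apply: fpsP => n; rewrite !(@fps_mul_trunc _ _ n.+1) // mulrC. Qed.

Fact fps_mul1 : left_id (fps_of_poly 1) fps_mul.
Proof.
move=> a; apply: fpsP => n.
rewrite (@fps_mul_poly _ _ 1 (fps_trunc n.+1 a)) // ?mul1r ?coef_trunc //.
by move=> i hi; rewrite coef_trunc.
Qed.

Fact fps_mulDl : left_distributive fps_mul fps_add.
Proof.
move=> a b c; apply: fpsP => n /=; rewrite -big_split /=.
by apply: eq_bigr => i _; rewrite mulrDl.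
Qed.

Fact fps_1_neq0 : fps_of_poly 1 != 0.
Proof.
by apply/eqP => /(congr1 (@fcoef F))/(congr1 (@^~ 0%N)) /= /eqP; rewrite coef1 coef0 oner_eq0.
Qed.

HB.instance Definition _ := GRing.Zmodule_isComNzRing.Build (fps F)
  fps_mulA fps_mulC fps_mul1 fps_mulDl fps_1_neq0.

Lemma fcoef0 n : fcoef (0 : fps F) n = 0. Proof. exact: coef0. Qed.
Lemma fcoef1 n : fcoef (1 : fps F) n = (n == 0%N)%:R. Proof. exact: coef1. Qed.
Lemma fcoefD a b n : fcoef (a + b) n = fcoef a n + fcoef b n. Proof. by []. Qed.
Lemma fcoefB a b n : fcoef (a - b) n = fcoef a n - fcoef b n. Proof. by []. Qed.
Lemma fcoefM a b n : fcoef (a * b) n = \sum_(i < n.+1) fcoef a i * fcoef b (n - i).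
Proof. by []. Qed.

Lemma fcoef_sum I (r : seq I) (P : pred I) (G : I -> fps F) n :
  fcoef (\sum_(i <- r | P i) G i) n = \sum_(i <- r | P i) fcoef (G i) n.
Proof. exact: (big_morph (fun a => fcoef a n) (fun a b => fcoefD a b n) (fcoef0 n)). Qed.

Fact fps_of_poly_zmod_morphism : zmod_morphism fps_of_poly.
Proof. by move=> p q; apply: fpsP => n /=; rewrite coefB. Qed.
Fact fps_of_poly_monoid_morphism : monoid_morphism fps_of_poly.
Proof.
by split=> // p q; apply: fpsP => n; rewrite /= coefM.
Qed.
HB.instance Definition _ := GRing.isZmodMorphism.Build _ _ fps_of_poly
  fps_of_poly_zmod_morphism.
HB.instance Definition _ := GRing.isMonoidMorphism.Build _ _ fps_of_poly
  fps_of_poly_monoid_morphism.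

Lemma fps_of_poly_inj : injective fps_of_poly.
Proof. by move=> p q /(congr1 (@fcoef F)) h; apply/polyP => i; have := congr1 (@^~ i) h. Qed.

Lemma fcoefZ (x : F) a n : fcoef (fps_of_poly x%:P * a) n = x * fcoef a n.
Proof.
rewrite fcoefM big_ord_recl /= coefC /= subn0 big1 ?addr0 // => i _.
by rewrite coefC /= mul0r.
Qed.

Definition fps_X : fps F := fps_of_poly 'X.

Lemma fcoefXnM a k n :
  fcoef (fps_X ^+ k * a) n = if (n < k)%N then 0 else fcoef a (n - k).
Proof.
rewrite /fps_X -rmorphXn (@fps_mul_poly _ _ 'X^k (fps_trunc n.+1 a)) //.
  by rewrite coefXnM; case: ltnP => // ?; rewrite coef_trunc // ltnS leq_subr.
by move=> i hi; rewrite coef_trunc.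
Qed.

(** ** Order of vanishing, inverses *)

Lemma fps_order a : a != 0 ->
  exists2 v, fcoef a v != 0 & forall i, (i < v)%N -> fcoef a i = 0.
Proof.
move=> a0; have ex : exists n, fcoef a n != 0.
  apply: contrapT => h; case/eqP: a0; apply: fpsP => n; rewrite fcoef0.
  by apply/eqP; apply: contrapT => /negP ?; apply: h; exists n.
exists (ex_minn ex); case: ex_minnP => // v _ vmin i lt_iv.
by apply/eqP; apply: contraTT lt_iv => /vmin; rewrite -leqNgt.
Qed.

Lemma fps_factor_X a v : (forall i, (i < v)%N -> fcoef a i = 0) ->
  a = fps_X ^+ v * Fps (fun n => fcoef a (n + v)).
Proof.
move=> h; apply: fpsP => n; rewrite fcoefXnM; case: ltnP => [/h //|le_vn].
by rewrite /= subnK.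
Qed.

Lemma fcoef_mul_order a b v w :
  (forall i, (i < v)%N -> fcoef a i = 0) -> (forall i, (i < w)%N -> fcoef b i = 0) ->
  fcoef (a * b) (v + w) = fcoef a v * fcoef b w.
Proof.
move=> ha hb; have -> : a * b = fps_X ^+ (v + w) *
    (Fps (fun n => fcoef a (n + v)) * Fps (fun n => fcoef b (n + w))).
  by rewrite {1}(fps_factor_X ha) {1}(fps_factor_X hb) mulrACA exprD.
by rewrite fcoefXnM ltnn subnn fcoefM big_ord1.
Qed.

Fact fps_integral a b : a * b = 0 -> (a == 0) || (b == 0).
Proof.
move=> ab0; apply: contrapT => /negP; rewrite negb_or => /andP[/fps_order[v av hv]].
case/fps_order => w bw hw; have := fcoef_mul_order hv hw.
by rewrite ab0 fcoef0 => /esym/eqP; rewrite mulf_eq0 (negPf av) (negPf bw).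
Qed.

(** The coefficients of the inverse are computed one after the other. *)
Lemma fps_left_inverse a : fcoef a 0 != 0 -> exists b, b * a = 1.
Proof.
move=> a0; pose G n (u : nat -> F) :=
  ((n == 0%N)%:R - \sum_(i < n) u i * fcoef a (n - i)) / fcoef a 0.
have [|u uE] := @recursive_sequence F 0 G.
  by move=> n u v h; rewrite /G; congr ((_ - _) / _); apply: eq_bigr => i _; rewrite h.
exists (Fps u); apply: fpsP => n; rewrite fcoefM big_ord_recr /= subnn uE divfK //.
by rewrite addrC subrK coef1.
Qed.

Definition fps_unit : pred (fps F) := fun a => fcoef a 0 != 0.
(** Outside the units the inverse is the identity, as required of the ring
    structures used here. *)
Definition fps_inv a : fps F :=
  match pselect (exists b, b * a = 1) with
  | left h => projT1 (cid h)
  | right _ => a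
  end.

Lemma fcoef0M a b : fcoef (a * b) 0 = fcoef a 0 * fcoef b 0.
Proof. by rewrite fcoefM big_ord1. Qed.

Fact fps_mulVr : {in fps_unit, left_inverse 1 fps_inv *%R}.
Proof.
move=> a ua; rewrite /fps_inv; case: pselect => [h|[]]; last exact: fps_left_inverse.
exact: projT2 (cid h).
Qed.

Fact fps_unitP a b : b * a = 1 -> fps_unit a.
Proof.
move/(congr1 (fun c => fcoef c 0)); rewrite fcoef0M fcoef1 => h.
by apply/eqP => a0; move/eqP: h; rewrite a0 mulr0 eq_sym oner_eq0.
Qed.

Fact fps_inv_out : {in predC fps_unit, fps_inv =1 id}.
Proof.
move=> a /= /negP na; rewrite /fps_inv; case: pselect => // h.
by case: na; case: h => b /fps_unitP.
Qed.

HB.instance Definition _ := GRing.ComNzRing_hasMulInverse.Build (fps F)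
  fps_mulVr fps_unitP fps_inv_out.
HB.instance Definition _ := GRing.ComUnitRing_isIntegral.Build (fps F) fps_integral.

Lemma fps_unitE a : (a \is a GRing.unit) = (fcoef a 0 != 0). Proof. by []. Qed.

Lemma fps_X_neq0 : fps_X != 0.
Proof.
by rewrite -(rmorph0 fps_of_poly) (inj_eq fps_of_poly_inj) polyX_eq0.
Qed.

(** ** Derivation and ramification *)

Definition fps_deriv a : fps F := Fps (fun n => fcoef a n.+1 *+ n.+1).

Lemma derivation_fps_deriv : derivation fps_deriv.
Proof.
split=> a b; first by apply: fpsP => n /=; rewrite mulrnDl.
apply: fpsP => n; have -> : fcoef (fps_deriv (a * b)) n = fcoef (fps_mul a b) n.+1 *+ n.+1 by [].
rewrite (@fps_mul_trunc a b n.+2) // -coef_deriv derivM coefD fcoefD.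
congr (_ + _); apply/esym/fps_mul_poly => i hi.
- by rewrite coef_deriv coef_trunc.
- by rewrite coef_trunc // ltnS (leq_trans hi).
- by rewrite coef_trunc // ltnS (leq_trans hi).
- by rewrite coef_deriv coef_trunc.
Qed.

Lemma fps_deriv_of_poly p : fps_deriv (fps_of_poly p) = fps_of_poly p^`().
Proof. by apply: fpsP => n /=; rewrite coef_deriv. Qed.

(** The substitution of t ^ N.+1 for t; the shift by one keeps it injective
    for every N. *)
Definition ramify (N : nat) a : fps F :=
  Fps (fun n => if (N.+1 %| n)%N then fcoef a (n %/ N.+1) else 0).

Lemma ramify_poly N p : ramify N (fps_of_poly p) = fps_of_poly (p \Po 'X^(N.+1)).
Proof. by apply: fpsP => n /=; rewrite coef_comp_poly_Xn. Qed.

Section Ramify.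
Variable N : nat.

Fact ramify_zmod_morphism : zmod_morphism (ramify N).
Proof. by move=> a b; apply: fpsP => n /=; case: ifP => //; rewrite ?subr0. Qed.

Fact ramify_monoid_morphism : monoid_morphism (ramify N).
Proof.
split; first by rewrite [1 in LHS]/(1) /= ramify_poly comp_polyC.
move=> a b; apply: fpsP => n; pose A c := fps_trunc n.+1 c \Po 'X^(N.+1).
have AE c i : (i <= n)%N -> (A c)`_i = fcoef (ramify N c) i.
  move=> hi; rewrite coef_comp_poly_Xn //=; case: ifP => // _.
  by rewrite coef_trunc // ltnS (leq_trans (leq_div _ _)).
rewrite (fps_mul_poly (AE a) (AE b)) -comp_polyM coef_comp_poly_Xn //=.
by case: ifP => // _; apply: (@fps_mul_trunc a b n.+1); rewrite ltnS leq_div.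
Qed.

HB.instance Definition _ := GRing.isZmodMorphism.Build _ _ (ramify N)
  ramify_zmod_morphism.
HB.instance Definition _ := GRing.isMonoidMorphism.Build _ _ (ramify N)
  ramify_monoid_morphism.

Lemma ramify_inj : injective (ramify N).
Proof.
move=> a b /(congr1 (@fcoef F)) h; apply: fpsP => n.
by have /= := congr1 (@^~ (n * N.+1)%N) h; rewrite dvdn_mull // mulnK.
Qed.

End Ramify.

Lemma ramifyM N1 N2 a :
  ramify N1 (ramify N2 a) = ramify (N1 * N2.+1 + N2) a.
Proof.
have E : (N1 * N2.+1 + N2).+1 = (N1.+1 * N2.+1)%N by lia.
apply: fpsP => n; rewrite /ramify /= E.
case: ifP => [/dvdnP[k ->]|h]; last first.
  by case: ifP => // /(dvdn_trans (dvdn_mulr N2.+1 (dvdnn N1.+1))); rewrite h.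
by rewrite mulnK // (mulnC k) dvdn_pmul2l // divnMl.
Qed.

End FpsRing.

(** * Hensel's lemma *)

Section Hensel.
Variable F : fieldType.

Definition fps_res (a : fps F) : F := fcoef a 0.
Fact fps_res_zmod_morphism : zmod_morphism fps_res. Proof. by []. Qed.
Fact fps_res_monoid_morphism : monoid_morphism fps_res.
Proof. by split=> [|a b]; [exact: fcoef1|exact: fcoef0M]. Qed.
HB.instance Definition _ := GRing.isZmodMorphism.Build _ _ fps_res fps_res_zmod_morphism.
HB.instance Definition _ := GRing.isMonoidMorphism.Build _ _ fps_res fps_res_monoid_morphism.

(** Bezout's identity u g0 + v h0 = 1 gives a solution; reducing u C modulo h0
    makes the degrees of both corrections small. *)
Lemma hensel_step (g0 h0 C : {poly F}) : coprimep g0 h0 -> h0 != 0 ->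
  exists2 gh : {poly F} * {poly F}, g0 * gh.2 + gh.1 * h0 = C &
    (size gh.2 < size h0)%N /\
    (forall n, (size C <= n)%N -> (size g0 + size h0 <= n.+2)%N -> (size gh.1 <= n - (size h0).-1)%N).
Proof.
move=> /Bezout_eq1_coprimepP[[u v] /= uv] h0n.
pose h := (u * C) %% h0; pose g := v * C + g0 * ((u * C) %/ h0).
have E : g0 * h + g * h0 = C.
  rewrite -[RHS]mul1r -uv; have := divp_eq (u * C) h0; rewrite -/h => D.
  rewrite /g mulrDl; transitivity (g0 * (u * C %/ h0 * h0 + h) + v * C * h0); first by ring.
  by rewrite -D; ring.
exists (g, h) => //; split=> /=; first by rewrite ltn_modp.
(* g is also an exact quotient by h0, which bounds its degree. *)
move=> n sC sgh; have -> : g = (C - g0 * h) %/ h0 by rewrite -E addrAC subrr add0r mulpK.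
rewrite size_divp // leq_sub2r //; apply: (leq_trans (size_polyD _ _)).
rewrite geq_max sC size_polyN /=; apply: (leq_trans (size_polyMleq _ _)).
have : (size h < size h0)%N by rewrite ltn_modp.
move: sgh; by move: (size g0) (size h0) (size h) => a b c; lia.
Qed.

(** The factors are lifted coefficient by coefficient in the parameter of the
    power series; at each step the correction has smaller degree than the factor,
    so that the lifted factors keep their degrees. *)
Lemma hensel (P : {poly fps F}) (g0 h0 : {poly F}) :
  P \is monic -> map_poly fps_res P = g0 * h0 -> coprimep g0 h0 ->
  exists G H, [/\ P = G * H, (size G <= size g0)%N & (size H <= size h0)%N].
Proof.
move=> Pm Pgh cop.
have lcP : fps_res (lead_coef P) != 0 by rewrite (monicP Pm) rmorph1 oner_eq0.
have gh0 : g0 * h0 != 0 by rewrite -Pgh -lead_coef_eq0 lead_coef_map_eq.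
have [g0n h0n] : g0 != 0 /\ h0 != 0 by apply/andP; rewrite -negb_or -mulf_eq0.
have sP : size P = (size g0 + size h0).-1.
  by rewrite -size_mul // -Pgh size_map_poly_id0.
pose n := (size P).-1.
pose A k : {poly F} := \poly_(j < size P) fcoef P`_j k.
have AE k j : (A k)`_j = fcoef P`_j k.
  by rewrite coef_poly; case: ltnP => // h; rewrite nth_default ?fcoef0.
have sA k : (0 < k)%N -> (size (A k) <= n)%N.
  move=> k0; apply/leq_sizeP => j; rewrite leq_eqVlt => /predU1P[<-|h]; rewrite AE.
    by rewrite /n -lead_coefE (monicP Pm) fcoef1 (gtn_eqF k0).
  by rewrite nth_default ?fcoef0 //; move: h; rewrite /n; case: (size P).
have step C := hensel_step C cop h0n.
pose lift C := projT1 (cid2 (step C)).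
have lift1 C : g0 * (lift C).2 + (lift C).1 * h0 = C.
  by rewrite /lift; case: cid2.
have lift2 C : (size (lift C).2 < size h0)%N by rewrite /lift; case: cid2 => ? ? [].
have lift3 (C : {poly F}) m : (size C <= m)%N -> (size g0 + size h0 <= m.+2)%N ->
    (size (lift C).1 <= m - (size h0).-1)%N.
  by rewrite /lift; case: cid2 => ? ? [_ h] /=; exact: h.
(* The equation at t^k is g0 h_k + g_k h0 = rest k. *)
pose rest k (u : nat -> {poly F} * {poly F}) :=
  A k - \sum_(i < k.+1 | (0 < i < k)%N) (u i).1 * (u (k - i)%N).2.
pose Q k u := if k == 0%N then (g0, h0) else lift (rest k u).
have [|u uE] := @recursive_sequence _ (g0, h0) Q.
  move=> k u v h; rewrite /Q /rest; congr (if _ then _ else lift (_ - _)).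
  apply: eq_bigr => i /andP[i0 ik]; rewrite !h //; lia.
have u0 : u 0%N = (g0, h0) by rewrite uE.
have uS k : (0 < k)%N -> u k = lift (rest k u) by rewrite {1}uE /Q; case: k.
have g0p : (0 < size g0)%N by rewrite size_poly_gt0.
have h0p : (0 < size h0)%N by rewrite size_poly_gt0.
have su k : (0 < k)%N -> (size (u k).1 < size g0)%N /\ (size (u k).2 < size h0)%N.
  elim/ltn_ind: k => k IH k0; rewrite (uS k k0); split; last exact: lift2.
  apply: (leq_ltn_trans (lift3 _ n _ _)); last 2 first.
  - by rewrite /n sP; move: (size g0) (size h0) g0p h0p => a b; lia.
  - by rewrite /n sP; move: (size g0) (size h0) g0p h0p => a b; lia.
  apply: (leq_trans (size_polyD _ _)); rewrite geq_max size_polyN sA //=.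
  apply: (leq_trans (size_sum _ _ _)); apply/bigmax_leqP => i /andP[i0 ik].
  apply: (leq_trans (size_polyMleq _ _)).
  have [||a _] := IH i => //; have [||_ b] := IH (k - i)%N; rewrite ?subn_gt0 //; first lia.
  rewrite /n sP; move: (size _) (size _) (size _) (size _) a b => *; lia.
have conv k : \sum_(i < k.+1) (u i).1 * (u (k - i)%N).2 = A k.
  case: (posnP k) => [->|k0].
    rewrite big_ord1 subnn u0 /= -Pgh; by apply/polyP => j; rewrite AE.
  rewrite (bigID (fun i : 'I_k.+1 => (0 < i < k)%N)) /= addrC.
  have -> : \sum_(i < k.+1 | ~~ (0 < i < k)%N) (u i).1 * (u (k - i)%N).2
      = g0 * (u k).2 + (u k).1 * h0.
    rewrite (bigD1 ord0) //= subn0 u0 /= (bigD1 ord_max) /=; last first.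
      by rewrite ltnn andbF -val_eqE /= -lt0n.
    rewrite subnn u0 /= big1 ?addr0 // => i /andP[/andP[h1 h2] h3].
    move: h1 h2 h3; rewrite -!val_eqE /=; have := ltn_ord i; lia.
  by rewrite (uS k k0) lift1 /rest subrK.
pose G : {poly fps F} := \poly_(a < size g0) Fps (fun k => ((u k).1)`_a).
pose H : {poly fps F} := \poly_(a < size h0) Fps (fun k => ((u k).2)`_a).
have sg k : (size (u k).1 <= size g0)%N.
  by case: (posnP k) => [->|/su[/ltnW //]]; rewrite u0.
have sh k : (size (u k).2 <= size h0)%N.
  by case: (posnP k) => [->|/su[_ /ltnW //]]; rewrite u0.
have GE a k : fcoef G`_a k = ((u k).1)`_a.
  by rewrite coef_poly; case: ltnP => // h; rewrite fcoef0 nth_default //; apply: leq_trans h.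
have HE a k : fcoef H`_a k = ((u k).2)`_a.
  by rewrite coef_poly; case: ltnP => // h; rewrite fcoef0 nth_default //; apply: leq_trans h.
exists G, H; split; try exact: size_poly.
apply/polyP => j; apply: fpsP => k; rewrite -AE -conv coef_sum coefM fcoef_sum.
under eq_bigr do rewrite coefM.
under [RHS]eq_bigr do rewrite fcoefM.
rewrite exchange_big /=; apply: eq_bigr => a _; apply: eq_bigr => i _.
by rewrite GE HE.
Qed.

End Hensel.

(** * Laurent series *)

Notation laurent F := {fraction (fps F)}.

Section Laurent.
Variable F : fieldType.
Implicit Types (x y : laurent F) (s u : fps F).

Definition lau_t : laurent F := tofrac (fps_X F).

Lemma lau_t_neq0 : lau_t != 0. Proof. by rewrite tofrac_eq0 fps_X_neq0. Qed.

Definition lau_const (c : F) : laurent F := tofrac (fps_of_poly c%:P).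

Fact lau_const_zmod_morphism : zmod_morphism lau_const.
Proof. by move=> a b; rewrite /lau_const polyCB rmorphB tofracB. Qed.
Fact lau_const_monoid_morphism : monoid_morphism lau_const.
Proof. by split=> [|a b]; rewrite /lau_const ?polyCM ?tofracM // rmorphM tofracM. Qed.
HB.instance Definition _ := GRing.isZmodMorphism.Build _ _ lau_const
  lau_const_zmod_morphism.
HB.instance Definition _ := GRing.isMonoidMorphism.Build _ _ lau_const
  lau_const_monoid_morphism.

(** A denominator is a power of t times a unit. *)
Lemma laurentP x : exists p : nat * fps F, x = tofrac p.2 / lau_t ^+ p.1.
Proof.
have [a [b [b0 ->]]] := fracP x; have [v bv hv] := fps_order b0.
pose u := Fps (fun n => fcoef b (n + v)); have bE : b = fps_X F ^+ v * u := fps_factor_X hv.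
have uu : u \is a GRing.unit by rewrite fps_unitE.
exists (v, a / u) => /=.
rewrite -tofracXn; apply/eqP; rewrite eq_frac ?expf_neq0 ?fps_X_neq0 // bE.
by rewrite mulrCA divrK // mulrC.
Qed.

(** Coefficients at integer indices, for shifts by powers of t of any sign. *)
Definition zcoef s (k : int) : F := if k is Posz n then fcoef s n else 0.

Lemma zcoefXnM s m (k : int) : zcoef (fps_X F ^+ m * s) k = zcoef s (k - m%:Z).
Proof.
case: k => k; last by have -> : Negz k - m%:Z = Negz (k + m) by lia.
rewrite [LHS]/zcoef fcoefXnM; case: ltnP => h.
  by have -> : k%:Z - m%:Z = Negz (m - k).-1 by lia.
by have -> : k%:Z - m%:Z = Posz (k - m) by lia.
Qed.

(** Any presentation of x as a power series over a power of t gives the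
    same coefficients, by [lcoef_div]. *)
Definition lcoef x (k : int) : F :=
  let p := projT1 (cid (laurentP x)) in zcoef p.2 (k + p.1%:Z).

Lemma lcoef_div s m k : lcoef (tofrac s / lau_t ^+ m) k = zcoef s (k + m%:Z).
Proof.
rewrite /lcoef; case: cid => -[m' s'] /= /eqP.
rewrite -!tofracXn eq_frac ?expf_neq0 ?fps_X_neq0 // => /eqP h.
transitivity (zcoef (fps_X F ^+ m * s') (k + m'%:Z + m%:Z)).
  by rewrite zcoefXnM; congr zcoef; lia.
rewrite mulrC -h mulrC zcoefXnM; congr zcoef; lia.
Qed.

Lemma zcoefD s u k : zcoef (s + u) k = zcoef s k + zcoef u k.
Proof. by case: k => //= n; rewrite addr0. Qed.

Lemma laurent_common x y : exists m s u,
  x = tofrac s / lau_t ^+ m /\ y = tofrac u / lau_t ^+ m.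
Proof.
have [[m s] /= ->] := laurentP x; have [[n u] /= ->] := laurentP y.
exists (m + n)%N, (fps_X F ^+ n * s), (fps_X F ^+ m * u).
rewrite /= !tofracM !tofracXn exprD -/lau_t.
have t0 k : lau_t ^+ k != 0 by rewrite expf_neq0 ?lau_t_neq0.
split; first by rewrite (mulrC (_ ^+ m)) -mulf_div divff ?mul1r.
by rewrite -mulf_div divff ?mul1r.
Qed.

Fact lcoefD x y k : lcoef (x + y) k = lcoef x k + lcoef y k.
Proof.
have [m [s [u [-> ->]]]] := laurent_common x y.
by rewrite -mulrDl -tofracD !lcoef_div zcoefD.
Qed.

Lemma lcoefZ c x k : lcoef (lau_const c * x) k = c * lcoef x k.
Proof.
have [[m s] /= ->] := laurentP x; rewrite mulrA -tofracM !lcoef_div.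
by case: (_ + _) => n /=; rewrite ?mulr0 // -fcoefZ.
Qed.

Lemma lcoef0 k : lcoef 0 k = 0.
Proof. by apply: (addrI (lcoef 0 k)); rewrite -lcoefD !addr0. Qed.

Lemma lcoef_sum I (r : seq I) (P : pred I) (G : I -> laurent F) k :
  lcoef (\sum_(i <- r | P i) G i) k = \sum_(i <- r | P i) lcoef (G i) k.
Proof. exact: (big_morph (lcoef^~ k) (fun a b => lcoefD a b k) (lcoef0 k)). Qed.

Lemma lcoefXnM x m k : lcoef (lau_t ^+ m * x) k = lcoef x (k - m%:Z).
Proof.
have [[n s] /= ->] := laurentP x; rewrite mulrA -tofracXn -tofracM !lcoef_div zcoefXnM.
by congr zcoef; lia.
Qed.

Lemma lcoefVXnM x m k : lcoef (lau_t ^- m * x) k = lcoef x (k + m%:Z).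
Proof.
by rewrite -[in RHS](mulVKf (expf_neq0 m lau_t_neq0) x) lcoefXnM addrK.
Qed.

Lemma lcoef_inj x : (forall k, lcoef x k = 0) -> x = 0.
Proof.
have [[m s] /= ->] := laurentP x => h; suff -> : s = 0 by rewrite rmorph0 mul0r.
by apply: fpsP => n; have := h (n%:Z - m%:Z); rewrite lcoef_div subrK fcoef0.
Qed.

Lemma lcoef_bounded x : exists m : nat, forall k, k < - m%:Z -> lcoef x k = 0.
Proof.
have [[m s] /= ->] := laurentP x; exists m => k; rewrite lcoef_div => h.
by case E : (k + m%:Z) => [n|n] //; lia.
Qed.

Definition lau_deriv : laurent F -> laurent F := frac_deriv (@fps_deriv F).

Lemma derivation_lau_deriv : derivation lau_deriv.
Proof. exact/derivation_frac_deriv/derivation_fps_deriv. Qed.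

Lemma lau_deriv_t : lau_deriv lau_t = 1.
Proof.
rewrite /lau_deriv /lau_t frac_deriv_tofrac; last exact: derivation_fps_deriv.
by rewrite /fps_X fps_deriv_of_poly derivX !rmorph1.
Qed.

Lemma lau_deriv_const c : lau_deriv (lau_const c) = 0.
Proof.
rewrite /lau_deriv /lau_const frac_deriv_tofrac; last exact: derivation_fps_deriv.
by rewrite fps_deriv_of_poly derivC !rmorph0.
Qed.

(** The Euler operator t d/dt is diagonal, which describes the derivation on
    coefficients without reference to denominators. *)
Lemma lcoef_euler x k : lcoef (lau_t * lau_deriv x) k = k%:~R * lcoef x k.
Proof.
have der := derivation_lau_deriv; have [[m s] /= xE] := laurentP x.
have t0 := lau_t_neq0.
have E : lau_t * lau_deriv x = (lau_t * tofrac (fps_deriv s) - lau_const m%:R * tofrac s) / lau_t ^+ m.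
  have : lau_deriv (x * lau_t ^+ m) = tofrac (fps_deriv s).
    rewrite xE divfK ?expf_neq0 // /lau_deriv frac_deriv_tofrac //.
    exact: derivation_fps_deriv.
  rewrite (derivationM der) (derivationX der) lau_deriv_t mulr1 => <-.
  apply: (canRL (mulfK (expf_neq0 m t0))).
  have -> : tofrac s = x * lau_t ^+ m by rewrite xE divfK ?expf_neq0.
  rewrite rmorph_nat -mulr_natl; case: m {xE} => [|m] /=; first by ring.
  by rewrite !exprS; ring.
rewrite E -tofracM /lau_const -tofracM -tofracB lcoef_div xE lcoef_div.
case E' : (k + m%:Z) => [n|n]; last by rewrite mulr0.
rewrite /zcoef fcoefB fcoefZ -[fps_X F](expr1) fcoefXnM.
have -> : k%:~R = n%:R - m%:R :> F.
  by have -> : k = n%:Z - m%:Z by [lia]; rewrite intrD rmorphN.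
rewrite mulrBl; congr (_ - _); case: n {E'} => [|n] /=; first by rewrite mul0r.
by rewrite subn1 /= mulr_natl.
Qed.

Lemma laurent_order x : x != 0 -> exists (k : int) (u : fps F),
  fcoef u 0 != 0 /\ x = lau_t ^ k * tofrac u.
Proof.
have [[m s] /= ->] := laurentP x; rewrite mulf_eq0 tofrac_eq0 => /norP[s0 _].
have [v sv hv] := fps_order s0; exists (v%:Z - m%:Z), (Fps (fun n => fcoef s (n + v))).
split=> //; rewrite {1}(fps_factor_X hv) tofracM tofracXn expfzDr ?lau_t_neq0 //.
by rewrite mulrAC -exprnN.
Qed.

End Laurent.

Section LauRamify.
Variable F : fieldType.

Fact tofrac_ramify_inj N : injective (@tofrac (fps F) \o @ramify F N).
Proof. exact: inj_comp (@tofrac_inj _) (@ramify_inj F N). Qed.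

Definition lau_ramify (N : nat) : laurent F -> laurent F :=
  frac_ext (@tofrac_ramify_inj N).
HB.instance Definition _ N := GRing.RMorphism.on (lau_ramify N).

Lemma lau_ramify_tofrac N s : lau_ramify N (tofrac s) = tofrac (ramify N s).
Proof. exact: frac_ext_tofrac. Qed.

Lemma fcoef0_ramify N (s : fps F) : fcoef (ramify N s) 0 = fcoef s 0.
Proof. by rewrite /ramify /= div0n. Qed.

Lemma lau_ramify_div N a b : lau_ramify N (tofrac a / tofrac b) =
  tofrac (ramify N a) / tofrac (ramify N b).
Proof. by rewrite (fmorph_div (lau_ramify N)) /= !lau_ramify_tofrac. Qed.

Lemma lau_ramify_t N : lau_ramify N (lau_t F) = lau_t F ^+ N.+1.
Proof.
by rewrite lau_ramify_tofrac /fps_X ramify_poly comp_polyX rmorphXn tofracXn.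
Qed.

Lemma lau_ramify_tz N (z : int) :
  lau_ramify N (lau_t F ^ z) = (lau_t F ^+ N.+1) ^ z.
Proof. by rewrite (fmorphXz (lau_ramify N)) /= lau_ramify_t. Qed.

Lemma lau_ramifyM N1 N2 x :
  lau_ramify N1 (lau_ramify N2 x) = lau_ramify (N1 * N2.+1 + N2) x.
Proof.
have [a [b [b0 ->]]] := fracP x.
by rewrite !lau_ramify_div !ramifyM.
Qed.

Lemma lau_ramify0 x : lau_ramify 0 x = x.
Proof.
have [a [b [b0 ->]]] := fracP x; rewrite !lau_ramify_div.
have E (s : fps F) : ramify 0 s = s.
  by apply: fpsP => n /=; rewrite dvd1n divn1.
by rewrite !E.
Qed.

End LauRamify.

(** * Puiseux's theorem *)

(** The leading coefficient is free, so that splitting is invariant under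
    scaling and affine substitutions. *)
Definition splits (K : fieldType) (p : {poly K}) : Prop :=
  exists c (rs : seq K), p = c *: \prod_(r <- rs) ('X - r%:P).

Section Splits.
Variable K : fieldType.
Implicit Types (p q : {poly K}).

Lemma splitsC c : splits (c%:P : {poly K}).
Proof. by exists c, [::]; rewrite big_nil alg_polyC. Qed.

Lemma splitsM p q : splits p -> splits q -> splits (p * q).
Proof.
move=> [c [rs ->]] [d [ss ->]]; exists (c * d), (rs ++ ss).
by rewrite big_cat -scalerAl -scalerAr scalerA.
Qed.

Lemma splitsZ c p : splits p -> splits (c *: p).
Proof. by rewrite -mul_polyC; apply: splitsM; exact: splitsC. Qed.

Lemma splitsXn n : splits ('X^n : {poly K}).
Proof.
by exists 1, (nseq n 0); rewrite scale1r big_nseq subr0 iter_mulr_1.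
Qed.

Lemma splits_comp a b p : a != 0 -> splits p -> splits (p \Po (a *: 'X + b%:P)).
Proof.
move=> a0 [c [rs ->]]; rewrite comp_polyZ; apply: splitsZ.
elim: rs => [|r rs IH]; first by rewrite big_nil comp_polyC; exact: splitsC.
rewrite big_cons comp_polyM; apply: splitsM => //.
exists a, [:: (r - b) / a]; rewrite big_seq1 comp_polyB comp_polyX comp_polyC.
have {1}-> : r = a * ((r - b) / a) + b by rewrite mulrCA divff // mulr1 subrK.
by rewrite polyCD polyCM mul_polyC opprD addrACA subrr addr0 scalerBr.
Qed.

Lemma splits_uncomp a b p : a != 0 -> splits (p \Po (a *: 'X + b%:P)) -> splits p.
Proof.
move=> a0 /(@splits_comp a^-1 (- b / a)); rewrite invr_eq0 => /(_ a0).
rewrite -comp_polyA comp_polyD comp_polyZ comp_polyX comp_polyC.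
by rewrite scalerDr scalerA mulfV // scale1r scale_polyC (mulrC a) divfK // polyCN subrK comp_polyXr.
Qed.

Lemma splits_map (K' : fieldType) (phi : {rmorphism K -> K'}) p :
  splits p -> splits (map_poly phi p).
Proof.
move=> [c [rs ->]]; exists (phi c), (map phi rs).
rewrite map_polyZ /= rmorph_prod big_map /=; congr (_ *: _).
by apply: eq_bigr => r _; rewrite map_polyXsubC.
Qed.

Lemma coef_comp_scaleX a p i : (p \Po (a *: 'X))`_i = a ^+ i * p`_i.
Proof.
rewrite coef_comp_poly; under eq_bigr do rewrite exprZn coefZ coefXn mulrA mulrC.
case: (ltnP i (size p)) => h.
  rewrite (bigD1 (Ordinal h)) //= eqxx mul1r big1 ?addr0 1?mulrC // => j.
  by rewrite -val_eqE /= eq_sym => /negPf ->; rewrite mul0r.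
rewrite nth_default // mulr0 big1 // => j _.
by rewrite gtn_eqF ?mul0r // (leq_trans (ltn_ord j)).
Qed.

End Splits.

Section Puiseux.
Variable F : numClosedFieldType.
Local Notation L := (laurent F).
Implicit Types (p q : {poly L}).

Definition ramified_splits p := exists N, splits (map_poly (lau_ramify N) p).

Lemma ramified_splits_ramify N p :
  ramified_splits (map_poly (lau_ramify N) p) -> ramified_splits p.
Proof.
move=> [M h]; exists (M * N.+1 + N)%N; move: h; rewrite -map_poly_comp.
by rewrite (eq_map_poly (@lau_ramifyM F M N)).
Qed.

Lemma ramified_splits_splits p : splits p -> ramified_splits p.
Proof. by move=> h; exists 0%N; exact: splits_map. Qed.

(** The second factor is split only after the ramification that splits the
    first one. *)
Lemma ramified_splitsM p q : ramified_splits p ->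
  (forall N, ramified_splits (map_poly (lau_ramify N) q)) -> ramified_splits (p * q).
Proof.
move=> [N hN] /(_ N) [M hM]; apply: (@ramified_splits_ramify N); exists M.
by rewrite !rmorphM; apply: splitsM hM; apply: splits_map.
Qed.

Lemma ramified_splits_uncomp a b p : a != 0 ->
  ramified_splits (p \Po (a *: 'X + b%:P)) -> ramified_splits p.
Proof.
move=> a0 [N h]; exists N; move: h; rewrite map_comp_poly rmorphD /= map_polyZ map_polyX map_polyC.
by apply: splits_uncomp; rewrite fmorph_eq0.
Qed.

(** Once the coefficient of degree n is zero and some other coefficient is a unit,
    the residue polynomial is not the power of a linear factor: the sum of its
    n.+1 roots is zero in characteristic zero, so a single root would be zero.
    Hence Hensel's lemma applies. *)
Lemma hensel_splitting (P : {poly fps F}) n j :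
  P \is monic -> size P = n.+2 -> fcoef P`_n 0 = 0 ->
  (j <= n)%N -> fcoef P`_j 0 != 0 ->
  exists G H, [/\ P = G * H, (size G <= n.+1)%N & (size H <= n.+1)%N].
Proof.
move=> Pm sP Pn0 jn Pj; pose r := map_poly (@fps_res F) P.
have lcP : fps_res (lead_coef P) != 0 by rewrite (monicP Pm) rmorph1 oner_eq0.
have sr : size r = n.+2 by rewrite size_map_poly_id0.
have rE i : r`_i = fcoef P`_i 0 by rewrite coef_map.
have rm : r \is monic.
  by rewrite monicE lead_coef_map_eq // (monicP Pm); apply/eqP; exact: fcoef1.
have [c rc] : exists c, root r c.
  by apply/closed_rootP; rewrite sr.
have r0 : r != 0 by rewrite -size_poly_eq0 sr.
have [m [q qc rq]] := multiplicity_XsubC r c.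
rewrite r0 /= in qc; have m0 : (0 < m)%N.
  by case: m rq => // rq; move: rc qc; rewrite rq mulr1 => ->.
have q0 : q != 0 by apply: contraNneq r0 => q0; rewrite rq q0 mul0r.
have sqm : (size q + m = n.+2)%N.
  have := congr1 (fun p : {poly F} => size p) rq; rewrite /= sr.
  rewrite size_Mmonic ?monic_exp ?monicXsubC // size_exp_XsubC addnS /= => <- //.
have q1 : (1 < size q)%N.
  rewrite ltnNge; apply/negP => sq1; have {}sq1 : size q = 1%N.
    by apply/eqP; rewrite eqn_leq sq1 size_poly_gt0.
  have mE : m = n.+1 by move: sqm; rewrite sq1 add1n => -[].
  have /size_poly1P[d d0 qE] : size q == 1%N by rewrite sq1.
  have d1 : d = 1.
    have := rm; rewrite rq qE mul_polyC monicE lead_coefZ.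
    by rewrite (monicP _) ?monic_exp ?monicXsubC // mulr1 => /eqP.
  have rX : r = ('X - c%:P) ^+ n.+1 by rewrite rq qE d1 mul1r mE.
  have c0 : c = 0.
    have E : ('X - c%:P) ^+ n.+1 = \prod_(z <- nseq n.+1 c) ('X - z%:P).
      by rewrite big_nseq iter_mulr_1.
    have := rE n; rewrite Pn0 rX E.
    have := coefPn_prod_XsubC (ps := nseq n.+1 c); rewrite size_nseq => -> //.
    rewrite big_nseq iter_addr_0 => /eqP.
    by rewrite oppr_eq0 -mulr_natr mulf_eq0 pnatr_eq0 orbF => /eqP.
  move: Pj; rewrite -rE rX c0 subr0 coefXn ltn_eqF ?eqxx //.
have cop : coprimep q (('X - c%:P) ^+ m).
  by rewrite coprimep_expr // coprimep_XsubC.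
have [G [H [PGH sG sH]]] := hensel Pm rq cop.
exists G, H; split=> //.
  by apply: leq_trans sG _; rewrite -ltnS -sqm -addn1 leq_add2l.
by apply: leq_trans sH _; rewrite size_exp_XsubC; move: sqm q1; move: (size q) => s; lia.
Qed.

Lemma ramified_splitsZ c p : ramified_splits p -> ramified_splits (c *: p).
Proof. by move=> [N h]; exists N; rewrite map_polyZ; apply: splitsZ. Qed.

(** Take the least slope of the Newton polygon.  A ramification of the parameter
    makes it an integer m, and the substitution of t ^ m y for y then makes all
    the coefficients integral, and one of them a unit. *)
Lemma newton_slope p n : p \is monic -> size p = n.+2 ->
  (exists j, (j <= n)%N && (p`_j != 0)) ->
  exists (N : nat) (m : int) (P : {poly fps F}) (j : nat),
    [/\ map_poly (@tofrac (fps F)) P = (lau_t F ^ m) ^- n.+1 *: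
          (map_poly (lau_ramify N) p \Po (lau_t F ^ m *: 'X)),
        (j <= n)%N & fcoef P`_j 0 != 0].
Proof.
move=> pm sp [j1 /andP[j1n pj1]]; have t0 := lau_t_neq0 F.
have tz (z : int) : lau_t F ^ z != 0 by rewrite expfz_neq0.
have /choice[ku kuP] : forall j : 'I_n.+1, exists ku : int * fps F, p`_j != 0 ->
    fcoef ku.2 0 != 0 /\ p`_j = lau_t F ^ ku.1 * tofrac ku.2.
  move=> j; case: (eqVneq p`_j 0) => [->|/laurent_order[k [u h]]].
    by exists (0, 0).
  by exists (k, u).
pose slope (j : 'I_n.+1) : rat := (ku j).1%:~R / (n.+1 - j)%:R.
have [j0 pj0 jmin] : exists2 j0 : 'I_n.+1, p`_j0 != 0 &
    forall j : 'I_n.+1, p`_j != 0 -> slope j0 <= slope j.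
  have j1n' : (j1 < n.+1)%N by rewrite ltnS.
  case: (@Order.TotalTheory.arg_minP _ _ _ (Ordinal j1n') (fun j : 'I_n.+1 => p`_j != 0) slope pj1).
  by move=> j0 h1 h2; exists j0.
pose e := (n.+1 - j0)%N; have e0 : (0 < e)%N by rewrite subn_gt0.
pose m := (ku j0).1; pose N := e.-1; have NE : N.+1 = e by rewrite prednK.
pose F2 := (lau_t F ^ m) ^- n.+1 *: (map_poly (lau_ramify N) p \Po (lau_t F ^ m *: 'X)).
have F2E j : F2`_j = (lau_t F ^ m) ^- n.+1 * ((lau_t F ^ m) ^+ j * lau_ramify N p`_j).
  by rewrite coefZ coef_comp_scaleX coef_map.
have F2S j : (n < j)%N -> F2`_j = (j == n.+1)%:R.
  move=> nj; rewrite F2E; case: eqVneq => [->|jn].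
    have -> : p`_n.+1 = 1 by have := monicP pm; rewrite lead_coefE sp.
    by rewrite rmorph1 mulr1 mulVf // expf_neq0.
  rewrite nth_default ?rmorph0 ?mulr0 // sp.
  by move: nj jn; rewrite leq_eqVlt => /predU1P[->|//]; rewrite eqxx.
have F2j (j : 'I_n.+1) : p`_j != 0 ->
    exists a : nat, F2`_j = lau_t F ^+ a * tofrac (ramify N (ku j).2) /\ (j = j0 -> a = 0%N).
  move=> pj; have [_ pE] := kuP j pj.
  (* The minimality of the slope at j0, cleared of denominators. *)
  have key : m * (n.+1 - j)%:Z <= (ku j).1 * e%:Z.
    have := jmin j pj; rewrite /slope ler_pdivrMr ?ltr0n // mulrAC ler_pdivlMr ?ltr0n ?subn_gt0 //.
    by rewrite !pmulrn -!intrM ler_int.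
  exists (absz ((ku j).1 * e%:Z - m * (n.+1 - j)%:Z)%R); split; last first.
    by move=> ->; rewrite subrr.
  rewrite F2E {1}pE (rmorphM (lau_ramify N)) /= lau_ramify_tz NE lau_ramify_tofrac mulrA mulrA.
  congr (_ * _).
  transitivity (lau_t F ^ (m * - n.+1%:Z + m * j%:Z + e%:Z * (ku j).1)).
    by rewrite !expfzDr // -!exprz_exp exprnN.
  rewrite [RHS]exprnP; congr (_ ^ _); rewrite gez0_abs ?subr_ge0 //.
  by have := ltn_ord j; rewrite ltnS => jn; lia.
have /choice[b bE] : forall j, exists s : fps F, F2`_j = tofrac s /\ (j = j0 -> fcoef s 0 != 0).
  move=> j; case: (ltnP j n.+1) => jn; last first.
    exists (j == n.+1)%:R; rewrite F2S // rmorph_nat; split=> // jE.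
    by move: jn; rewrite jE leqNgt ltn_ord.
  case: (eqVneq p`_j 0) => [pj|pj].
    exists 0; rewrite F2E pj !rmorph0 !mulr0; split=> // jE.
    by move: pj0; rewrite -jE pj eqxx.
  have [a [aE a0]] := F2j (Ordinal jn) pj.
  exists (fps_X F ^+ a * ramify N (ku (Ordinal jn)).2); split.
    by rewrite tofracM tofracXn -aE.
  move=> jE; have jE' : Ordinal jn = j0 by apply: val_inj.
  rewrite (a0 jE') expr0 mul1r fcoef0_ramify.
  by have [] := kuP _ (pj : p`_(Ordinal jn) != 0).
exists N, m, (\poly_(j < n.+2) b j), j0; split; last 2 first.
- by rewrite -ltnS.
- have jn : (j0 < n.+2)%N by apply: ltn_trans (ltn_ord j0) _.
  by rewrite coef_poly jn; have [_] := bE j0; apply.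
apply/polyP => j; rewrite -/F2 coef_map coef_poly; case: ltnP => jn.
  by have [] := bE j.
by rewrite F2S ?gtn_eqF //; exact: ltnW.
Qed.

(** Induction on the degree, after the translation that cancels the second
    coefficient: either the polynomial is a power of the variable, or it
    factors. *)
Lemma puiseux p : ramified_splits p.
Proof.
have [n] := ubnP (size p); elim: n p => // n IH p; rewrite ltnS => sp.
case: (leqP (size p) 1) => [/size1_polyC ->|sp1]; first exact/ramified_splits_splits/splitsC.
have [d sd] : exists d, size p = d.+2 by case: (size p) sp1 => [|[|d]] //; exists d.
pose lc := lead_coef p; have lc0 : lc != 0 by rewrite lead_coef_eq0 -size_poly_eq0 sd.
(* The translation by b cancels the coefficient of degree d. *)
pose b : L := - ((lc^-1 *: p)`_d / d.+1%:R).
have d0 : d.+1%:R != 0 :> L.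
  by rewrite -(rmorph_nat (@lau_const F)) fmorph_eq0 pnatr_eq0.
pose P1 := (lc^-1 *: p) \Po (1 *: 'X + b%:P).
suff : ramified_splits P1.
  move/(@ramified_splits_uncomp 1 b _ (oner_neq0 _)) => /(ramified_splitsZ lc).
  by rewrite scalerA divff // scale1r.
have pm : lc^-1 *: p \is monic by rewrite monicE lead_coefZ mulVf.
have sZ : size (lc^-1 *: p) = d.+2 by rewrite size_scale ?invr_eq0.
have XbE : 1 *: 'X + b%:P = 'X - (- b)%:P by rewrite scale1r polyCN opprK.
have s1 : size P1 = d.+2 by rewrite size_comp_poly2 // XbE size_XsubC.
have P1m : P1 \is monic.
  rewrite /P1 XbE monicE lead_coef_comp; last by rewrite size_XsubC.
  by rewrite (monicP pm) lead_coefXsubC expr1n mul1r eqxx.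
have P1d : P1`_d = 0.
  rewrite coef_comp_poly sZ big_ord_recr big_ord_recr /= big1 ?add0r; last first.
    by move=> i _; rewrite XbE [X in _ * X]nth_default ?mulr0 // size_exp_XsubC.
  have mX : ('X - (- b)%:P) ^+ d \is monic by rewrite monic_exp ?monicXsubC.
  have -> : ((1 *: 'X + b%:P) ^+ d)`_d = 1.
    by have := monicP mX; rewrite lead_coefE size_exp_XsubC XbE.
  have -> : ((1 *: 'X + b%:P) ^+ d.+1)`_d = b *+ d.+1.
    have -> : (1 *: 'X + b%:P) ^+ d.+1 = \prod_(z <- nseq d.+1 (- b)) ('X - z%:P).
      by rewrite big_nseq iter_mulr_1 XbE.
    have := coefPn_prod_XsubC (ps := nseq d.+1 (- b)); rewrite size_nseq => -> //.
    by rewrite big_nseq iter_addr_0 mulNrn opprK.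
  have -> : (lc^-1 *: p)`_d.+1 = 1 by have := monicP pm; rewrite lead_coefE sZ.
  by rewrite mulr1 mul1r -mulr_natr /b mulNr divfK // subrr.
move: P1 s1 P1m P1d => {pm sZ b XbE d0} P s1 Pm Pd.
have [ex|nex] := pselect (exists j, (j <= d)%N && (P`_j != 0)); last first.
  suff -> : P = 'X^(d.+1) by exact/ramified_splits_splits/splitsXn.
  apply/polyP => j; rewrite coefXn; case: (ltngtP j d.+1) => h.
  - by apply/eqP/negPn/negP => Pj; apply: nex; exists j; rewrite -ltnS h.
  - by rewrite nth_default // s1.
  - by rewrite h; have := monicP Pm; rewrite lead_coefE s1.
have [N [m [Q [j [QE jd Qj]]]]] := newton_slope Pm s1 ex.
have tm : lau_t F ^ m != 0 by rewrite expfz_neq0 ?lau_t_neq0.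
have QcE i : tofrac Q`_i = (lau_t F ^ m) ^- d.+1 * ((lau_t F ^ m) ^+ i * lau_ramify N P`_i).
  have := congr1 (fun p : {poly L} => p`_i) QE.
  by rewrite coef_map coefZ coef_comp_scaleX coef_map.
have sQ : size Q = d.+2.
  rewrite -size_map_tofrac QE size_scale ?invr_eq0 ?expf_neq0 //.
  by rewrite size_comp_poly2 ?size_map_poly // size_scale // size_polyX.
have Qm : Q \is monic.
  rewrite monicE lead_coefE sQ -tofrac_eq QcE.
  have -> : P`_d.+2.-1 = 1 by have := monicP Pm; rewrite lead_coefE s1.
  by rewrite rmorph1 mulr1 mulVf ?expf_neq0 // tofrac1.
have Qd : fcoef Q`_d 0 = 0.
  suff -> : Q`_d = 0 by exact: fcoef0.
  by apply: (@tofrac_inj (fps F)); rewrite QcE Pd !rmorph0 !mulr0.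
have [G [H [QGH sG sH]]] := hensel_splitting Qm sQ Qd jd Qj.
have small (K : {poly fps F}) M : (size K <= d.+1)%N ->
    ramified_splits (map_poly (lau_ramify M) (map_poly (@tofrac (fps F)) K)).
  move=> sK; apply: IH; rewrite size_map_poly size_map_tofrac.
  by apply: leq_ltn_trans sK _; rewrite -sd.
have : ramified_splits (map_poly (@tofrac (fps F)) Q).
  rewrite QGH rmorphM; apply: ramified_splitsM => [|M]; last exact: small.
  by have := small G 0%N sG; exact: ramified_splits_ramify.
rewrite QE => /(ramified_splitsZ ((lau_t F ^ m) ^+ d.+1)).
rewrite scalerA divff ?expf_neq0 // scale1r -[_ *: 'X]addr0 -polyC0.
move=> /(ramified_splits_uncomp tm); exact: ramified_splits_ramify.
Qed.

End Puiseux.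

(** * Conjugates of an algebraic solution *)

Definition diff_extension (K L : fieldType) (d : K -> K) (j : K -> L) (D : L -> L) :=
  derivation D /\ forall a, D (j a) = j (d a).

Definition op_act (K L : fieldType) (j : K -> L) (D : L -> L) (M : {poly K}) (g : L) : L :=
  \sum_(i < size M) j M`_i * iter i D g.

Section Minpoly.
Variables (K L : fieldType) (j : {rmorphism K -> L}) (f : L).
Hypothesis char0 : forall n, n.+1%:R != 0 :> K.

Lemma minimal_polynomial (P0 : {poly K}) : P0 != 0 -> root (map_poly j P0) f ->
  exists2 P : {poly K}, P != 0 /\ root (map_poly j P) f
    & forall q, root (map_poly j q) f -> P %| q.
Proof.
move=> P0n rP0; pose good n := exists2 P : {poly K}, P != 0 /\ root (map_poly j P) f & size P = n.
have ex : exists n, `[< good n >] by exists (size P0); apply/asboolP; exists P0.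
case: (ex_minnP ex) => n /asboolP[P [Pn rP] sP] nmin; exists P => // q rq.
apply: contraT => nd; have : (n <= size (q %% P)%R)%N.
  apply: nmin; apply/asboolP; exists (q %% P) => //; split=> //.
  move: rq; rewrite {1}(divp_eq q P) rmorphD rmorphM /= /root hornerD hornerM.
  by rewrite (eqP rP) mulr0 add0r.
by rewrite leqNgt -sP ltn_modp Pn.
Qed.

(** f is a root of the gcd G of P and P' or of the cofactor P / G.  In the first
    case P divides P', which is impossible in characteristic zero; in the
    second one P divides P / G, so that G is constant. *)
Lemma minimal_polynomial_separable (P : {poly K}) : P != 0 -> root (map_poly j P) f ->
  (forall q, root (map_poly j q) f -> P %| q) -> coprimep P P^`().
Proof.
move=> Pn rP Pmin.
have sP : (1 < size P)%N.
  rewrite ltnNge; apply/negP => /size1_polyC PE; move: rP Pn.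
  by rewrite PE map_polyC rootC /= fmorph_eq0 polyC_eq0 => ->.
have P'n : P^`() != 0.
  apply/eqP => /polyP/(_ (size P).-2) /eqP; rewrite coef_deriv coef0.
  have -> : (size P).-2.+1 = (size P).-1 by case: (size P) sP => [|[]].
  rewrite -lead_coefE -mulr_natr mulf_eq0 lead_coef_eq0 (negPf Pn) /=.
  by case: (size P) sP => [|[|n]] //= _; rewrite (negPf (char0 n)).
have Gn : gcdp P P^`() != 0 by rewrite gcdp_eq0 negb_and Pn.
have : root (map_poly j (P %/ gcdp P P^`() * gcdp P P^`())) f.
  by rewrite divpK ?dvdp_gcdl.
rewrite rmorphM /= rootM => /orP[] /Pmin.
  move/dvdp_leq; rewrite divp_eq0 (negPf Pn) (negPf Gn) /= -leqNgt dvdp_leq ?dvdp_gcdl //.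
  move=> /(_ isT); rewrite size_divp // /coprimep => h.
  have : (0 < size (gcdp P P^`()))%N by rewrite size_poly_gt0.
  by move: (size (gcdp P P^`())) (size P) h sP => a b; lia.
move=> /(fun h => dvdp_trans h (dvdp_gcdr _ _)) /(dvdp_leq P'n).
by rewrite leqNgt lt_size_deriv.
Qed.

End Minpoly.

Section Conjugates.
Variables (K : fieldType) (d : K -> K).
Hypothesis der : derivation d.

Definition coef_deriv_poly (q : {poly K}) : {poly K} := \poly_(i < size q) d q`_i.

Lemma coef_coef_deriv_poly q i : (coef_deriv_poly q)`_i = d q`_i.
Proof.
rewrite coef_poly; case: ltnP => // h.
by rewrite nth_default // (derivation0 der).
Qed.

(** D is not linear over K, so that the coefficients contribute a term of their
    own. *)
Lemma diff_extension_horner (L : fieldType) (j : {rmorphism K -> L}) (D : L -> L) q g :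
  diff_extension d j D ->
  D (map_poly j q).[g] =
    (map_poly j (coef_deriv_poly q)).[g] + (map_poly j q^`()).[g] * D g.
Proof.
move=> [derD Dj]; elim/poly_ind: q => [|q c IH].
  have -> : coef_deriv_poly 0 = 0.
    by apply/polyP => i; rewrite coef_coef_deriv_poly !coef0 (derivation0 der).
  by rewrite poly.deriv0 map_poly0 horner0 mul0r addr0 (derivation0 derD).
have -> : coef_deriv_poly (q * 'X + c%:P) = coef_deriv_poly q * 'X + (d c)%:P.
  apply/polyP => i; rewrite coef_coef_deriv_poly !coefD !coefMX !coefC.
  rewrite coef_coef_deriv_poly (derivationD der).
  by case: i => [|i] /=; rewrite (derivation0 der).
rewrite derivD derivM derivX derivC addr0 mulr1.
rewrite !rmorphD !rmorphM /= !map_polyX !map_polyC /=.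
rewrite !hornerD !hornerM !hornerX !hornerC (derivationD derD) (derivationM derD) Dj IH.
ring.
Qed.

Variable P : {poly K}.
Hypothesis Psep : coprimep P P^`().

(** Differentiate P(g) = 0 and divide by P'(g), which is invertible by a Bezout
    identity that holds in every extension at once. *)
Lemma derivative_of_root : exists R : {poly K},
  forall (L : fieldType) (j : {rmorphism K -> L}) (D : L -> L) g,
    diff_extension d j D -> root (map_poly j P) g -> D g = (map_poly j R).[g].
Proof.
have /Bezout_eq1_coprimepP[[u v] /= uv] := Psep.
exists (- (coef_deriv_poly P * v)) => L j D g ext rg.
have := diff_extension_horner P g ext; rewrite (eqP rg) (derivation0 (proj1 ext)).
have := congr1 (fun q => (map_poly j q).[g]) uv.
rewrite /= rmorphD !rmorphM !rmorph1 /= hornerD !hornerM hornerC (eqP rg) mulr0 add0r.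
rewrite rmorphN rmorphM /= hornerN hornerM => vP /esym/eqP; rewrite addr_eq0 => /eqP ->.
by rewrite mulNr opprK mulrAC [X in _ = X * _]mulrC vP mul1r.
Qed.

Lemma iterated_derivative_of_root : exists Delta : nat -> {poly K},
  forall (L : fieldType) (j : {rmorphism K -> L}) (D : L -> L) g,
    diff_extension d j D -> root (map_poly j P) g ->
    forall i, iter i D g = (map_poly j (Delta i)).[g].
Proof.
have [R RP] := derivative_of_root.
exists (fun i => iter i (fun q => coef_deriv_poly q + q^`() * R) 'X) => L j D g ext rg.
elim=> [|i IH] /=; first by rewrite map_polyX hornerX.
rewrite IH (diff_extension_horner _ _ ext) (RP _ _ _ _ ext rg).
by rewrite rmorphD rmorphM /= hornerD hornerM.
Qed.

End Conjugates.

(** The derivatives of a root g of P are fixed polynomial expressions in g.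
    Thus an operator that annihilates one root annihilates all of them, and the
    matrix of the derivatives of all the roots is the product of the matrix
    of these expressions with a Vandermonde matrix. *)
Lemma conjugate_solutions (K : fieldType) (d : K -> K) (L : fieldType)
    (j : {rmorphism K -> L}) (D : L -> L) (f : L) (M : {poly K}) (r : nat) (P0 : {poly K}) :
  (forall n, n.+1%:R != 0 :> K) -> derivation d -> diff_extension d j D ->
  P0 != 0 -> root (map_poly j P0) f -> op_act j D M f = 0 ->
  (forall u : 'rV[K]_r, \sum_i j (u 0 i) * iter i D f = 0 -> u = 0) ->
  exists2 P : {poly K}, P != 0 &
    forall (L' : fieldType) (j' : {rmorphism K -> L'}) (D' : L' -> L') c (gs : seq L'),
      diff_extension d j' D' ->
      map_poly j' P = c *: \prod_(g <- gs) ('X - g%:P) ->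
      (forall g, g \in gs -> op_act j' D' M g = 0) /\
      \rank (\matrix_(k < size gs, i < r) iter i D' gs`_k) = r.
Proof.
move=> char0 der ext P0n rP0 Mf indep.
have [P [Pn rP] Pmin] := minimal_polynomial P0n rP0.
have Psep := minimal_polynomial_separable char0 Pn rP Pmin.
have [Delta DeltaP] := iterated_derivative_of_root der Psep.
exists P => // L' j' D' c gs ext' Pgs.
have c0 : c != 0.
  by apply: contraNneq Pn => c0; rewrite -(map_poly_eq0 j') Pgs c0 scale0r.
have rgs g : g \in gs -> root (map_poly j' P) g.
  by rewrite Pgs rootZ // root_prod_XsubC.
have ugs : uniq gs.
  rewrite -separable_prod_XsubC unlock.
  have := Psep; rewrite -(coprimep_map j') -deriv_map Pgs derivZ.
  by rewrite coprimepZl // coprimepZr.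
have comb (L1 : fieldType) (j1 : {rmorphism K -> L1}) (D1 : L1 -> L1) g m (a : 'I_m -> K) :
    diff_extension d j1 D1 -> root (map_poly j1 P) g ->
    \sum_i j1 (a i) * iter i D1 g = (map_poly j1 (\sum_i a i *: Delta i)).[g].
  move=> e1 r1; rewrite rmorph_sum horner_sum; apply: eq_bigr => i _.
  by rewrite /= map_polyZ hornerZ (DeltaP _ _ _ _ e1 r1).
split=> [g /rgs rg|].
  rewrite /op_act (comb _ _ _ _ _ (fun i : 'I_(size M) => M`_i)) //.
  move: Mf; rewrite /op_act (comb _ _ _ _ _ (fun i : 'I_(size M) => M`_i)) //.
  move/eqP/Pmin/dvdpP => [q ->]; rewrite rmorphM /= hornerM.
  by rewrite (eqP rg) mulr0.
have sP : size P = (size gs).+1.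
  by rewrite -(size_map_poly j') Pgs size_scale // size_prod_XsubC.
pose H : 'M[K]_(r, size gs) := \matrix_(i, k) (Delta i %% P)`_k.
(* A relation between the rows of H is a relation between the derivatives of f. *)
have Hfree : row_free H.
  apply: inj_row_free => u uH; apply: indep.
  rewrite (comb _ _ _ _ _ (fun i => u 0 i)) //; apply/eqP.
  suff : P %| \sum_i u 0 i *: Delta i.
    by case/dvdpP => q ->; rewrite rmorphM /= hornerM (eqP rP) mulr0.
  apply/modp_eq0P; rewrite (big_morph (fun q => q %% P) (modpD P) (mod0p P)).
  apply/polyP => k; rewrite coef0 coef_sum; case: (ltnP k (size gs)) => hk; last first.
    rewrite big1 // => i _; rewrite nth_default // (leq_trans _ hk) // -ltnS -sP ltn_modp //.
  have := congr1 (fun A : 'rV[K]_(size gs) => A 0 (Ordinal hk)) uH; rewrite !mxE => E; apply: etrans E.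
  by apply: eq_bigr => i _; rewrite mxE modpZl coefZ.
pose V := Vandermonde (size gs) (\row_k gs`_k : 'rV[L']_(size gs)).
have Vunit : V \in unitmx.
  rewrite unitmxE det_Vandermonde unitfE; apply/prodf_neq0 => a _; apply/prodf_neq0 => b ab.
  by rewrite !mxE subr_eq0 nth_uniq // gtn_eqF.
have -> : \matrix_(k, i) iter i D' gs`_k = (map_mx j' H *m V)^T.
  apply/matrixP => k i; rewrite !mxE (DeltaP _ _ _ _ ext') ?rgs ?mem_nth //.
  rewrite {1}(divp_eq (Delta i) P) rmorphD rmorphM /= hornerD hornerM.
  rewrite (eqP (rgs _ (mem_nth _ (ltn_ord k)))) mulr0 add0r.
  rewrite (@horner_coef_wide _ (size gs)).
    by apply: eq_bigr => a _; rewrite !mxE coef_map.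
  by rewrite size_map_poly -ltnS -sP ltn_modp.
by rewrite mxrank_tr mxrankMfree ?row_free_unit // mxrank_map; exact/eqP.
Qed.

(** * Operators on generalized series *)

Section LogAction.
Variable F : fieldType.
Implicit Types (p q : {poly F}) (rho c : F).

(** The action of z d/dz on z^rho q(log z). *)
Definition euler_log rho q : {poly F} := rho *: q + q^`().

(** [log_act p rho q] is the factor q' of p(theta)(z^rho q(log z)) = z^rho q'(log z),
    for the Euler operator theta = z d/dz. *)
Definition log_act p rho q : {poly F} :=
  \sum_(j < size p) p`_j *: iter j (euler_log rho) q.

Lemma euler_logD rho q1 q2 : euler_log rho (q1 + q2) = euler_log rho q1 + euler_log rho q2.
Proof. by rewrite /euler_log scalerDr derivD addrACA. Qed.

Lemma euler_logZ rho c q : euler_log rho (c *: q) = c *: euler_log rho q.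
Proof. by rewrite /euler_log derivZ !scalerDr !scalerA mulrC. Qed.

Lemma euler_log0 rho : euler_log rho 0 = 0.
Proof. by rewrite /euler_log scaler0 poly.deriv0 addr0. Qed.

Lemma iter_euler_logD rho q1 q2 j :
  iter j (euler_log rho) (q1 + q2) = iter j (euler_log rho) q1 + iter j (euler_log rho) q2.
Proof. by elim: j => //= j ->; rewrite euler_logD. Qed.

Lemma iter_euler_logZ rho c q j :
  iter j (euler_log rho) (c *: q) = c *: iter j (euler_log rho) q.
Proof. by elim: j => //= j ->; rewrite euler_logZ. Qed.

Lemma log_act_wide n p rho q : (size p <= n)%N ->
  log_act p rho q = \sum_(j < n) p`_j *: iter j (euler_log rho) q.
Proof.
move=> h; rewrite /log_act (big_ord_widen _ (fun j => p`_j *: iter j (euler_log rho) q) h).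
rewrite big_mkcond /=; apply: eq_bigr => i _; case: ifPn => //.
by rewrite -leqNgt => hi; rewrite nth_default // scale0r.
Qed.

Lemma log_actDl p1 p2 rho q : log_act (p1 + p2) rho q = log_act p1 rho q + log_act p2 rho q.
Proof.
pose n := maxn (size p1) (size p2).
rewrite !(@log_act_wide n) ?leq_maxl ?leq_maxr ?size_polyD // -big_split /=.
by apply: eq_bigr => i _; rewrite coefD scalerDl.
Qed.

Lemma log_actZl c p rho q : log_act (c *: p) rho q = c *: log_act p rho q.
Proof.
rewrite (@log_act_wide (size p)) ?size_scale_leq // scaler_sumr.
by apply: eq_bigr => i _; rewrite coefZ scalerA.
Qed.

Lemma log_act0l rho q : log_act 0 rho q = 0.
Proof. by rewrite /log_act size_poly0 big_ord0. Qed.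

Lemma log_act_suml I (r : seq I) (P : pred I) (G : I -> {poly F}) rho q :
  log_act (\sum_(i <- r | P i) G i) rho q = \sum_(i <- r | P i) log_act (G i) rho q.
Proof.
exact: (big_morph (fun p => log_act p rho q)
  (fun a b => log_actDl a b rho q) (log_act0l rho q)).
Qed.

Lemma log_actDr p rho q1 q2 : log_act p rho (q1 + q2) = log_act p rho q1 + log_act p rho q2.
Proof.
rewrite /log_act -big_split; apply: eq_bigr => i _.
by rewrite iter_euler_logD scalerDr.
Qed.

Lemma log_actZr c p rho q : log_act p rho (c *: q) = c *: log_act p rho q.
Proof.
rewrite /log_act scaler_sumr; apply: eq_bigr => i _.
by rewrite iter_euler_logZ !scalerA mulrC.
Qed.

Lemma log_act0r p rho : log_act p rho 0 = 0.
Proof. by have := log_actZr 0 p rho 0; rewrite !scale0r. Qed.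

Lemma log_act_XsubC p c rho q :
  log_act (p * ('X - c%:P)) rho q = euler_log (rho - c) (log_act p rho q).
Proof.
rewrite mulrBr mulrC [p * c%:P]mulrC mul_polyC -scaleNr log_actDl log_actZl.
rewrite /euler_log scalerBl addrAC -/(euler_log _ _) scaleNr; congr (_ - _).
rewrite (@log_act_wide (size p).+1) ?size_polyXM_leq //; last first.
  by rewrite mulrC; apply: leq_trans (size_polyMleq _ _) _; rewrite size_polyX addn2.
rewrite big_ord_recl coefXM eqxx scale0r add0r -/(euler_log rho _) /log_act.
rewrite (big_morph (euler_log rho) (euler_logD rho) (euler_log0 rho)).
by apply: eq_bigr => i _; rewrite coefXM /= euler_logZ.
Qed.

(** On a power of z without logarithm, p(theta) multiplies by p(rho). *)
Lemma log_actC p rho c : log_act p rho c%:P = (p.[rho] * c)%:P.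
Proof.
rewrite /log_act horner_coef mulr_suml rmorph_sum; apply: eq_bigr => i _ /=.
have -> : iter i (euler_log rho) c%:P = (rho ^+ i * c)%:P.
  elim: (i : nat) => [|k IH]; first by rewrite expr0 mul1r.
  by rewrite iterS IH /euler_log derivC addr0 scale_polyC mulrA -exprS.
by rewrite scale_polyC mulrA.
Qed.

(** Only the two leading coefficients in log z matter: the first one detects
    the roots of p, the second one tells simple roots from multiple ones. *)
Lemma iter_euler_log_coef rho q d j : (size q <= d.+2)%N ->
  [/\ (size (iter j (euler_log rho) q) <= d.+2)%N,
      (iter j (euler_log rho) q)`_d.+1 = rho ^+ j * q`_d.+1 &
      (iter j (euler_log rho) q)`_d =
        rho ^+ j * q`_d + (rho ^+ j.-1 *+ j) * (q`_d.+1 *+ d.+1)].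
Proof.
move=> sq; elim: j => [|j [s1 c1 c0]] /=.
  by rewrite !expr0 !mul1r mulr0n mul0r addr0.
set u := iter j _ q in s1 c1 c0 *.
have u2 : u`_d.+2 = 0 by rewrite nth_default.
split.
- rewrite (leq_trans (size_polyD _ _)) // geq_max (leq_trans (size_scale_leq _ _)) //=.
  by rewrite (leq_trans (size_poly _ _)) // (leq_trans (leq_pred _)).
- by rewrite coefD coefZ coef_deriv u2 mul0rn addr0 c1 mulrA exprS.
- rewrite coefD coefZ coef_deriv c1 c0 mulrDr mulrA -exprS -addrA; congr (_ + _).
  rewrite -mulrnAr mulrA -mulrDl; congr (_ * _).
  by case: j {s1 c1 c0 u u2} => [|j]; rewrite ?mulr0n ?mulr0 ?add0r // mulrnAr -exprS -mulrSr.
Qed.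

Lemma log_act_coefS p rho q d : (size q <= d.+2)%N ->
  (log_act p rho q)`_d.+1 = p.[rho] * q`_d.+1.
Proof.
move=> sq; rewrite /log_act coef_sum horner_coef mulr_suml; apply: eq_bigr => j _.
by rewrite coefZ; have [_ -> _] := iter_euler_log_coef rho j sq; rewrite mulrA.
Qed.

Lemma log_act_coef p rho q d : (size q <= d.+2)%N ->
  (log_act p rho q)`_d = p.[rho] * q`_d + p^`().[rho] * (q`_d.+1 *+ d.+1).
Proof.
move=> sq; rewrite /log_act coef_sum.
have -> : p^`().[rho] = \sum_(j < size p) p`_j * (rho ^+ j.-1 *+ j).
  rewrite (@horner_coef_wide _ (size p)); last by rewrite (leq_trans (size_poly _ _)) ?leq_pred.
  case sn : (size p) => [|n]; first by rewrite !big_ord0.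
  rewrite big_ord_recr /= coef_deriv nth_default ?sn // mul0rn mul0r addr0.
  rewrite big_ord_recl mulr0n mulr0 add0r; apply: eq_bigr => i _.
  by rewrite coef_deriv mulrnAl mulrnAr.
rewrite horner_coef !mulr_suml -big_split; apply: eq_bigr => j _ /=.
by rewrite coefZ; have [_ _ ->] := iter_euler_log_coef rho j sq; rewrite mulrDr !mulrA.
Qed.

End LogAction.

(** z^i (d/dz)^i is the falling factorial of theta. *)
Definition falling (i : nat) : {poly algC} := \prod_(k < i) ('X - (k%:R)%:P).

Lemma fallingS i : falling i.+1 = falling i * ('X - (i%:R)%:P).
Proof. exact: big_ord_recr. Qed.

Lemma iter_gderiv i (y : gseries) e :
  iter i gderiv y e = log_act (falling i) (e + i%:R) (y (e + i%:R)).
Proof.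
elim: i e => [|i IH] e.
  rewrite /falling big_ord0 addr0 /log_act size_poly1 big_ord1 coef1 /= scale1r //.
rewrite fallingS log_act_XsubC iterS /gderiv -/(euler_log (e + 1) _) IH.
have -> : e + 1 + i%:R = e + i.+1%:R by rewrite -addrA -natr1 (addrC 1).
by congr euler_log; rewrite -natr1 addrA addrAC addrK.
Qed.

Section Recurrence.
Implicit Types (A : pdiffop algC) (y : gseries) (E : algC).

(** The action of operators with coefficients in algC[z], as needed at points
    that are not rational. *)
Definition capply A y : gseries := fun e =>
  \sum_(i < size A) \sum_(j < size A`_i) A`_i`_j *: iter i gderiv y (e - j%:R).

(** The term z^j (d/dz)^i shifts exponents down by i - j.  For the largest shift
    v that occurs, the terms of shift v make up the indicial polynomial,
    and the other ones link a coefficient to those of smaller exponents. *)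
Definition principal A (v : int) : {poly algC} :=
  \sum_(i < size A) \sum_(j < size A`_i | i%:Z - j%:Z == v) A`_i`_j *: falling i.

Definition remainder A (v : int) y : gseries := fun E =>
  \sum_(i < size A) \sum_(j < size A`_i | i%:Z - j%:Z != v)
     A`_i`_j *: log_act (falling i) (E - (v - i%:Z + j%:Z)%:~R) (y (E - (v - i%:Z + j%:Z)%:~R)).

Lemma capplyE A v y E :
  capply A y (E - v%:~R) = log_act (principal A v) E (y E) + remainder A v y E.
Proof.
rewrite log_act_suml -big_split /=; apply: eq_bigr => i _.
rewrite log_act_suml (bigID (fun j : 'I_(size A`_i) => i%:Z - j%:Z == v)) /=.
congr (_ + _); apply: eq_bigr => j ij.
  rewrite log_actZl iter_gderiv; have -> // : E - v%:~R - j%:R + i%:R = E.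
  by rewrite -(eqP ij) rmorphB /=; ring.
rewrite iter_gderiv; have -> // : E - v%:~R - j%:R + i%:R = E - (v - i%:Z + j%:Z)%:~R.
by rewrite !rmorphD rmorphN /=; ring.
Qed.

Definition shift_bound A (v : int) := forall i j, A`_i`_j != 0 -> i%:Z - j%:Z <= v.

Section Bound.
Variables (A : pdiffop algC) (v : int).
Hypothesis Av : shift_bound A v.

(** The remainder at E only involves the coefficients at E - 1, E - 2, ... *)
Lemma remainder_ind (Q : {poly algC} -> Prop) y E :
  Q 0 -> (forall p q, Q p -> Q q -> Q (p + q)) ->
  (forall c i (k : nat), (0 < k)%N -> Q (c *: log_act (falling i) (E - k%:R) (y (E - k%:R)))) ->
  Q (remainder A v y E).
Proof.
move=> Q0 QD Qk; rewrite /remainder; apply: (big_ind Q) => // i _.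
apply: (big_ind Q) => // j ij; case: (eqVneq A`_i`_j 0) => [->|Aij].
  by rewrite scale0r.
have le := Av Aij; have [k k0 kE] : exists2 k : nat, (0 < k)%N & v - i%:Z + j%:Z = k%:Z.
  by exists (absz (v - i%:Z + j%:Z)%R); lia.
by rewrite kE; exact: Qk.
Qed.

Lemma eq_remainder y y' E :
  (forall k : nat, (0 < k)%N -> y (E - k%:R) = y' (E - k%:R)) ->
  remainder A v y E = remainder A v y' E.
Proof.
move=> h; apply: eq_bigr => i _; apply: eq_bigr => j ij.
case: (eqVneq A`_i`_j 0) => [->|Aij]; first by rewrite !scale0r.
have le := Av Aij; have [k k0 kE] : exists2 k : nat, (0 < k)%N & v - i%:Z + j%:Z = k%:Z.
  by exists (absz (v - i%:Z + j%:Z)%R); lia.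
by rewrite kE h.
Qed.

Lemma remainder_eq0 y E :
  (forall k : nat, (0 < k)%N -> y (E - k%:R) = 0) -> remainder A v y E = 0.
Proof.
move=> h; apply: (@remainder_ind (fun p => p = 0)) => // [p q -> ->|c i k k0].
  by rewrite addr0.
by rewrite h // log_act0r scaler0.
Qed.

Lemma remainder_log_free y E :
  (forall k : nat, (0 < k)%N -> (size (y (E - k%:R)%R) <= 1)%N) ->
  (size (remainder A v y E) <= 1)%N.
Proof.
move=> h; apply: (@remainder_ind (fun p => (size p <= 1)%N)).
- by rewrite size_poly0.
- by move=> p q sp sq; rewrite (leq_trans (size_polyD _ _)) // geq_max sp.
- move=> c i k k0; have /size1_polyC -> := h k k0.
  by rewrite log_actC scale_polyC size_polyC leq_b1.
Qed.

Section Solution.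
Variable y : gseries.
Hypothesis yA : forall e, capply A y e = 0.

Let eqn E : log_act (principal A v) E (y E) = - remainder A v y E.
Proof. by apply/eqP; rewrite -addr_eq0 -capplyE yA. Qed.

(** The coefficient of highest degree in log z of P(E + D)(y E) = 0 is
    P(E) times that of y E. *)
Lemma leading_exponent_root E : y E != 0 ->
  (forall k : nat, (0 < k)%N -> y (E - k%:R) = 0) -> root (principal A v) E.
Proof.
move=> yE low; have := eqn E; rewrite (remainder_eq0 low) oppr0.
case E1 : (size (y E)) => [|[|d]] h.
- by move: yE; rewrite -size_poly_eq0 E1.
- have /size1_polyC yC : (size (y E) <= 1)%N by rewrite E1.
  move: h yE; rewrite yC log_actC => /eqP; rewrite !polyC_eq0 mulf_eq0.
  by case/orP=> [//|->].
- have := congr1 (fun p : {poly algC} => p`_d.+1) h.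
  rewrite /= log_act_coefS ?E1 // coef0 => /eqP; rewrite mulf_eq0 => /orP[//|].
  by have := lead_coef_eq0 (y E); rewrite lead_coefE E1 /= (negPf yE) => ->.
Qed.

(** If y E has degree d.+1 > 0, then the coefficient of degree d of
    P(E + D)(y E) = 0 is P'(E) times a nonzero constant. *)
Lemma leading_coef_log_free E : y E != 0 ->
  (forall k : nat, (0 < k)%N -> y (E - k%:R) = 0) ->
  ~~ root (principal A v)^`() E -> (size (y E) <= 1)%N.
Proof.
move=> yE low simple; have rE := leading_exponent_root yE low.
rewrite leqNgt; apply: contra simple => s1.
have [d sd] : exists d, size (y E) = d.+2 by case: (size (y E)) s1 => [|[|d]] // _; exists d.
have := eqn E; rewrite (remainder_eq0 low) oppr0 => /(congr1 (fun p : {poly algC} => p`_d)).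
rewrite /= log_act_coef ?sd // (eqP rE) mul0r add0r coef0 => /eqP.
rewrite -mulr_natr !mulf_eq0 pnatr_eq0 orbF => /orP[//|].
by have := lead_coef_eq0 (y E); rewrite lead_coefE sd /= (negPf yE) => ->.
Qed.

(** If P(E) is nonzero, P(E + D) preserves degrees, so that y E inherits the
    degree of the remainder. *)
Lemma log_free_step E :
  (forall k : nat, (0 < k)%N -> (size (y (E - k%:R)%R) <= 1)%N) ->
  ~~ root (principal A v) E -> (size (y E) <= 1)%N.
Proof.
move=> low; apply: contraR; rewrite -ltnNge => s1.
have [d sd] : exists d, size (y E) = d.+2 by case: (size (y E)) s1 => [|[|d]] // _; exists d.
have := congr1 (fun p : {poly algC} => p`_d.+1) (eqn E).
rewrite /= log_act_coefS ?sd // coefN [X in - X]nth_default; last first.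
  exact: leq_trans (remainder_log_free low) _.
rewrite oppr0 => /eqP; rewrite mulf_eq0 => /orP[//|].
have := lead_coef_eq0 (y E); rewrite lead_coefE sd /= => ->.
by rewrite -size_poly_eq0 sd.
Qed.

End Solution.

Definition series_at (e0 : algC) (c : nat -> algC) : gseries := fun e =>
  if e - e0 \is a Num.nat then (c (Num.truncn (e - e0)))%:P else 0.

Lemma series_atE e0 c n : series_at e0 c (e0 + n%:R) = (c n)%:P.
Proof. by rewrite /series_at addrAC subrr add0r natr_nat natrK. Qed.

(** Frobenius' method: beyond m the indicial polynomial does not vanish, and the
    recurrence determines the coefficients. *)
Lemma frobenius_solution (e0 : algC) (m : nat) (c0 : nat -> algC) :
  (forall n, (n <= m)%N ->
     (principal A v).[e0 + n%:R] * c0 n + (remainder A v (series_at e0 c0) (e0 + n%:R))`_0 = 0) ->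
  (forall n, (m < n)%N -> ~~ root (principal A v) (e0 + n%:R)) ->
  exists c, (forall n, (n <= m)%N -> c n = c0 n) /\
            forall e, capply A (series_at e0 c) e = 0.
Proof.
move=> init nroot.
pose G n (u : nat -> algC) := if (n <= m)%N then c0 n else
  - (remainder A v (series_at e0 u) (e0 + n%:R))`_0 / (principal A v).[e0 + n%:R].
have Gext n u u' : (forall i, (i < n)%N -> u i = u' i) ->
    remainder A v (series_at e0 u) (e0 + n%:R) = remainder A v (series_at e0 u') (e0 + n%:R).
  move=> h; apply: eq_remainder => k k0; rewrite /series_at; case: ifP => // kn.
  rewrite h //; rewrite natrEtruncn in kn; move/eqP: kn => kn.
  rewrite -(ltr_nat algC) kn addrAC [e0 + _]addrC addrK.
  by rewrite gtrBl ltr0n.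
have [|c cE] := @recursive_sequence _ 0 G.
  by move=> n u u' h; rewrite /G (Gext n u u').
exists c; split=> [n nm|e]; first by rewrite cE /G nm.
rewrite -[e](addrK v%:~R) capplyE; move: (e + _) => {e} E.
case: (boolP (E - e0 \is a Num.nat)) => [|nE]; last first.
  rewrite remainder_eq0 ?addr0 /series_at ?(negPf nE) ?log_act0r // => k k0.
  case: ifP => // h; case/negP: nE; have -> : E - e0 = E - k%:R - e0 + k%:R by ring.
  by rewrite rpredD ?natr_nat.
case/natrP => n nE; have {nE} -> : E = e0 + n%:R by rewrite -nE addrC subrK.
rewrite series_atE log_actC.
have /size1_polyC -> : (size (remainder A v (series_at e0 c) (e0 + n%:R)%R) <= 1)%N.
  apply: remainder_log_free => k _; rewrite /series_at; case: ifP => _.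
    by rewrite size_polyC leq_b1.
  by rewrite size_poly0.
rewrite -polyCD; case: (leqP n m) => nm.
  rewrite (Gext _ _ c0) ?cE /G ?nm ?init // => i lt_in.
  by rewrite cE /G (leq_trans (ltnW lt_in) nm).
rewrite cE /G leqNgt nm /= mulrC divfK ?addNr //.
exact: nroot.
Qed.

End Bound.

(** The operators shift exponents by integers, hence act separately on the
    classes of exponents modulo the integers. *)
Definition exponent_class (rho : algC) (y : gseries) : gseries :=
  fun e => if e - rho \is a Num.int then y e else 0.

Lemma capply_exponent_class A rho y e :
  capply A (exponent_class rho y) e = exponent_class rho (capply A y) e.
Proof.
have E i j : iter i gderiv (exponent_class rho y) (e - j%:R) =
    if e - rho \is a Num.int then iter i gderiv y (e - j%:R) else 0.
  rewrite !iter_gderiv /exponent_class.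
  have -> : e - j%:R + i%:R - rho = e - rho + (i%:Z - j%:Z)%:~R :> algC.
    by rewrite rmorphB /=; ring.
  by rewrite rpredDr ?intr_int //; case: ifP => // _; rewrite log_act0r.
rewrite /capply /exponent_class; case: ifP => h.
  by apply: eq_bigr => i _; apply: eq_bigr => j _; rewrite E h.
by rewrite big1 // => i _; rewrite big1 // => j _; rewrite E h scaler0.
Qed.

Lemma capplyB A y y' e :
  capply A (fun x => y x - y' x) e = capply A y e - capply A y' e.
Proof.
rewrite -sumrB; apply: eq_bigr => i _; rewrite -sumrB; apply: eq_bigr => j _.
rewrite -scalerBr !iter_gderiv log_actDr -[- y' _]scaleN1r log_actZr scaleN1r //.
Qed.

End Recurrence.

(** * Indicial polynomials *)

Section Lowest.
Variable F : fieldType.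
Implicit Types p q : {poly F}.

Definition lowest_coef p := p`_(mup 0 p).

Lemma dvdXnP n p : reflect (forall j, (j < n)%N -> p`_j = 0) ('X^n %| p).
Proof.
apply: (iffP idP) => [/dvdpP[q ->] j jn|h]; first by rewrite coefMXn jn.
apply/dvdpP; exists (drop_poly n p); rewrite -{1}(poly_take_drop n p).
suff -> : take_poly n p = 0 by rewrite add0r.
by apply/polyP => j; rewrite coef_take_poly coef0; case: ifP => // /h.
Qed.

Lemma mup0_geq n p : p != 0 -> (n <= mup 0 p)%N = ('X^n %| p).
Proof. by move=> p0; rewrite mup_geq // subr0. Qed.

Lemma coef_lt_mup p j : (j < mup 0 p)%N -> p`_j = 0.
Proof.
have [->|p0] := eqVneq p 0; first by rewrite coef0.
by move=> h; apply: (dvdXnP (mup 0 p) p _ j h); rewrite -mup0_geq.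
Qed.

Lemma lowest_coef_neq0 p : p != 0 -> lowest_coef p != 0.
Proof.
move=> p0; apply/eqP => h; have := ltnn (mup 0 p); rewrite mup0_geq // => /negP[].
by apply/dvdXnP => j; rewrite ltnS leq_eqVlt => /predU1P[->//|/coef_lt_mup].
Qed.

Lemma mup_le p j : p`_j != 0 -> (mup 0 p <= j)%N.
Proof. by move=> h; rewrite leqNgt; apply: contra h => /coef_lt_mup ->. Qed.

Lemma lowest_coefM p q : p != 0 -> q != 0 ->
  lowest_coef (p * q) = lowest_coef p * lowest_coef q.
Proof.
move=> p0 q0; rewrite /lowest_coef mupM // coefM.
have lt : (mup 0 p < (mup 0 p + mup 0 q).+1)%N by rewrite ltnS leq_addr.
rewrite (bigD1 (Ordinal lt)) //= addKn big1 ?addr0 // => i.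
rewrite -val_eqE /=; case: (ltngtP i (mup 0 p)) => // h _.
  by rewrite coef_lt_mup ?mul0r.
rewrite [q`_ _]coef_lt_mup ?mulr0 //.
have := ltn_ord i; move: h; case: (i : nat) => // k; move: (mup 0 p) (mup 0 q) => a b; lia.
Qed.

End Lowest.

Section ValLc.
Implicit Types a b : {poly algC}.

Lemma val0_div a b : a != 0 -> b != 0 ->
  val0 (tofrac a / tofrac b) = (mup 0 a)%:Z - (mup 0 b)%:Z.
Proof.
move=> a0 b0; set x := _ / _; rewrite /val0; have d0 := denom_ratioP (repr x).
have /eqP := frac_repr x; rewrite {1}/x eq_frac // => /eqP h.
have n0 : \n_(repr x) != 0.
  apply: contraTneq isT => n0; move/eqP: h; rewrite n0 mul0r mulf_eq0.
  by rewrite (negPf a0) (negPf d0).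
have E : (mup 0 a + mup 0 \d_(repr x) = mup 0 \n_(repr x) + mup 0 b)%N.
  by rewrite -!mupM // h.
change ((mup 0 \n_(repr x))%:Z - (mup 0 \d_(repr x))%:Z = (mup 0 a)%:Z - (mup 0 b)%:Z).
by move: E; move: (mup 0 a) (mup 0 b) (mup 0 \n_(repr x)) (mup 0 \d_(repr x)) => k l m n; lia.
Qed.

Lemma lc0_div a b : a != 0 -> b != 0 ->
  lc0 (tofrac a / tofrac b) = lowest_coef a / lowest_coef b.
Proof.
move=> a0 b0; set x := _ / _; rewrite /lc0 -/(lowest_coef _) -/(lowest_coef _).
have d0 := denom_ratioP (repr x).
have /eqP := frac_repr x; rewrite {1}/x eq_frac // => /eqP h.
have n0 : \n_(repr x) != 0.
  apply: contraTneq isT => n0; move/eqP: h; rewrite n0 mul0r mulf_eq0.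
  by rewrite (negPf a0) (negPf d0).
apply/eqP; rewrite eqr_div ?lowest_coef_neq0 // -!lowest_coefM //.
by rewrite h.
Qed.

End ValLc.

Lemma clear_denominators (R : idomainType) (N : {poly {fraction R}}) :
  exists d A, d != 0 /\ map_poly (@tofrac R) A = tofrac d *: N.
Proof.
elim/poly_ind: N => [|N c [d [A [d0 dA]]]].
  by exists 1, 0; rewrite oner_eq0 rmorph0 scaler0.
have [a [b [b0 ->]]] := fracP c.
exists (b * d), (b *: A * 'X + (a * d)%:P); split; first by rewrite mulf_neq0.
rewrite rmorphD rmorphM /= map_polyZ map_polyX map_polyC /= dA.
rewrite !tofracM scalerDr scalerAl scalerA scale_polyC; congr (_ + _%:P).
by rewrite [RHS]mulrC mulrA divfK ?tofrac_eq0.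
Qed.

Lemma monic_falling i : falling i \is monic.
Proof. by rewrite monic_prod // => k _; exact: monicXsubC. Qed.

Lemma size_falling i : size (falling i) = i.+1.
Proof.
elim: i => [|i IH]; first by rewrite /falling big_ord0 size_poly1.
by rewrite fallingS size_Mmonic ?monicXsubC ?monic_neq0 ?monic_falling // IH size_XsubC addn2.
Qed.

(** Falling factorials have distinct degrees. *)
Lemma falling_free n (c : nat -> algC) :
  \sum_(i < n) c i *: falling i = 0 -> forall i, (i < n)%N -> c i = 0.
Proof.
elim: n => // n IH; rewrite big_ord_recr /= => h i.
have cn : c n = 0.
  have := congr1 (fun p : {poly algC} => p`_n) h.
  rewrite /= coefD coefZ coef0 coef_sum big1 ?add0r; last first.
    by move=> j _; rewrite coefZ nth_default ?mulr0 // size_falling.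
  have := monicP (monic_falling n); rewrite lead_coefE size_falling /= => ->.
  by rewrite mulr1.
rewrite ltnS leq_eqVlt => /predU1P[->//|]; apply: IH.
by move: h; rewrite cn scale0r addr0.
Qed.

Fact newton_edge (i i0 m m0 e : int) :
  i - m <= i0 - m0 -> m - e - i <= m0 - e - i0 -> i - m = i0 - m0.
Proof. by lia. Qed.

Fact newton_edge_le (i j m m' e v : int) :
  i - m = v -> j - m' <= v -> m - e - i <= m' - e - j.
Proof. by lia. Qed.

Fact newton_edge_eq (i v : int) (j m : nat) : i - j%:Z = v -> i - m%:Z = v -> j = m.
Proof. by lia. Qed.

Fact newton_edge_max (i v : int) (j m : nat) :
  i - m%:Z <= v -> (m <= j)%N -> i - j%:Z = v -> i - m%:Z = v.
Proof. by lia. Qed.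

(** Left multiplication by a function changes the indicial polynomial by a
    constant factor only. *)
Lemma indicial_principal (N : rdiffop algC) (A : pdiffop algC) (d : {poly algC}) :
  N != 0 -> d != 0 -> map_poly (@tofrac {poly algC}) A = tofrac d *: N ->
  exists v, [/\ shift_bound A v, principal A v = lowest_coef d *: indicial0 N &
    exists2 i : nat, A`_i != 0 & i%:Z - (mup 0 A`_i)%:Z = v].
Proof.
move=> N0 d0 dA.
have td : tofrac d != 0 by rewrite tofrac_eq0.
have sN : size N = size A.
  by rewrite -(size_map_tofrac A) dA size_scale.
have NE i : N`_i = tofrac A`_i / tofrac d.
  have := congr1 (fun p : {poly {fraction {poly algC}}} => p`_i) dA.
  rewrite /= coef_map coefZ /= => ->; by rewrite mulrC mulKf.
have N0E i : (N`_i != 0) = (A`_i != 0).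
  by rewrite NE mulf_eq0 invr_eq0 tofrac_eq0 (negPf td) orbF.
have A0 : A != 0 by rewrite -size_poly_eq0 -sN size_poly_eq0.
have ltA : ((size A).-1 < size A)%N by rewrite prednK ?size_poly_gt0.
pose w (i : 'I_(size A)) : int := (mup 0 A`_i)%:Z - (i : nat)%:Z.
have lA : A`_(Ordinal ltA) != 0 by rewrite /= -lead_coefE lead_coef_eq0.
(* An edge of the Newton polygon of the operator: i0 attains the largest shift. *)
have [i0 Ai0 i0min] : exists2 i0 : 'I_(size A), A`_i0 != 0 &
    forall i : 'I_(size A), A`_i != 0 -> w i0 <= w i.
  case: (@Order.TotalTheory.arg_minP _ _ _ (Ordinal ltA) (fun i : 'I_(size A) => A`_i != 0) w lA).
  by move=> i0 h1 h2; exists i0.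
pose v := (i0 : nat)%:Z - (mup 0 A`_i0)%:Z.
have vmax i : A`_i != 0 -> i%:Z - (mup 0 A`_i)%:Z <= v.
  move=> Ai; have lt : (i < size A)%N.
    by rewrite ltnNge; apply: contra Ai => h; rewrite nth_default.
  by have := i0min (Ordinal lt) Ai; rewrite /w /v /=; lia.
have coefA (k l : nat) : A`_k`_l != 0 -> A`_k != 0.
  by apply: contraNneq => ->; rewrite coef0.
have bound : shift_bound A v.
  move=> i j Aij; have Ai := coefA _ _ Aij.
  by have := vmax _ Ai; have := mup_le Aij; lia.
exists v; split=> //; last by exists i0.
have -> : indicial0 N = \sum_(i < size N | (A`_i != 0) && (i%:Z - (mup 0 A`_i)%:Z == v))
    lc0 N`_i *: \prod_(k < i) ('X - (k%:R)%:P).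
  rewrite /indicial0; apply: eq_bigl => i.
  apply: (etrans (congr1 (fun b => b && _) (N0E i))).
  apply: andb_id2l => Ai.
  have valN k : A`_k != 0 -> val0 N`_k = (mup 0 A`_k)%:Z - (mup 0 d)%:Z.
    by move=> Ak; rewrite NE val0_div.
  apply/forallP/eqP => [h|iv j].
    have i0N : (i0 < size N)%N by rewrite sN.
    have := h (Ordinal i0N); rewrite /= N0E Ai0 /= !valN //.
    by move=> le1; exact: newton_edge (vmax _ Ai) le1.
  by apply/implyP; rewrite N0E => Aj; rewrite !valN //; exact: newton_edge_le iv (vmax _ Aj).
rewrite sN scaler_sumr big_mkcond /principal /=; apply: eq_bigr => i _.
case: ifPn => [/andP[Ai /eqP iv]|niv].
  have mA : (mup 0 (A`_i)%R < size (A`_i)%R)%N.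
    rewrite ltnNge; apply: contra (lowest_coef_neq0 Ai) => h.
    by rewrite /lowest_coef nth_default.
  rewrite (bigD1 (Ordinal mA)) /=; last by rewrite iv.
  rewrite big1 ?addr0; last first.
    move=> j /andP[/eqP ij]; rewrite -val_eqE /= => /eqP jm; case: jm.
    exact: newton_edge_eq ij iv.
  by rewrite NE lc0_div // scalerA mulrCA divff ?mulr1 ?lowest_coef_neq0.
rewrite big1 // => j /eqP ij; case: (eqVneq A`_i`_j 0) => [->|Aij]; first by rewrite scale0r.
have Ai := coefA _ _ Aij.
move: niv; rewrite Ai /= => /eqP[]; exact: newton_edge_max (vmax _ Ai) (mup_le Aij) ij.
Qed.

Lemma size_principal (A : pdiffop algC) v : (size (principal A v) <= size A)%N.
Proof.
apply: (leq_trans (size_sum _ _ _)); apply/bigmax_leqP => i _.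
apply: (leq_trans (size_sum _ _ _)); apply/bigmax_leqP => j _.
by rewrite (leq_trans (size_scale_leq _ _)) // size_falling.
Qed.

Lemma principal_neq0 (A : pdiffop algC) v i : A`_i != 0 ->
  i%:Z - (mup 0 A`_i)%:Z = v -> principal A v != 0.
Proof.
move=> Ai iv; have lt : (i < size A)%N.
  by rewrite ltnNge; apply: contra Ai => h; rewrite nth_default.
pose c (k : nat) := \sum_(j < size A`_k | k%:Z - j%:Z == v) A`_k`_j.
have mA : (mup 0 (A`_i)%R < size (A`_i)%R)%N.
  rewrite ltnNge; apply: contra (lowest_coef_neq0 Ai) => le.
  by rewrite /lowest_coef nth_default.
have ci : c i = lowest_coef A`_i.
  rewrite /c (bigD1 (Ordinal mA)) /=; last by rewrite iv.
  rewrite big1 ?addr0 // => j /andP[/eqP ij]; rewrite -val_eqE /= => /eqP jm; case: jm.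
  exact: newton_edge_eq ij iv.
have pE : principal A v = \sum_(k < size A) c k *: falling k.
  by apply: eq_bigr => k _; rewrite scaler_suml.
apply/eqP => p0; have := @falling_free (size A) c.
rewrite -pE => /(_ p0 i lt); rewrite ci => /eqP.
exact/negP/lowest_coef_neq0.
Qed.

(** * Expansion of rational functions in a ramified local parameter *)

Section Expansion.
Variable F : fieldType.

Fact tofrac_fps_of_poly_inj : injective (@tofrac (fps F) \o @fps_of_poly F).
Proof.
exact: inj_comp (@tofrac_inj _) (@fps_of_poly_inj F).
Qed.

(** The expansion of a rational function in w, for w = t ^ N.+1. *)
Definition expand (N : nat) (x : {fraction {poly F}}) : laurent F :=
  lau_ramify N (frac_ext tofrac_fps_of_poly_inj x).

Fact expand_zmod_morphism N : zmod_morphism (expand N).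
Proof. exact: (rmorphB (lau_ramify N \o frac_ext tofrac_fps_of_poly_inj)). Qed.
Fact expand_monoid_morphism N : monoid_morphism (expand N).
Proof.
split; first exact: (rmorph1 (lau_ramify N \o frac_ext tofrac_fps_of_poly_inj)).
exact: (rmorphM (lau_ramify N \o frac_ext tofrac_fps_of_poly_inj)).
Qed.
HB.instance Definition _ N := GRing.isZmodMorphism.Build _ _ (expand N)
  (@expand_zmod_morphism N).
HB.instance Definition _ N := GRing.isMonoidMorphism.Build _ _ (expand N)
  (@expand_monoid_morphism N).

Lemma expand_tofrac N p :
  expand N (tofrac p) = tofrac (fps_of_poly (p \Po 'X^(N.+1))).
Proof.
by rewrite /expand frac_ext_tofrac /= lau_ramify_tofrac ramify_poly.
Qed.

Lemma expand_const N c : expand N (tofrac c%:P) = lau_const c.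
Proof. by rewrite expand_tofrac comp_polyC. Qed.

Lemma expand_X N : expand N (tofrac 'X) = lau_t F ^+ N.+1.
Proof. by rewrite expand_tofrac comp_polyX rmorphXn tofracXn. Qed.

(** d/dw for w = t ^ N.+1 *)
Definition deriv_w (N : nat) (x : laurent F) : laurent F :=
  (lau_const N.+1%:R * lau_t F ^+ N)^-1 * lau_deriv x.

Lemma derivation_deriv_w N : derivation (deriv_w N).
Proof. exact/scale_derivation/derivation_lau_deriv. Qed.

Hypothesis char0 : forall n, n.+1%:R != 0 :> F.

(** By the chain rule it suffices that dw/dw = 1. *)
Lemma deriv_w_expand N x : deriv_w N (expand N x) = expand N (frac_deriv (@deriv F) x).
Proof.
apply: (frac_rmorph_deriv (psi := expand N)).
- exact: derivation_poly_deriv.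
- exact: derivation_deriv_w.
move=> p; have derD := derivation_deriv_w N.
have dC c : deriv_w N (expand N (tofrac c%:P)) = 0.
  by rewrite expand_const /deriv_w lau_deriv_const mulr0.
rewrite [LHS](deriv_rmorph_poly derD (phi := expand N \o @tofrac {poly F}) dC p).
rewrite -[RHS]mul1r; congr (_ * _).
rewrite /= expand_X /deriv_w (derivationX (derivation_lau_deriv F)) lau_deriv_t mulr1 /=.
have -> : lau_t F ^+ N *+ N.+1 = lau_const N.+1%:R * lau_t F ^+ N.
  by rewrite (rmorph_nat (@lau_const F)) mulr_natl.
by rewrite mulVf ?rmorph1 // mulf_neq0 ?expf_neq0 ?lau_t_neq0 // fmorph_eq0.
Qed.

Lemma lcoef_expandM N p g k :
  lcoef (expand N (tofrac p) * g) k =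
  \sum_(j < size p) p`_j * lcoef g (k - (N.+1 * j)%:Z).
Proof.
rewrite -[p in LHS]coefK poly_def !rmorph_sum mulr_suml lcoef_sum; apply: eq_bigr => j _.
rewrite -mul_polyC /= tofracM tofracXn !rmorphM /= expand_const rmorphXn /= expand_X.
by rewrite -mulrA lcoefZ -exprM lcoefXnM.
Qed.

(** The exponent k of t is the exponent k / N.+1 of w. *)
Lemma lcoef_deriv_w N g k :
  lcoef (deriv_w N g) k = (k + N.+1%:Z)%:~R / N.+1%:R * lcoef g (k + N.+1%:Z).
Proof.
have t0 := lau_t_neq0 F.
have -> : deriv_w N g = lau_const N.+1%:R^-1 * (lau_t F ^- N.+1 * (lau_t F * lau_deriv g)).
  rewrite /deriv_w invfM fmorphV -mulrA; congr (_ * _).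
  by rewrite [RHS]mulrA exprSr invfM divfK.
by rewrite lcoefZ lcoefVXnM lcoef_euler mulrA (mulrC _^-1).
Qed.

End Expansion.

(** * From Laurent series to generalized series *)

(** The exponents of t are divided by N.+1 to become exponents of w. *)
Definition to_gseries (N : nat) (g : laurent algC) : gseries := fun e =>
  if N.+1%:R * e \is a Num.int then (lcoef g (Num.floor (N.+1%:R * e)))%:P else 0.

Lemma to_gseries_log_free N g : log_free (to_gseries N g).
Proof.
move=> e; rewrite /to_gseries; case: ifP => _; rewrite ?size_poly0 //.
by rewrite size_polyC leq_b1.
Qed.

Lemma to_gseriesE N g e (k : int) : N.+1%:R * e = k%:~R -> to_gseries N g e = (lcoef g k)%:P.
Proof. by move=> h; rewrite /to_gseries h intr_int intrKfloor. Qed.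

Lemma to_gseries_neq0 N g e : to_gseries N g e != 0 ->
  exists2 k : int, N.+1%:R * e = k%:~R & lcoef g k != 0.
Proof.
rewrite /to_gseries; case: ifP; rewrite ?eqxx // => /intrP[k h].
by rewrite h intrKfloor polyC_eq0; exists k.
Qed.

Lemma to_gseries_scale N (p : {poly algC}) g e :
  to_gseries N (expand N (tofrac p) * g) e =
  \sum_(j < size p) p`_j *: to_gseries N g (e - j%:R).
Proof.
have Ej (j : nat) : N.+1%:R * (e - j%:R) = N.+1%:R * e - (N.+1 * j)%:Z%:~R.
  by rewrite mulrBr -natrM.
case: (boolP (N.+1%:R * e \is a Num.int)) => [/intrP[k kE]|nint].
  rewrite (to_gseriesE _ kE) lcoef_expandM rmorph_sum; apply: eq_bigr => j _ /=.
  rewrite polyCM mul_polyC; congr (_ *: _); apply/esym/to_gseriesE.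
  by rewrite Ej kE -rmorphB.
rewrite {1}/to_gseries (negPf nint) big1 // => j _.
rewrite /to_gseries Ej; case: ifP; rewrite ?scaler0 // => h; case/negP: nint.
by rewrite -[_ * e](subrK (N.+1 * j)%:Z%:~R) rpredD ?intr_int.
Qed.

Lemma to_gseries_deriv N g : to_gseries N (deriv_w N g) =1 gderiv (to_gseries N g).
Proof.
move=> e; rewrite /gderiv.
have n0 : N.+1%:R != 0 :> algC by rewrite pnatr_eq0.
have Ee : N.+1%:R * (e + 1) = N.+1%:R * e + (N.+1%:Z)%:~R by rewrite mulrDr mulr1.
case: (boolP (N.+1%:R * e \is a Num.int)) => [/intrP[k kE]|nint].
  have kE' : N.+1%:R * (e + 1) = (k + N.+1%:Z)%:~R by rewrite Ee kE -rmorphD.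
  rewrite (to_gseriesE _ kE) (to_gseriesE _ kE') derivC addr0 lcoef_deriv_w scale_polyC.
  by rewrite -kE' [N.+1%:R * _]mulrC mulfK.
have -> : to_gseries N g (e + 1) = 0.
  rewrite /to_gseries; case: ifP => // h; case/negP: nint.
  by rewrite -[_ * e](addrK (N.+1%:Z)%:~R) -Ee rpredB ?intr_int.
by rewrite scaler0 poly.deriv0 addr0 /to_gseries (negPf nint).
Qed.

Lemma to_gseries_sum N I (r : seq I) (P : pred I) (G : I -> laurent algC) e :
  to_gseries N (\sum_(i <- r | P i) G i) e = \sum_(i <- r | P i) to_gseries N (G i) e.
Proof.
rewrite /to_gseries; case: ifP => _; last by rewrite big1.
by rewrite lcoef_sum rmorph_sum.
Qed.

Lemma to_gseries_apply N (A : pdiffop algC) g e :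
  to_gseries N (op_act (expand N) (deriv_w N) (map_poly (@tofrac {poly algC}) A) g) e =
  capply A (to_gseries N g) e.
Proof.
have it i : to_gseries N (iter i (deriv_w N) g) =1 iter i gderiv (to_gseries N g).
  elim: i => // i IH x; rewrite !iterS to_gseries_deriv /gderiv !IH //.
rewrite /op_act to_gseries_sum /capply size_map_tofrac.
apply: eq_bigr => i _; rewrite coef_map /= to_gseries_scale.
by apply: eq_bigr => j _; rewrite it.
Qed.

(** * Localization at a point *)

Section RatSubst.
Variable u : {fraction {poly algC}}.
(** A transcendental value can be substituted in rational functions. *)
Hypothesis u_nconst : forall c : algC, u != tofrac c%:P.

Definition subst_poly (p : {poly rat}) : {fraction {poly algC}} :=
  (map_poly (fun c : rat => tofrac (ratr c : algC)%:P) p).[u].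

Let emb : rat -> {fraction {poly algC}} :=
  @tofrac {poly algC} \o (@polyC algC \o (@ratr algC)).

Let subst_polyE p : subst_poly p = (map_poly emb p).[u]. Proof. by []. Qed.

Fact subst_poly_zmod_morphism : zmod_morphism subst_poly.
Proof. by move=> p q; rewrite !subst_polyE rmorphB hornerD hornerN. Qed.
Fact subst_poly_monoid_morphism : monoid_morphism subst_poly.
Proof.
by split=> [|p q]; rewrite !subst_polyE ?rmorph1 ?hornerC // rmorphM hornerM.
Qed.
HB.instance Definition _ := GRing.isZmodMorphism.Build _ _ subst_poly
  subst_poly_zmod_morphism.
HB.instance Definition _ := GRing.isMonoidMorphism.Build _ _ subst_poly
  subst_poly_monoid_morphism.

Lemma subst_polyC c : subst_poly c%:P = tofrac (ratr c)%:P.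
Proof. by rewrite subst_polyE map_polyC hornerC. Qed.

Lemma subst_polyX : subst_poly 'X = u.
Proof. by rewrite subst_polyE map_polyX hornerX. Qed.

(** Over the complex algebraic numbers p is a product of linear factors, none
    of which vanishes at u. *)
Fact subst_poly_inj : injective subst_poly.
Proof.
apply: raddf_inj => p p0.
have {p0} : (map_poly (@tofrac {poly algC} \o @polyC algC) (map_poly (@ratr algC) p)).[u] == 0.
  by rewrite -map_poly_comp; exact/eqP.
have [rs ->] := closed_field_poly_normal (map_poly (@ratr algC) p).
rewrite map_polyZ hornerZ mulf_eq0 /= tofrac_eq0 polyC_eq0 lead_coef_map fmorph_eq0 lead_coef_eq0.
case/orP=> [/eqP //|]; rewrite rmorph_prod horner_prod.
elim: rs => [|r rs IH]; first by rewrite big_nil oner_eq0.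
rewrite big_cons mulf_eq0 => /orP[|//].
by rewrite /= map_polyXsubC hornerXsubC subr_eq0 (negPf (u_nconst r)).
Qed.

Lemma rat_substE x : rat_subst u x = frac_ext subst_poly_inj x.
Proof. by []. Qed.

Fact rat_subst_zmod_morphism : zmod_morphism (rat_subst u).
Proof. by move=> x y; rewrite !rat_substE rmorphB. Qed.
Fact rat_subst_monoid_morphism : monoid_morphism (rat_subst u).
Proof. by split=> [|x y]; rewrite !rat_substE ?rmorph1 // rmorphM. Qed.

End RatSubst.

Section OpAct.
Variables (K L : fieldType) (j : {rmorphism K -> L}) (D : L -> L).
Implicit Types (M : {poly K}) (g : L).

Lemma op_act_wide n M g : (size M <= n)%N ->
  op_act j D M g = \sum_(i < n) j M`_i * iter i D g.
Proof.
move=> h; rewrite /op_act (big_ord_widen _ (fun i => j M`_i * iter i D g) h).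
rewrite big_mkcond /=; apply: eq_bigr => i _; case: ifPn => //.
by rewrite -leqNgt => hi; rewrite nth_default // rmorph0 mul0r.
Qed.

Lemma op_actD M1 M2 g : op_act j D (M1 + M2) g = op_act j D M1 g + op_act j D M2 g.
Proof.
pose n := maxn (size M1) (size M2).
rewrite !(@op_act_wide n) ?leq_maxl ?leq_maxr ?size_polyD // -big_split /=.
by apply: eq_bigr => i _; rewrite coefD rmorphD mulrDl.
Qed.

Lemma op_actZ c M g : op_act j D (c *: M) g = j c * op_act j D M g.
Proof.
rewrite (@op_act_wide (size M)) ?size_scale_leq // mulr_sumr.
by apply: eq_bigr => i _; rewrite coefZ rmorphM mulrA.
Qed.

Lemma op_act0 g : op_act j D 0 g = 0.
Proof. by rewrite /op_act size_poly0 big_ord0. Qed.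

Lemma op_act_sum I (r : seq I) (P : pred I) (G : I -> {poly K}) g :
  op_act j D (\sum_(i <- r | P i) G i) g = \sum_(i <- r | P i) op_act j D (G i) g.
Proof.
exact: (big_morph (fun M => op_act j D M g) (fun a b => op_actD a b g) (op_act0 g)).
Qed.

Lemma op_actMX M g : op_act j D (M * 'X) g = \sum_(i < size M) j M`_i * iter i.+1 D g.
Proof.
rewrite (@op_act_wide (size M).+1); last first.
  by apply: leq_trans (size_polyMleq _ _) _; rewrite size_polyX addn2.
rewrite big_ord_recl coefMX eqxx rmorph0 mul0r add0r.
by apply: eq_bigr => i _; rewrite coefMX.
Qed.

Lemma op_act1 g : op_act j D 1 g = g.
Proof. by rewrite /op_act size_poly1 big_ord1 coef1 rmorph1 mul1r. Qed.

End OpAct.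

(** * Expansions at the points of the projective line *)

Definition local_coord (s : point) : {fraction {poly algC}} :=
  if s is Some c then tofrac ('X + c%:P) else (tofrac 'X)^-1.

(** d/dz is the multiple of d/dw by this function. *)
Definition local_factor (s : point) : {poly algC} := if s is Some _ then 1 else - 'X^2.

Lemma local_coord_nconst s c : local_coord s != tofrac c%:P.
Proof.
case: s => [a|] /=.
  rewrite tofrac_eq; apply/eqP => /(congr1 (fun p : {poly algC} => p`_1)).
  by rewrite coefD coefX !coefC /= addr0 => /eqP; rewrite oner_eq0.
apply/eqP => /(congr1 (fun x => x * tofrac 'X)).
rewrite mulVf ?tofrac_eq0 ?polyX_eq0 // -tofracM -tofrac1 => /eqP.
rewrite tofrac_eq => /eqP /(congr1 (fun p : {poly algC} => p`_0)).
by rewrite coefMX coef1 /= => /eqP; rewrite oner_eq0.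
Qed.

Definition localize_coef (s : point) := rat_subst (local_coord s).
HB.instance Definition _ s := GRing.isZmodMorphism.Build _ _ (localize_coef s)
  (rat_subst_zmod_morphism (local_coord_nconst s)).
HB.instance Definition _ s := GRing.isMonoidMorphism.Build _ _ (localize_coef s)
  (rat_subst_monoid_morphism (local_coord_nconst s)).

Lemma localize_coef_tofrac s p : localize_coef s (tofrac p) = subst_poly (local_coord s) p.
Proof.
exact: (frac_ext_tofrac (@subst_poly_inj (local_coord s) (local_coord_nconst s)) p).
Qed.

(** dz/dz = 1. *)
Lemma frac_deriv_coord s :
  tofrac (local_factor s) * frac_deriv (@deriv algC) (local_coord s) = 1.
Proof.
have der := derivation_poly_deriv algC; have fder := derivation_frac_deriv der.
have X0 : tofrac 'X != 0 :> {fraction {poly algC}} by rewrite tofrac_eq0 polyX_eq0.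
case: s => [a|] /=.
  by rewrite (frac_deriv_tofrac der) derivD derivX derivC addr0 tofrac1 mul1r.
rewrite (derivationV fder X0) (frac_deriv_tofrac der) derivX tofrac1.
by rewrite tofracN tofracXn mulN1r mulrNN divff ?expf_neq0.
Qed.

Section PointExpansion.
Variables (N : nat) (s : point).

Definition point_expand (x : {fraction {poly rat}}) : laurent algC :=
  expand N (localize_coef s x).
Fact point_expand_zmod_morphism : zmod_morphism point_expand.
Proof. exact: (rmorphB (expand N \o localize_coef s)). Qed.
Fact point_expand_monoid_morphism : monoid_morphism point_expand.
Proof.
split; first exact: (rmorph1 (expand N \o localize_coef s)).
exact: (rmorphM (expand N \o localize_coef s)).
Qed.
HB.instance Definition _ := GRing.isZmodMorphism.Build _ _ point_expand
  point_expand_zmod_morphism.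
HB.instance Definition _ := GRing.isMonoidMorphism.Build _ _ point_expand
  point_expand_monoid_morphism.

Definition point_deriv (g : laurent algC) : laurent algC :=
  expand N (tofrac (local_factor s)) * deriv_w N g.

Lemma algC_char0 n : n.+1%:R != 0 :> algC. Proof. by rewrite pnatr_eq0. Qed.

(** Expansion at s is a differential embedding of Q(z): both derivations agree
    on z. *)
Lemma diff_extension_point :
  diff_extension (frac_deriv (@deriv rat)) point_expand point_deriv.
Proof.
have derD : derivation point_deriv by apply/scale_derivation/derivation_deriv_w.
split=> //; apply: (frac_rmorph_deriv (psi := point_expand)) => //.
  exact: derivation_poly_deriv.
move=> p; rewrite /= /point_expand !localize_coef_tofrac.
have dE x : point_deriv (expand N x) = expand N (tofrac (local_factor s) * frac_deriv (@deriv algC) x).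
  by rewrite /point_deriv (deriv_w_expand algC_char0); exact/esym/(rmorphM (expand N)).
pose phi := expand N \o subst_poly (local_coord s).
have dC c : point_deriv (phi c%:P) = 0.
  rewrite /phi /= dE subst_polyC frac_deriv_tofrac; last exact: derivation_poly_deriv.
  by rewrite derivC tofrac0 mulr0 (rmorph0 (expand N)).
rewrite [LHS](deriv_rmorph_poly derD (phi := phi) dC p).
by rewrite /phi /= subst_polyX dE frac_deriv_coord (rmorph1 (expand N)) mul1r.
Qed.

End PointExpansion.

(** Composing an operator T with d/dw on the left gives the operator T' + T d/dw,
    where T' has the derivatives of the coefficients of T. *)
Lemma op_act_inv_deriv N i g :
  op_act (expand N) (deriv_w N) (map_poly (@tofrac {poly algC}) (inv_deriv_exp i)) g =
  iter i (point_deriv N None) g.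
Proof.
elim: i => [|i IH]; first by rewrite /inv_deriv_exp /= rmorph1 op_act1.
rewrite iterS -{}IH [inv_deriv_exp i.+1]/(_ *: _) /= -/(inv_deriv_exp i).
set T := inv_deriv_exp i.
rewrite map_polyZ op_actZ /=; congr (_ * _).
rewrite rmorphD rmorphM /= map_polyX op_actD op_actMX.
have derD := @derivation_deriv_w algC N.
have der := derivation_poly_deriv algC.
rewrite {2}/op_act (derivation_sum derD).
under [RHS]eq_bigr => k _.
  rewrite (derivationM derD) (deriv_w_expand algC_char0) coef_map /= (frac_deriv_tofrac der).
  over.
rewrite big_split /=; congr (_ + _); last first.
  by apply: eq_bigr => k _; rewrite coef_map.
rewrite size_map_tofrac.
rewrite (@op_act_wide _ _ _ _ (size T)); last first.
  by rewrite size_map_tofrac size_poly.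
by apply: eq_bigr => k _; rewrite coef_map coef_map.
Qed.

(** At a finite point only the coefficients are translated; at infinity
    d/dz = - w^2 d/dw, and its powers are given by [op_act_inv_deriv]. *)
Lemma localize_act N s (M : rdiffop rat) g :
  op_act (expand N) (deriv_w N) (localize s M) g =
  op_act (point_expand N s) (point_deriv N s) M g.
Proof.
case: s => [c|] /=.
  have -> : map_poly (rat_subst (tofrac ('X + c%:P))) M = map_poly (localize_coef (Some c)) M by [].
  rewrite /op_act size_map_poly; apply: eq_bigr => i _; rewrite coef_map; congr (_ * _).
  elim: (i : nat) => // k IH; rewrite !iterS IH /point_deriv /=.
  by rewrite tofrac1 (rmorph1 (expand N)) mul1r.
rewrite op_act_sum [RHS]/op_act; apply: eq_bigr => i _.
by rewrite op_actZ op_act_inv_deriv.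
Qed.

(** * The minimal operator in the field of Laurent series *)

Definition to_fps (f : series) : fps algC := Fps (fun n => ratr (f n)).
Definition to_laurent (f : series) : laurent algC := tofrac (to_fps f).

Lemma to_fps_poly p : to_fps (series_of_poly p) = fps_of_poly (map_poly ratr p).
Proof. by apply: fpsP => n; rewrite /= coef_map. Qed.

Lemma to_fps_mul f g : to_fps (series_mul f g) = to_fps f * to_fps g.
Proof.
apply: fpsP => n; rewrite fcoefM /= rmorph_sum; apply: eq_bigr => i _.
by rewrite /= rmorphM.
Qed.

Lemma to_fps_exp f k : to_fps (series_exp f k) = to_fps f ^+ k.
Proof.
elim: k => [|k IH]; last by rewrite exprS -IH -to_fps_mul.
by rewrite expr0 /series_exp /= to_fps_poly rmorph1 (rmorph1 (@fps_of_poly algC)).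
Qed.

Lemma to_fps_deriv f i : to_fps (iter i series_deriv f) = iter i (@fps_deriv algC) (to_fps f).
Proof.
elim: i => // i IH; rewrite !iterS -IH; apply: fpsP => n /=.
by rewrite rmorphMn.
Qed.

Lemma localize_coef_origin p :
  localize_coef (Some 0) (tofrac p) = tofrac (map_poly ratr p).
Proof.
rewrite localize_coef_tofrac /subst_poly /=.
have -> : map_poly (fun c : rat => tofrac (ratr c : algC)%:P) p =
    map_poly (@tofrac {poly algC}) (map_poly (@polyC algC) (map_poly (@ratr algC) p)).
  by rewrite -!map_poly_comp.
rewrite horner_map /=; congr tofrac.
by rewrite addr0 -/(comp_poly _ _) comp_polyXr.
Qed.

Lemma point_expand_origin p :
  point_expand 0 (Some 0) (tofrac p) = tofrac (fps_of_poly (map_poly ratr p)).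
Proof.
by rewrite /point_expand localize_coef_origin expand_tofrac expr1 comp_polyXr.
Qed.

Lemma point_deriv_origin g : point_deriv 0 (Some 0) g = lau_deriv g.
Proof.
rewrite /point_deriv /= tofrac1 (rmorph1 (expand 0)) mul1r /deriv_w.
by rewrite rmorph1 expr0 mulr1 invr1 mul1r.
Qed.

Local Notation j0 := (point_expand 0 (Some 0)).
Local Notation D0 := (point_deriv 0 (Some 0)).

Lemma iter_point_deriv_origin i f :
  iter i D0 (to_laurent f) = to_laurent (iter i series_deriv f).
Proof.
rewrite /to_laurent to_fps_deriv; elim: i => // i IH.
rewrite !iterS IH point_deriv_origin /lau_deriv frac_deriv_tofrac //.
exact: derivation_fps_deriv.
Qed.

Lemma op_act_apply (L : pdiffop rat) f :
  op_act j0 D0 (map_poly (@tofrac {poly rat}) L) (to_laurent f) = to_laurent (op_apply L f).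
Proof.
rewrite /op_act size_map_tofrac.
have -> : to_laurent (op_apply L f) = tofrac (\sum_(i < size L)
    to_fps (series_mul (series_of_poly L`_i) (iter i series_deriv f))).
  by congr tofrac; apply: fpsP => n; rewrite fcoef_sum /= rmorph_sum.
rewrite rmorph_sum; apply: eq_bigr => i _ /=.
by rewrite coef_map /= point_expand_origin iter_point_deriv_origin to_fps_mul to_fps_poly tofracM.
Qed.

Lemma to_laurent_eq0 f : to_laurent f = 0 <-> forall n, f n = 0.
Proof.
split=> [/eqP|f0]; rewrite /to_laurent.
  rewrite tofrac_eq0 => /eqP h n; apply/eqP; rewrite -(fmorph_eq0 (@ratr algC)).
  by have := congr1 (fun a => fcoef a n) h; rewrite fcoef0 /= => ->.
suff -> : to_fps f = 0 by rewrite tofrac0.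
by apply: fpsP => n; rewrite fcoef0 /= f0 rmorph0.
Qed.

(** Annihilation is insensitive to the choice of the cleared denominator. *)
Lemma rannihilatesP (M : rdiffop rat) f :
  rannihilates M f <-> op_act j0 D0 M (to_laurent f) = 0.
Proof.
split=> [[L [d d0 dL] Lf]|Mf].
  have : op_act j0 D0 (map_poly (@tofrac {poly rat}) L) (to_laurent f) = 0.
    by rewrite op_act_apply; apply/to_laurent_eq0.
  rewrite dL op_actZ => /eqP; rewrite mulf_eq0 fmorph_eq0 tofrac_eq0 (negPf d0) /=.
  by move/eqP.
have [d [L [d0 dL]]] := clear_denominators M; exists L; first by exists d.
by apply/to_laurent_eq0; rewrite -op_act_apply dL op_actZ Mf mulr0.
Qed.

Lemma algebraic_root f : algebraic f ->
  exists2 P : {poly {fraction {poly rat}}}, P != 0 & root (map_poly j0 P) (to_laurent f).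
Proof.
move=> [P [P0 Pf]]; exists (map_poly (@tofrac {poly rat}) P).
  by rewrite -size_poly_eq0 size_map_tofrac size_poly_eq0.
apply/eqP; rewrite -map_poly_comp (@horner_coef_wide _ (size P)); last exact: size_poly.
transitivity (to_laurent (fun n => \sum_(i < size P)
      series_mul (series_of_poly P`_i) (series_exp f i) n)); last exact/to_laurent_eq0.
have -> : to_laurent (fun n => \sum_(i < size P)
      series_mul (series_of_poly P`_i) (series_exp f i) n) =
    tofrac (\sum_(i < size P) to_fps (series_mul (series_of_poly P`_i) (series_exp f i))).
  by congr tofrac; apply: fpsP => n; rewrite fcoef_sum /= rmorph_sum.
rewrite rmorph_sum; apply: eq_bigr => i _ /=.
by rewrite coef_map /= point_expand_origin to_fps_mul to_fps_poly to_fps_exp tofracM tofracXn.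
Qed.

(** A relation is an operator of order less than r that annihilates f. *)
Lemma Lmin_independent f M : is_Lmin f M ->
  forall u : 'rV_(ord M), \sum_i j0 (u 0 i) * iter i D0 (to_laurent f) = 0 -> u = 0.
Proof.
move=> [_ _ Mmin] u uf; apply/eqP; apply: contraT => u0.
pose M' : rdiffop rat := \poly_(i < ord M) (if insub i is Some k then u 0 k else 0).
have M'E (i : 'I_(ord M)) : M'`_i = u 0 i.
  by rewrite coef_poly ltn_ord insubT //= => lt; congr (u 0 _); apply: val_inj.
have M'0 : M' != 0.
  apply: contraNneq u0 => M'0; apply/eqP/rowP => i.
  by rewrite mxE -M'E M'0 coef0.
have sM' : (size M' <= ord M)%N by exact: size_poly.
have : (ord M <= ord M')%N.
  apply: Mmin => //; apply/rannihilatesP; rewrite (op_act_wide _ _ _ sM') -[RHS]uf.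
  by apply: eq_bigr => i _; rewrite M'E.
have : (0 < size M')%N by rewrite size_poly_gt0.
rewrite [ord M']/ord; move: sM'; case: (size M') => //= k kM _ Mk.
by have := leq_ltn_trans Mk kM; rewrite ltnn.
Qed.

(** * Local exponents of the minimal operator of an algebraic series *)

Lemma rat_fraction_char0 n : n.+1%:R != 0 :> {fraction {poly rat}}.
Proof.
by rewrite -(rmorph_nat (@tofrac {poly rat})) tofrac_eq0 -polyC_natr polyC_eq0 pnatr_eq0.
Qed.

(** The solutions are the roots, expanded at s, of the minimal polynomial of f;
    f itself is expanded at the origin. *)
Lemma puiseux_solutions f M s : is_Lmin f M -> algebraic f ->
  exists N (gs : seq (laurent algC)),
    (forall g, g \in gs -> op_act (expand N) (deriv_w N) (localize s M) g = 0) /\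
    \rank (\matrix_(k < size gs, i < ord M) iter i (point_deriv N s) gs`_k) = ord M.
Proof.
move=> Mf /algebraic_root[P0 P0n rP0].
have [_ /rannihilatesP Mf0 _] := Mf.
have [P Pn conj] := conjugate_solutions rat_fraction_char0
  (derivation_frac_deriv (derivation_poly_deriv rat)) (diff_extension_point 0 (Some 0))
  P0n rP0 Mf0 (Lmin_independent Mf).
have [N [c [gs Pgs]]] := puiseux (map_poly (point_expand 0 s) P).
exists N, gs.
have E : map_poly (point_expand N s) P = c *: \prod_(g <- gs) ('X - g%:P).
  rewrite -Pgs -map_poly_comp; apply: eq_map_poly => x.
  by rewrite /point_expand /expand /= lau_ramify0.
have [Mgs rk] := conj _ _ _ _ _ (diff_extension_point N s) E; split=> // g /Mgs.
by rewrite localize_act.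
Qed.

Section Combination.
Variables (K : fieldType) (L : fieldType) (j : {rmorphism K -> L}) (D : L -> L).
Hypothesis der : derivation D.

Lemma iter_deriv_comb i I (r : seq I) (a g : I -> L) : (forall k, D (a k) = 0) ->
  iter i D (\sum_(k <- r) a k * g k) = \sum_(k <- r) a k * iter i D (g k).
Proof.
move=> Da; elim: i => // i IH; rewrite iterS IH (derivation_sum der).
by apply: eq_bigr => k _; rewrite (derivationM der) Da mul0r add0r.
Qed.

Lemma op_act_comb M I (r : seq I) (a g : I -> L) : (forall k, D (a k) = 0) ->
  op_act j D M (\sum_(k <- r) a k * g k) = \sum_(k <- r) a k * op_act j D M (g k).
Proof.
move=> Da; rewrite /op_act.
under eq_bigr do rewrite iter_deriv_comb // mulr_sumr.
rewrite exchange_big; apply: eq_bigr => k _; rewrite mulr_sumr; apply: eq_bigr => i _.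
by rewrite mulrCA.
Qed.

End Combination.

Lemma deriv_w_const N (c : algC) : deriv_w N (lau_const c) = 0.
Proof. by rewrite /deriv_w lau_deriv_const mulr0. Qed.

Lemma lcoef_lowest (F : fieldType) (g : laurent F) : g != 0 ->
  exists2 k, lcoef g k != 0 & forall i, i < k -> lcoef g i = 0.
Proof.
move=> g0; have [m gm] := lcoef_bounded g.
have ex : exists n : nat, lcoef g (n%:Z - m%:Z) != 0.
  apply: contrapT => h; case/eqP: g0; apply: lcoef_inj => k.
  have [/gm //|mk] := ltP k (- m%:Z); apply/eqP; apply: contrapT => /negP gk.
  by apply: h; exists (absz (k + m%:Z)%R); have -> : (absz (k + m%:Z)%R)%:Z - m%:Z = k by lia.
exists ((ex_minn ex)%:Z - m%:Z); case: ex_minnP => // n gn nmin i lt_in.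
have [/gm //|mi] := ltP i (- m%:Z); apply/eqP; apply: contrapT => /negP gi.
have : (n <= absz (i + m%:Z)%R)%N.
  by apply: nmin; have -> : (absz (i + m%:Z)%R)%:Z - m%:Z = i by lia.
lia.
Qed.

(** The exponents E are the roots of the indicial polynomial that occur among
    the exponents of the Puiseux solutions.  The coefficients at E determine a
    combination of these solutions, so that E has at least as many elements as
    there are independent solutions; in case of equality the coefficients
    at E can be prescribed. *)
Lemma local_exponents f M s (A : pdiffop algC) (d : {poly algC}) v :
  is_Lmin f M -> algebraic f ->
  map_poly (@tofrac {poly algC}) A = tofrac d *: localize s M ->
  shift_bound A v -> principal A v != 0 ->
  exists E : seq algC,
    [/\ uniq E, (ord M <= size E)%N,
        forall e, e \in E -> root (principal A v) e /\ exists q : rat, e = ratr q &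
        size E = ord M -> forall tau : algC -> algC, exists Y : gseries,
          [/\ log_free Y, forall e, capply A Y e = 0,
              exists N K : nat, forall e, Y e != 0 ->
                 exists2 k : int, N.+1%:R * e = k%:~R & - K%:Z <= k &
              forall e, e \in E -> Y e = (tau e)%:P]].
Proof.
move=> Mf falg dA Av P0.
have [N [gs [Mgs rk]]] := puiseux_solutions s Mf falg.
have N0 : N.+1%:R != 0 :> algC by rewrite pnatr_eq0.
pose n := size gs.
have [rs PE] := closed_field_poly_normal (principal A v).
have rootE x : root (principal A v) x = (x \in rs).
  by rewrite PE rootZ ?lead_coef_eq0 // root_prod_XsubC.
pose E := [seq x <- undup rs | N.+1%:R * x \is a Num.int].
pose idx (e : algC) : int := Num.floor (N.+1%:R * e).
have EP x : (x \in E) = (N.+1%:R * x \is a Num.int) && root (principal A v) x.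
  by rewrite mem_filter mem_undup rootE.
pose comb (c : 'rV[algC]_n) : laurent algC := \sum_(k < n) lau_const (c 0 k) * gs`_k.
have combA c e : capply A (to_gseries N (comb c)) e = 0.
  rewrite -to_gseries_apply dA op_actZ op_act_comb; first last.
  - by move=> k; exact: deriv_w_const.
  - exact: derivation_deriv_w.
  rewrite big1 ?mulr0; last by move=> k _; rewrite Mgs ?mulr0 ?mem_nth.
  by rewrite /to_gseries lcoef0 if_same.
have lcomb c k : lcoef (comb c) k = \sum_(i < n) c 0 i * lcoef gs`_i k.
  by rewrite lcoef_sum; apply: eq_bigr => i _; rewrite lcoefZ.
pose m := size E.
pose G : 'M[algC]_(n, m) := \matrix_(k, i) lcoef gs`_k (idx E`_i).
have combG c (i : 'I_m) : (c *m G) 0 i = lcoef (comb c) (idx E`_i).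
  by rewrite lcomb mxE; apply: eq_bigr => k _; rewrite mxE.
(* The leading exponent of a nonzero combination belongs to E. *)
have comb0 c : c *m G = 0 -> comb c = 0.
  move=> cG; apply/eqP; apply: contraT => /lcoef_lowest[k ck kmin].
  pose e : algC := k%:~R / N.+1%:R.
  have eE : N.+1%:R * e = k%:~R by rewrite mulrC divfK.
  have re : root (principal A v) e.
    apply: (leading_exponent_root Av (combA c)).
      by rewrite (to_gseriesE _ eE) polyC_eq0.
    move=> i i0; rewrite (@to_gseriesE _ _ _ (k - (N.+1 * i)%:Z)).
      by rewrite kmin //; lia.
    by rewrite mulrBr eE rmorphB /= -natrM.
  have eIn : e \in E by rewrite EP re eE intr_int.
  have lt : (index e E < m)%N by rewrite index_mem.
  have := combG c (Ordinal lt); rewrite cG mxE /= nth_index // /idx eE intrKfloor.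
  by move=> h; move: ck; rewrite -h eqxx.
(* A relation with constant coefficients between the rows of G holds between the
   solutions, hence between the rows of the matrix W of their derivatives. *)
have rankG : (ord M <= \rank G)%N.
  pose W := \matrix_(k < n, i < ord M) iter i (point_deriv N s) gs`_k.
  have derP : derivation (point_deriv N s) by apply/scale_derivation/derivation_deriv_w.
  have sub : (map_mx (@lau_const algC) (kermx G) <= kermx W)%MS.
    apply/sub_kermxP/row_matrixP => l; rewrite row_mul row0 -map_row.
    have := comb0 (row l (kermx G)); rewrite -row_mul mulmx_ker row0 => /(_ erefl) c0.
    apply/rowP => i; rewrite !mxE.
    have := congr1 (iter i (point_deriv N s)) c0.
    rewrite /comb (iter_deriv_comb derP); last first.
      by move=> k; rewrite /point_deriv deriv_w_const mulr0.
    move=> h; transitivity (iter i (point_deriv N s) 0); last first.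
      by elim: (i : nat) => // q IH; rewrite iterS IH (derivation0 derP).
    by rewrite -h; apply: eq_bigr => k _; rewrite !mxE.
  have := mxrankS sub; rewrite mxrank_map !mxrank_ker rk.
  have := rank_leq_row W; rewrite rk; have := rank_leq_row G.
  by rewrite -/n; move: (\rank G) => a; lia.
exists E; split.
- by rewrite filter_uniq ?undup_uniq.
- exact: leq_trans rankG (rank_leq_col G).
- move=> e; rewrite EP => /andP[/intrP[k kE] re]; split=> //.
  exists (k%:~R / N.+1%:R); rewrite fmorph_div rmorph_int rmorph_nat.
  by rewrite -kE mulrC mulKf.
- move=> mE tau.
  have full : row_full G.
    by rewrite /row_full eqn_leq rank_leq_col /=; apply: leq_trans rankG; rewrite -mE.
  have /submxP[c cE] : ((\row_(i < m) tau E`_i) <= G)%MS by exact: submx_full.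
  exists (to_gseries N (comb c)); split=> //.
  + exact: to_gseries_log_free.
  + have [K hK] := lcoef_bounded (comb c); exists N, K => e /to_gseries_neq0[k kE ck].
    by exists k => //; rewrite leNgt; apply: contra ck => /hK ->.
  + move=> e eIn; move: (eIn); rewrite EP => /andP[/intrP[k kE] _].
    rewrite (to_gseriesE _ kE); congr _%:P.
    have lt : (index e E < m)%N by rewrite index_mem.
    have := combG c (Ordinal lt); rewrite -cE mxE /= nth_index // /idx kE intrKfloor.
    by move=> ->.
Qed.

(** * Indicial polynomials at the points of the projective line *)

Lemma size_inv_deriv_exp i : size (inv_deriv_exp i) = i.+1.
Proof.
elim: i => [|i IH]; first by rewrite /inv_deriv_exp /= size_poly1.
rewrite [inv_deriv_exp i.+1]/(_ *: _) /= -/(inv_deriv_exp i).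
have T0 : inv_deriv_exp i != 0 by rewrite -size_poly_eq0 IH.
rewrite size_scale ?oppr_eq0 ?expf_neq0 ?polyX_eq0 //.
have sTX : size (inv_deriv_exp i * 'X) = i.+2 by rewrite size_mulX // IH.
by rewrite addrC size_polyDl sTX // ltnS (leq_trans (size_poly _ _)) // IH.
Qed.

Lemma size_localize s (M : rdiffop rat) : M != 0 -> size (localize s M) = size M.
Proof.
case: s => [c|] M0 /=.
  have -> : map_poly (rat_subst (tofrac ('X + c%:P))) M = map_poly (localize_coef (Some c)) M by [].
  exact: size_map_poly.
have sM : size M = (size M).-1.+1 by rewrite prednK ?size_poly_gt0.
have sB i : size (map_poly (@tofrac {poly algC}) (inv_deriv_exp i)) = i.+1.
  by rewrite size_map_tofrac size_inv_deriv_exp.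
rewrite sM big_ord_recr /= -lead_coefE addrC.
have lc0 : localize_coef None (lead_coef M) != 0 by rewrite fmorph_eq0 lead_coef_eq0.
have sl := size_scale (map_poly (@tofrac {poly algC}) (inv_deriv_exp (size M).-1)) lc0.
rewrite size_polyDl; rewrite sl sB // ltnS.
apply: (leq_trans (size_sum _ _ _)); apply/bigmax_leqP => i _.
by rewrite (leq_trans (size_scale_leq _ _)) // sB.
Qed.

Lemma indicial_principal_point s (M : rdiffop rat) (A : pdiffop algC) (d : {poly algC}) :
  M != 0 -> d != 0 -> map_poly (@tofrac {poly algC}) A = tofrac d *: localize s M ->
  exists v, [/\ shift_bound A v, principal A v != 0, (size (principal A v) <= size M)%N,
    size (principal A v) = size (indicial M s) &
    forall e, root (principal A v) e = root (indicial M s) e].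
Proof.
move=> M0 d0 dA; have sN := size_localize s M0.
have N0 : localize s M != 0 by rewrite -size_poly_eq0 sN size_poly_eq0.
have [v [Av PE [i Ai iv]]] := indicial_principal N0 d0 dA.
have ld := lowest_coef_neq0 d0.
exists v; split=> //.
- exact: principal_neq0 Ai iv.
- rewrite -sN; have := size_principal A v.
  by rewrite -(size_map_tofrac A) dA size_scale ?tofrac_eq0.
- by rewrite PE size_scale.
- by move=> e; rewrite PE rootZ.
Qed.

Lemma size_monic_ord (M : rdiffop rat) : M != 0 -> size M = (ord M).+1.
Proof. by move=> M0; rewrite /ord prednK ?size_poly_gt0. Qed.

(** The indicial polynomial has degree at most the order, and at least that many
    distinct rational roots. *)
Lemma algebraic_exponents f M s : is_Lmin f M -> algebraic f ->
  deg (indicial M s) = ord M /\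
  exists E : seq algC, [/\ uniq E, size E = ord M &
    forall e, e \in E -> root (indicial M s) e /\ exists q : rat, e = ratr q].
Proof.
move=> Mf falg; have [Mm _ _] := Mf; have M0 := monic_neq0 Mm.
have [d [A [d0 dA]]] := clear_denominators (localize s M).
have [v [Av P0 sP sPE PE]] := indicial_principal_point M0 d0 dA.
have [E [uE sE Eroot _]] := local_exponents Mf falg dA Av P0.
have lt : (size E < size (principal A v))%N.
  by apply: max_poly_roots => //; apply/allP => e /Eroot[].
rewrite (size_monic_ord M0) in sP.
have sEM : size E = ord M by apply/eqP; rewrite eqn_leq sE -ltnS (leq_trans lt sP).
split; last by exists E; split=> // e /Eroot[]; rewrite PE.
rewrite /deg -sPE; suff -> : size (principal A v) = (ord M).+1 by [].
by apply/eqP; rewrite eqn_leq sP -sEM.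
Qed.

(** * Formal solutions at the origin *)

Lemma gapply_capply (L : pdiffop rat) y e :
  gapply L y e = capply (map_poly (map_poly (@ratr algC)) L) y e.
Proof.
have inj : injective (map_poly (@ratr algC)) by exact: map_inj_poly (fmorph_inj _) (rmorph0 _).
rewrite /gapply /capply size_map_inj_poly ?rmorph0 //; apply: eq_bigr => i _.
rewrite /gscale coef_map_id0 ?rmorph0 // size_map_poly; apply: eq_bigr => j _.
by rewrite coef_map.
Qed.

Lemma clears_denominators_origin (M : rdiffop rat) L d : d != 0 ->
  map_poly (@tofrac {poly rat}) L = tofrac d *: M ->
  map_poly (@tofrac {poly algC}) (map_poly (map_poly (@ratr algC)) L) =
    tofrac (map_poly ratr d) *: localize (Some 0) M.
Proof.
move=> d0 dL; transitivity (map_poly (localize_coef (Some 0)) (map_poly (@tofrac {poly rat}) L)).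
  rewrite -!map_poly_comp; apply: eq_map_poly => p /=.
  by rewrite localize_coef_origin.
by rewrite dL map_polyZ /= localize_coef_origin.
Qed.

Lemma formal_solution_local (M : rdiffop rat) y : M != 0 -> formal_solution M y ->
  generalized_series y /\ exists (A : pdiffop algC) d v,
    [/\ map_poly (@tofrac {poly algC}) A = tofrac d *: localize (Some 0) M,
        d != 0, forall e, capply A y e = 0, shift_bound A v /\ principal A v != 0 &
        [/\ (size (principal A v) <= size M)%N,
            size (principal A v) = size (indicial M (Some 0)) &
            forall e, root (principal A v) e = root (indicial M (Some 0)) e]].
Proof.
move=> M0 [gen [L [d d0 dL] Ly]]; split=> //.
have dA := clears_denominators_origin d0 dL.
have d0' : map_poly (@ratr algC) d != 0 by rewrite map_poly_eq0.
have [v [Av P0 sP sPE PE]] := indicial_principal_point M0 d0' dA.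
exists (map_poly (map_poly (@ratr algC)) L), (map_poly ratr d), v.
by split=> // e; rewrite -gapply_capply.
Qed.

Lemma simple_roots (F : fieldType) (P : {poly F}) (E : seq F) :
  size P = (size E).+1 -> uniq E -> (forall e, e \in E -> root P e) ->
  (forall e, root P e = (e \in E)) /\ (forall e, root P e -> ~~ root P^`() e).
Proof.
move=> sP uE Eroot; have aE : all (root P) E by apply/allP.
have PE := all_roots_prod_XsubC sP aE; rewrite uniq_rootsE in PE.
have {}PE := PE uE; have l0 : lead_coef P != 0 by rewrite lead_coef_eq0 -size_poly_eq0 sP.
have rE e : root P e = (e \in E) by rewrite PE rootZ // root_prod_XsubC.
split=> // e re; have : separable_poly (\prod_(z <- E) ('X - z%:P)).
  by rewrite separable_prod_XsubC.
rewrite unlock => cop; rewrite PE derivZ rootZ //.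
by apply: (coprimep_root cop); rewrite root_prod_XsubC -rE.
Qed.

(** Let Y be the combination of Puiseux solutions whose coefficients at the
    exponents are the constant terms of y.  Where y - Y has its leading
    term, the coefficient is constant, since exponents are simple roots, and
    its constant term is zero. *)
Lemma algebraic_log_free f M y : is_Lmin f M -> algebraic f ->
  formal_solution M y -> log_free y.
Proof.
move=> Mf falg ysol; have [Mm _ _] := Mf; have M0 := monic_neq0 Mm.
have [[[rho yrho] _] [A [d [v [dA d0 yA [Av P0] [sP sPE _]]]]]] := formal_solution_local M0 ysol.
have [E [uE sE Eroot Esol]] := local_exponents Mf falg dA Av P0.
have lt : (size E < size (principal A v))%N.
  by apply: max_poly_roots => //; apply/allP => e /Eroot[].
rewrite (size_monic_ord M0) in sP.
have sEM : size E = ord M by apply/eqP; rewrite eqn_leq sE -ltnS (leq_trans lt sP).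
have sPM : size (principal A v) = (size E).+1 by apply/eqP; rewrite eqn_leq lt sEM sP.
have [rE simple] := simple_roots sPM uE (fun e h => proj1 (Eroot e h)).
have [Y [Ylf YA [N [K YK]] YE]] := Esol sEM (fun e => (y e)`_0).
(* Y may involve several classes of exponents modulo the integers, y only one. *)
pose z : gseries := fun e => y e - exponent_class rho Y e.
have zA e : capply A z e = 0.
  by rewrite capplyB capply_exponent_class yA /exponent_class YA if_same subr0.
have zrho e : z e != 0 -> e - rho \is a Num.int.
  rewrite /z /exponent_class; case: ifP => //= ne; rewrite subr0 => /yrho/natrP[n nE].
  by move: ne; rewrite nE natr_int.
suff z0 e : z e = 0.
  move=> e; have /eqP := z0 e; rewrite subr_eq0 => /eqP ->.
  by rewrite /exponent_class; case: ifP => _; [exact: Ylf|rewrite size_poly0].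
apply/eqP; apply: contraT => ze.
(* Going down from e by integers one leaves the supports of y and Y. *)
have [J zJ] : exists J : nat, forall j : nat, z (e - j%:R) != 0 -> (j <= J)%N.
  have /intrP[k ek] := zrho _ ze.
  have [/intrP[l el]|nint] := boolP (N.+1%:R * e \is a Num.int).
    exists (absz k + absz (l + K%:Z)%R)%N => j zj.
    case: (eqVneq (y (e - j%:R)) 0) => [yj|/yrho].
      have : Y (e - j%:R) != 0.
        apply: contraNneq zj => Yj; rewrite /z yj /exponent_class Yj.
        by rewrite if_same subr0.
      case/YK => i; rewrite mulrBr el -natrM => /eqP.
      have -> : l%:~R - (N.+1 * j)%:R = (l - (N.+1 * j)%:Z)%:~R :> algC by rewrite rmorphB.
      by rewrite eqr_int => /eqP <-; nia.
    have -> : e - j%:R - rho = (k - j%:Z)%:~R by rewrite addrAC ek rmorphB.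
    rewrite natrEint ler0z => /andP[_]; lia.
  exists (absz k) => j zj.
  case: (eqVneq (y (e - j%:R)) 0) => [yj|/yrho].
    have : Y (e - j%:R) != 0.
      apply: contraNneq zj => Yj; rewrite /z yj /exponent_class Yj.
      by rewrite if_same subr0.
    case/YK => i ei _; case/negP: nint.
    have -> : N.+1%:R * e = i%:~R + (N.+1 * j)%:R by rewrite -ei mulrBr natrM subrK.
    by rewrite rpredD ?intr_int ?natr_int ?natr_nat.
  have -> : e - j%:R - rho = (k - j%:Z)%:~R by rewrite addrAC ek rmorphB.
  rewrite natrEint ler0z => /andP[_]; lia.
have ex : exists j : nat, z (e - j%:R) != 0 by exists 0%N; rewrite subr0.
case: (ex_maxnP ex zJ) => j zj jmax.
have low k : (0 < k)%N -> z (e - j%:R - k%:R) = 0.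
  move=> k0; apply/eqP; apply: contraT => zk.
  have := jmax (j + k)%N; rewrite natrD opprD addrA => /(_ zk).
  by rewrite -{2}[j]addn0 leq_add2l leqNgt k0.
have re := leading_exponent_root Av zA zj low.
have /size1_polyC zC := leading_coef_log_free Av zA zj low (simple _ re).
have int := zrho _ zj; move: zj; rewrite zC polyC_eq0 /z coefB /exponent_class int.
by rewrite YE -?rE // coefC subrr eqxx.
Qed.

(** * The outcome T *)

Lemma loop_OutT M ss : loop M ss OutT -> exists s, loop_body M s (Some OutT).
Proof.
move=> h; move E : OutT h => v h; elim: h E => [|s ss' v' hb|s ss' v' _ _ IH] E //; first by exists s.
exact: IH.
Qed.

Lemma loop_OutA M ss : loop M ss OutA -> forall s, s \in ss -> loop_body M s None.
Proof.
move=> h; move E : OutA h => v h; elim: h E => [|s ss' v' hb|s ss' v' hb _ IH] E; first by [].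
  by move: hb; rewrite -E => hb; inversion hb.
by move=> x; rewrite inE => /predU1P[->//|]; exact: IH.
Qed.

Lemma GBTest_OutT_transcendental L f0 f : specifies L f0 f ->
  GBTest L f0 OutT -> transcendental f.
Proof.
move=> [Lf sf uf] [f' [M [ss [[Lf' sf' _] Mf' _ hloop]]]].
have {Lf' sf'} ff : f' = f by apply/funext; exact: uf.
rewrite {}ff in Mf' => falg.
have [s hs] := loop_OutT hloop; have [degE [E [uE sE Eroot]]] := algebraic_exponents s Mf' falg.
inversion hs as [irr|Z od zZ sZ|Z B od zZ sZ s0 gaps [B' [B'sol _] trunc] nlog| |]; subst.
- by move: irr; rewrite degE ltnn.
- move: sZ; rewrite degE -sE -(size_map (@ratr algC)) ltnNge => /negP[].
  apply: uniq_leq_size => // e eE; have [re [q qe]] := Eroot e eE.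
  by rewrite qe; apply: map_f; apply/(proj2 zZ); rewrite -qe.
- case: nlog => i e; have [e0 _ ->] := trunc i; case: ifP => _; last by rewrite size_poly0.
  exact: algebraic_log_free Mf' falg (B'sol i) e.
Qed.

(** * Log-free fundamental systems at the origin *)

Lemma formal_solution_series_at (M : rdiffop rat) L d e0 c : d != 0 ->
  map_poly (@tofrac {poly rat}) L = tofrac d *: M ->
  (forall e, capply (map_poly (map_poly (@ratr algC)) L) (series_at e0 c) e = 0) ->
  formal_solution M (series_at e0 c).
Proof.
move=> d0 dL cap; split; last first.
  by exists L; [exists d|move=> e; rewrite gapply_capply].
split.
  by exists e0 => e; rewrite /series_at; case: ifP => //; rewrite eqxx.
exists 1%N => e; rewrite /series_at; case: ifP => _; rewrite ?size_poly0 //.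
by rewrite size_polyC leq_b1.
Qed.

Lemma series_at_log_free e0 c : log_free (series_at e0 c).
Proof.
move=> e; rewrite /series_at; case: ifP => _; rewrite ?size_poly0 //.
by rewrite size_polyC leq_b1.
Qed.

(** The points pt j provide linear forms dual to the solutions, whence their
    independence. *)
Lemma log_free_system_of_dual (M : rdiffop rat) (pt : 'I_(ord M) -> algC) :
  (forall i, exists Y, [/\ formal_solution M Y, log_free Y &
     forall j, Y (pt j) = (i == j)%:R%:P]) ->
  has_log_free_fundamental_system M.
Proof.
move=> /choice[B BP]; exists B; last by move=> i; have [] := BP i.
split=> [i|c c0 j]; first by have [] := BP i.
have := c0 (pt j); rewrite (bigD1 j) //= big1 => [|i ij]; last first.
  by have [_ _ ->] := BP i; rewrite (negPf ij) polyC0 scaler0.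
have [_ _ ->] := BP j; rewrite eqxx addr0 scale_polyC mulr1 => /eqP.
by rewrite polyC_eq0 => /eqP.
Qed.

Lemma nat_sub_nat (e : algC) n k : (e + n%:R) - k%:R - e \is a Num.nat = (k <= n)%N.
Proof.
have -> : e + n%:R - k%:R - e = (n%:Z - k%:Z)%:~R by rewrite rmorphB /=; ring.
by rewrite natrEint intr_int ler0z subr_ge0.
Qed.

Lemma max_gap_ge Z d : d \in exponent_gaps Z -> (d <= max_gap Z)%N.
Proof. by move=> h; rewrite /max_gap (big_rem d) //= leq_maxl. Qed.

Lemma mem_exponent_gaps Z a b n : a \in Z -> b \in Z -> a = b + n.+1%:R ->
  n.+1 \in exponent_gaps Z.
Proof.
move=> aZ bZ ab; apply/mapP; exists n.+1%:R; last by rewrite natrK.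
rewrite mem_filter natr_nat ltr0n /=; apply/allpairsP; exists (a, b); split=> //=.
by rewrite ab addrAC subrr add0r ger0_norm ?ler0n.
Qed.

(** P has no more roots than its degree, and Z provides that many. *)
Lemma rational_zeros_complete P Z e : P != 0 -> rational_zeros P Z ->
  (deg P <= size Z)%N -> root P e -> exists2 q, q \in Z & e = ratr q.
Proof.
move=> P0 [uZ ZP] sZ re; have [/mapP[q qZ ->]|ne] := boolP (e \in map (@ratr algC) Z).
  by exists q.
have : (size (e :: map (@ratr algC) Z) < size P)%N.
  apply: max_poly_roots => //=; last by rewrite ne map_inj_uniq //; exact: fmorph_inj.
  by rewrite re; apply/allP => x /mapP[q qZ ->]; apply/ZP.
rewrite /= size_map; move: sZ; rewrite /deg; case: (size P) => // k.
by rewrite ltnS => h1 h2; have := leq_trans h2 h1; rewrite ltnn.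
Qed.

(** Beyond the largest gap between exponents the recurrence for the
    coefficients is never degenerate, so that logarithms can only show up in the
    truncation. *)
Lemma truncation_log_free (M : rdiffop rat) Z y t : M != 0 ->
  rational_zeros (indicial M (Some 0)) Z -> (deg (indicial M (Some 0%R)) <= size Z)%N ->
  formal_solution M y -> truncated_at (max_gap Z) y t -> log_free t -> log_free y.
Proof.
move=> M0 zZ sZ ysol [e0 [ye0 yexp] tE] tlf.
have [_ [A [d [v [dA d0 yA [Av P0] [_ sPE PE]]]]]] := formal_solution_local M0 ysol.
have I0 : indicial M (Some 0) != 0 by rewrite -size_poly_eq0 -sPE size_poly_eq0.
have r0 : root (principal A v) e0.
  apply: (leading_exponent_root Av yA ye0) => k k0; apply/eqP; apply: contraT => /yexp.
  by have := nat_sub_nat e0 0 k; rewrite addr0 => ->; rewrite leqNgt k0.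
have [b bZ e0E] : exists2 q, q \in Z & e0 = ratr q.
  by apply: (rational_zeros_complete I0) => //; rewrite -PE.
have step n : (size (y (e0 + n%:R)%R) <= 1)%N.
  elim/ltn_ind: n => n IH.
  have [nm|nm] := leqP n (max_gap Z).
    have := tlf (e0 + n%:R); rewrite tE addrAC subrr add0r natr_nat ler_nat nm //.
  apply: (log_free_step Av yA) => [k k0|].
    have [kn|kn] := leqP k n.
      have -> : e0 + n%:R - k%:R = e0 + (n - k)%:R by rewrite natrB // addrA.
      by apply: IH; rewrite ltn_subrL k0 (leq_trans k0 kn).
    suff -> : y (e0 + n%:R - k%:R) = 0 by rewrite size_poly0.
    by apply/eqP; apply: contraT => /yexp; rewrite nat_sub_nat leqNgt kn.
  apply/negP; rewrite PE => re.
  have [a aZ aE] := rational_zeros_complete I0 zZ sZ re.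
  case: n nm {IH re} aE => // n nm aE; suff /max_gap_ge : n.+1 \in exponent_gaps Z.
    by rewrite leqNgt nm.
  apply: (@mem_exponent_gaps _ a b) => //; apply: (fmorph_inj (@ratr algC)).
  by rewrite /= rmorphD rmorph_nat /= -aE -e0E.
move=> e; have [->|ye] := eqVneq (y e) 0; first by rewrite size_poly0.
have /natrP[n nE] := yexp e ye; have -> : e = e0 + n%:R by rewrite -nE addrC subrK.
exact: step.
Qed.

(** Each exponent starts its own solution, since no root of the indicial
    polynomial comes later in its class. *)
Lemma no_gap_log_free (M : rdiffop rat) Z : M != 0 ->
  rational_zeros (indicial M (Some 0)) Z -> (ord M <= size Z)%N ->
  exponent_gaps Z = [::] -> has_log_free_fundamental_system M.
Proof.
move=> M0 zZ sZ gaps; have [uZ ZP] := zZ.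
have [d [L [d0 dL]]] := clear_denominators M.
have dA := clears_denominators_origin d0 dL.
have d0' : map_poly (@ratr algC) d != 0 by rewrite map_poly_eq0.
have [v [Av P0 _ _ PE]] := indicial_principal_point M0 d0' dA.
set A := map_poly _ L in dA Av P0 PE.
pose pt (i : 'I_(ord M)) : algC := ratr Z`_i.
have ptZ (i : 'I_(ord M)) : Z`_i \in Z by rewrite mem_nth // (leq_trans (ltn_ord i)).
have nogap a b n : a \in Z -> b \in Z -> (ratr a : algC) = ratr b + n.+1%:R -> False.
  move=> aZ bZ ab; have : n.+1 \in exponent_gaps Z; last by rewrite gaps.
  apply: (mem_exponent_gaps aZ bZ); apply: (fmorph_inj (@ratr algC)).
  by rewrite rmorphD rmorph_nat.
apply: (log_free_system_of_dual (pt := pt)) => i.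
have [|n n0|c [c0 cA]] := @frobenius_solution A v Av (pt i) 0 (fun n => (n == 0%N)%:R).
- move=> n; rewrite leqn0 => /eqP ->; rewrite addr0 mulr1.
  have /eqP -> : root (principal A v) (pt i) by rewrite PE; apply/ZP.
  rewrite (remainder_eq0 Av) ?coef0 ?addr0 // => k k0; rewrite /series_at.
  by have := nat_sub_nat (pt i) 0 k; rewrite addr0 => ->; rewrite leqNgt k0.
- apply/negP; rewrite PE; case: n n0 => // n _ re.
  have re' : root (indicial M (Some 0)) (ratr (Z`_i + n.+1%:R)).
    by rewrite rmorphD rmorph_nat.
  by apply: (nogap (Z`_i + n.+1%:R) Z`_i n) => //; [apply/ZP|rewrite rmorphD rmorph_nat].
exists (series_at (pt i) c); split.
- exact: formal_solution_series_at d0 dL cA.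
- exact: series_at_log_free.
move=> j; have [<-|ij] := eqVneq i j.
  by have := series_atE (pt i) c 0; rewrite addr0 => ->; rewrite c0.
rewrite /series_at; case: ifP => // /natrP[[|n] nE].
  case/negP: ij; have : Z`_j = Z`_i.
    by apply: (fmorph_inj (@ratr algC)); apply/eqP; rewrite -subr_eq0 -/(pt j) -/(pt i) nE.
  move/eqP; rewrite nth_uniq ?(leq_trans (ltn_ord _)) // => /eqP ji.
  by apply/eqP/val_inj.
by case: (@nogap Z`_j Z`_i n) => //; rewrite -nE -/(pt j) -/(pt i) addrC subrK.
Qed.

Lemma falling_root i j : (j < i)%N -> (falling i).[j%:R] = 0.
Proof.
move=> ji; apply/eqP; rewrite horner_prod prodf_seq_eq0; apply/hasP.
by exists (Ordinal ji); rewrite ?mem_index_enum //= hornerXsubC subrr.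
Qed.

Lemma falling_nonroot i n : (i <= n)%N -> ~~ root (falling i) n%:R.
Proof.
move=> le_in; rewrite /root horner_prod; apply/prodf_neq0 => k _.
by rewrite hornerXsubC subr_eq0 eqr_nat gtn_eqF // (leq_trans (ltn_ord k)).
Qed.

Fact shift_lt (i r j mu : nat) : i%:Z - j%:Z = r%:Z - mu%:Z -> (i < r)%N -> (j < mu)%N.
Proof. by lia. Qed.

Fact shift_eq (r j mu : nat) : r%:Z - j%:Z = r%:Z - mu%:Z -> j = mu.
Proof. by lia. Qed.

Fact shift_source (n r mu i k p : nat) :
  n%:Z - (r%:Z - mu%:Z - i%:Z + k%:Z) = p%:Z -> (n < r)%N -> (mu <= k)%N -> (p < i)%N.
Proof. by lia. Qed.

(** Cauchy's theorem: the exponents at an ordinary point are 0, ..., r - 1, and the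
    first r coefficients of a solution are arbitrary, because the recurrence
    is trivial at these exponents. *)
Lemma ordinary_log_free (M : rdiffop rat) : M \is monic ->
  ~~ singularity M (Some 0) -> has_log_free_fundamental_system M.
Proof.
move=> Mm ns; have M0 := monic_neq0 Mm.
have [d [L [d0 dL]]] := clear_denominators M.
have dA := clears_denominators_origin d0 dL.
have d0' : map_poly (@ratr algC) d != 0 by rewrite map_poly_eq0.
set A := map_poly _ L in dA; set da := map_poly _ d in dA d0'.
pose r := ord M; have sM : size M = r.+1 := size_monic_ord M0.
have sA : size A = r.+1.
  rewrite -sM -(size_localize (Some 0) M0) -(size_scale _ (_ : tofrac da != 0)) ?tofrac_eq0 //.
  by rewrite -dA size_map_tofrac.
pose mu := mup 0 da.
have Nlead : lead_coef (localize (Some 0) M) = 1.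
  have -> : localize (Some 0) M = map_poly (localize_coef (Some 0)) M by [].
  by rewrite lead_coef_map (monicP Mm) rmorph1.
have AE i : tofrac A`_i = tofrac da * (localize (Some 0) M)`_i.
  by have := congr1 (fun p : {poly {fraction {poly algC}}} => p`_i) dA; rewrite coef_map coefZ.
have Ar : A`_r = da.
  apply: (@tofrac_inj {poly algC}); rewrite AE.
  by move: Nlead; rewrite lead_coefE size_localize // sM /= => ->; rewrite mulr1.
(* M has no pole at the origin, so d divides A up to a unit at the origin. *)
have low i j : (j < mu)%N -> A`_i`_j = 0.
  move=> jm; have [->|Ai] := eqVneq A`_i 0; first by rewrite coef0.
  have lt : (i < size (localize (Some 0%R) M))%N.
    by rewrite size_localize // sM -sA ltnNge; apply: contra Ai => h; rewrite nth_default.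
  have NE : (localize (Some 0) M)`_i = tofrac A`_i / tofrac da.
    by rewrite AE mulrC mulKf // tofrac_eq0.
  move: ns; rewrite /singularity /singular0 => /existsPn/(_ (Ordinal lt)).
  rewrite /pole0 Nlead divr1 /= NE mulf_eq0 invr_eq0 !tofrac_eq0 (negPf Ai) (negPf d0') /=.
  rewrite val0_div // -leNgt subr_ge0 lez_nat => h.
  by apply: coef_lt_mup; apply: leq_trans h.
pose v := r%:Z - mu%:Z.
have Ar0 i j : A`_i`_j != 0 -> (i <= r)%N /\ (mu <= j)%N.
  move=> Aij; split; last by rewrite leqNgt; apply: contra Aij => /low ->.
  rewrite leqNgt; apply: contra Aij => ri.
  by rewrite [A`_i]nth_default ?coef0 // sA.
have Av : shift_bound A v by move=> i j /Ar0[h1 h2]; rewrite /v; lia.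
have PE : principal A v = lowest_coef da *: falling r.
  rewrite /principal sA big_ord_recr /= big1 ?add0r; last first.
    move=> i _; rewrite big1 // => j /eqP ij; rewrite low ?scale0r //.
    exact: shift_lt ij (ltn_ord i).
  rewrite Ar; have mA : (mu < size da)%N.
    rewrite ltnNge; apply: contra (lowest_coef_neq0 d0') => h.
    by rewrite /lowest_coef nth_default.
  rewrite (bigD1 (Ordinal mA)) //= big1 ?addr0 // => j /andP[/eqP rj].
  by rewrite -val_eqE /= => /eqP[]; exact: shift_eq rj.
have ld := lowest_coef_neq0 d0'.
apply: (log_free_system_of_dual (pt := fun i => (i : nat)%:R)) => j.
have r0 : (0 < r)%N by apply: leq_ltn_trans (ltn_ord j).
have [|n n0|c [c0 cA]] := @frobenius_solution A v Av 0 r.-1 (fun n => (n == j)%:R).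
(* A term linking exponents j and n < r would have falling factorial of order
   i > j at j, hence vanish. *)
- move=> n nr; have {}nr : (n < r)%N by rewrite -(prednK r0).
  rewrite add0r PE hornerZ falling_root // mulr0 mul0r add0r.
  rewrite /remainder big1 ?coef0 // => i _; rewrite big1 // => k ik.
  have [->|Aik] := eqVneq A`_i`_k 0; first by rewrite scale0r.
  have [ir mk] := Ar0 _ _ Aik.
  rewrite /series_at subr0; case: ifP => [/natrP[p pE]|_]; last by rewrite log_act0r scaler0.
  rewrite pE natrK log_actC; have [pj|] := eqVneq p j; last by rewrite mulr0 scaler0.
  have pE' : n%:Z - (v - (i : nat)%:Z + (k : nat)%:Z) = p%:Z.
    by apply/eqP; rewrite -(eqr_int algC) rmorphB /= pE.
  rewrite falling_root ?mul0r ?scaler0 // {pj}.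
  exact: shift_source pE' nr mk.
- rewrite add0r PE rootZ //; apply: falling_nonroot.
  by rewrite -(prednK r0).
exists (series_at 0 c); split.
- exact: formal_solution_series_at d0 dL cA.
- exact: series_at_log_free.
move=> i; have := series_atE 0 c i; rewrite add0r => ->.
by rewrite c0 1?eq_sym // -ltnS prednK.
Qed.

(** The zero operator annihilates every series, so that no initial segment
    specifies one. *)
Lemma specifies_D_finite L f0 f : specifies L f0 f -> D_finite f.
Proof.
move=> [Lf sf uf]; exists L; split=> //; apply/eqP => L0.
pose g : series := fun n => if (n < size f0)%N then f n else f n + 1.
have gf : g =1 f.
  apply: uf => n; first by rewrite L0 /op_apply size_poly0 big_ord0.
  by move=> h; rewrite /g h; exact: sf.
have /eqP := gf (size f0); rewrite /g ltnn.
by rewrite -subr_eq0 addrAC subrr add0r oner_eq0.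
Qed.

Lemma OutA_log_free (M : rdiffop rat) ss : M \is monic ->
  enumerates (singularity M) ss -> loop M ss OutA -> has_log_free_fundamental_system M.
Proof.
move=> Mm [_ ssP] hloop; have M0 := monic_neq0 Mm.
have [sing|] := boolP (singularity M (Some 0)); last exact: ordinary_log_free.
have hs := loop_OutA hloop (proj2 (ssP (Some 0)) sing).
inversion hs as [| | |Z T od zZ sZ _ gaps [B [Bsol Bind] trunc] Tlf|Z od zZ sZ ngaps].
  exists B => [|i]; first by split.
  exact: truncation_log_free M0 zZ sZ (Bsol i) (trunc i) (Tlf i).
apply: (no_gap_log_free M0 zZ); first exact: leq_trans od sZ.
by apply: contrapT => h; apply: ngaps.
Qed.

Theorem theorem12 (L : pdiffop rat) (f0 : seq rat) (f : series)
    (Lf : specifies L f0 f) :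
  (GBTest L f0 OutT -> transcendental f) /\
  (globally_bounded f -> Christol_Andre -> GBTest L f0 OutA -> algebraic f).
Proof.
split; first exact: GBTest_OutT_transcendental Lf.
move=> gb CA [f' [M [ss [[Lf' sf' _] Mf' ssP hloop]]]].
have ff : f' = f by apply/funext; have [_ _ uf] := Lf; exact: uf.
rewrite {}ff in Mf'.
apply: (CA f M gb (specifies_D_finite Lf) Mf').
by have [Mm _ _] := Mf'; exact: OutA_log_free Mm ssP hloop.
Qed.
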